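(* Suppose that $U$ is a torsion-free bialgebra over a principal ideal domain $R$, and suppose that the Lie algebra of primitive elements of $U$ is a free $R$-module. If $U$ is generated as an algebra by all coefficients $a_i$ of some set of group-like elements $1+a_1x+a_2x^2+\cdots\in U[[x]]$, then $U$ is a Hopf algebra with a structural basis.
   Context: An element $a(x)=\sum a_nx^n\in U[[x]]$ is group-like if $\Delta(a(x))=a(x)\otimes a(x)$, i.e. $\Delta(a_n)=\sum_{0\le m\le n}a_m\otimes a_{n-m}$ for all $n$. An element $a\in U$ is primitive if $\Delta(a)=a\otimes1+1\otimes a$; the primitive elements form a Lie algebra under the commutator. Let $\mathbb Z_{\ge0}^{(I)}$ be the set of functions $I\to\mathbb Z_{\ge 0}$ vanishing at all but finitely many elements of the set $I$, with the pointwise partial order. A structural basis of $U$ over $R$ is a basis $\{Z_\alpha\}_{\alpha\in\mathbb Z_{\ge 0}^{(I)}}$ of $U$ as a free $R$-module (for some set $I$), with $Z_0=1$, such that $\Delta(Z_\alpha)=\sum_{0\le\beta\le\alpha}Z_\beta\otimes Z_{\alpha-\beta}$ for all $\alpha$. A Hopf algebra is a bialgebra that has an antipode. *)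

(* Defs.v *)
From HB Require Import structures.
From mathcomp Require Import all_boot all_algebra finmap multiset.
From mathcomp Require Import generic_quotient ring_quotient.
From mathcomp Require Import boolp classical_sets functions cardinality fsbigop.
From mathcomp Require Import monalg.

Set Implicit Arguments.
Unset Strict Implicit.
Unset Printing Implicit Defensive.

Import GRing.Theory.

Local Open Scope classical_set_scope.
Local Open Scope ring_scope.
Local Open Scope quotient_scope.

(* -------------------------------------------------------------------- *)
(* {malg R[I]} is the free R-module on I, i.e. the finitely supported
   functions I -> R. *)

Definition lincomb (R : comNzRingType) (I : choiceType) (M : lmodType R)
    (b : I -> M) (c : {malg R[I]}) : M :=
  \sum_(i <- msupp c) c@_i *: b i.

Section LinComb.
Context (R : comNzRingType) (I : choiceType) (M : lmodType R) (b : I -> M).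
Implicit Types c : {malg R[I]}.

Lemma lincombEw (d : {fset I}) c : fsubset (msupp c) d ->
  lincomb b c = \sum_(i <- d) c@_i *: b i.
Proof.
move=> le; rewrite /lincomb (big_fset_incl _ le) //= => x xd /mcoeff_outdom ->.
by rewrite scale0r.
Qed.

Lemma lincomb_is_linear : linear (lincomb b).
Proof.
move=> a c1 c2.
pose d := fsetU (msupp (a *: c1 + c2)) (fsetU (msupp c1) (msupp c2)).
rewrite !(@lincombEw d) /d ?fsubsetUl //; last 2 first.
- by apply/fsubsetP => x; rewrite !inE => ->; rewrite !orbT.
- by apply/fsubsetP => x; rewrite !inE => ->; rewrite !orbT.
rewrite scaler_sumr -big_split /=; apply: eq_bigr => i _.
by rewrite mcoeffD mcoeffZ scalerDl scalerA.
Qed.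

HB.instance Definition _ :=
  GRing.isLinear.Build R {malg R[I]} M *:%R (lincomb b) lincomb_is_linear.

Lemma lincombU i : lincomb b << i >> = b i.
Proof. by rewrite (lincombEw msuppU_le) big_seq_fset1 mcoeffUU scale1r. Qed.

End LinComb.

Definition module_basis (R : comNzRingType) (M : lmodType R) (S : set M)
    (I : choiceType) (b : I -> M) : Prop :=
  (forall i, S (b i)) /\
  forall x, S x -> exists! c : {malg R[I]}, x = lincomb b c.

Definition free_submodule (R : comNzRingType) (M : lmodType R) (S : set M) :=
  exists (I : choiceType) (b : I -> M), module_basis S b.

Definition torsion_free (R : idomainType) (M : lmodType R) : Prop :=
  forall (r : R) (x : M), r *: x = 0 -> r = 0 \/ x = 0.

(* Ideals are the submodules of the regular module R^o. *)
Definition principal_ideal_domain (R : idomainType) : Prop :=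
  forall J : {pred R^o}, GRing.submod_closed J ->
    exists d : R, forall x : R, (x \in J) <-> exists c : R, x = c * d.

Definition bilinear_map (R : comNzRingType) (M N P : lmodType R)
    (f : M -> N -> P) : Prop :=
  (forall y, linear (f^~ y)) /\ (forall x, linear (f x)).

(* -------------------------------------------------------------------- *)
(* M (x) N is the quotient of the free module on M * N by the submodule
   spanned by the bilinearity relations. *)

(* The operations below are locked: conversion never needs to look inside. *)
Fact tens_key : unit. Proof. by []. Qed.

Section Tensor.
Context (R : comNzRingType) (M N : lmodType R).

Let F := {malg R[(M * N)%type]}.
Let e (x : M) (y : N) : F := << (x, y) >>.

Inductive tens_relation : F -> Prop :=
| TensAddl x x' y : tens_relation (e (x + x') y - e x y - e x' y)
| TensAddr x y y' : tens_relation (e x (y + y') - e x y - e x y')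
| TensScalel a x y : tens_relation (e (a *: x) y - a *: e x y)
| TensScaler a x y : tens_relation (e x (a *: y) - a *: e x y).

Definition tens_null : {pred F} := fun z =>
  `[< forall S : {pred F}, GRing.submod_closed S ->
      (forall r, tens_relation r -> r \in S) -> z \in S >].

Lemma tens_nullP z :
  reflect (forall S : {pred F}, GRing.submod_closed S ->
             (forall r, tens_relation r -> r \in S) -> z \in S)
          (z \in tens_null).
Proof. exact: asboolP. Qed.

Lemma tens_null_submod : GRing.submod_closed tens_null.
Proof.
split=> [|a u v /tens_nullP Hu /tens_nullP Hv]; apply/tens_nullP => S HS Hr.
  by case: HS.
by case: (HS) => _; apply; [exact: Hu | exact: Hv].
Qed.

HB.instance Definition _ := GRing.isSubmodClosed.Build R F tens_null
  (GRing.submod_closed_semi tens_null_submod).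

Definition tensor : Type := {ideal_quot tens_null}.

HB.instance Definition _ := Choice.on tensor.

Definition tens_pi (z : F) : tensor := \pi_{ideal_quot tens_null} z.
Definition tens_repr (t : tensor) : F := repr (t : {ideal_quot tens_null}).

Lemma tens_pi_repr (t : tensor) : tens_pi (tens_repr t) = t.
Proof. exact: reprK. Qed.

Lemma tens_pi_eq z z' : z - z' \in tens_null -> tens_pi z = tens_pi z'.
Proof. by move=> H; apply/eqP; rewrite /tens_pi -Quotient.idealrBE. Qed.

Lemma tens_piB z z' : tens_pi z = tens_pi z' -> z - z' \in tens_null.
Proof. by move=> H; rewrite Quotient.idealrBE; apply/eqP. Qed.

Definition tens_zero : tensor := locked_with tens_key (tens_pi 0).
Definition tens_add : tensor -> tensor -> tensor :=
  locked_with tens_key (fun t u => tens_pi (tens_repr t + tens_repr u)).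
Definition tens_opp : tensor -> tensor :=
  locked_with tens_key (fun t => tens_pi (- tens_repr t)).

Lemma tens_piD_subproof z z' :
  tens_pi (z + z') = tens_add (tens_pi z) (tens_pi z').
Proof.
rewrite /tens_add locked_withE.
apply: tens_pi_eq; rewrite opprD addrACA.
by rewrite rpredD //; apply: tens_piB; rewrite tens_pi_repr.
Qed.

Lemma tens_piN_subproof z : tens_pi (- z) = tens_opp (tens_pi z).
Proof.
rewrite /tens_opp locked_withE.
apply: tens_pi_eq; rewrite -opprD rpredN.
by apply: tens_piB; rewrite tens_pi_repr.
Qed.

Lemma tens_addA : associative tens_add.
Proof.
move=> t u v; rewrite -[t]tens_pi_repr -[u]tens_pi_repr -[v]tens_pi_repr.
by rewrite -!tens_piD_subproof addrA.
Qed.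

Lemma tens_addC : commutative tens_add.
Proof.
move=> t u; rewrite -[t]tens_pi_repr -[u]tens_pi_repr.
by rewrite -!tens_piD_subproof addrC.
Qed.

Lemma tens_add0 : left_id tens_zero tens_add.
Proof.
move=> t; rewrite -[t]tens_pi_repr /tens_zero locked_withE.
by rewrite -tens_piD_subproof add0r.
Qed.

Lemma tens_addN : left_inverse tens_zero tens_opp tens_add.
Proof.
move=> t; rewrite -[t]tens_pi_repr -tens_piN_subproof -tens_piD_subproof.
by rewrite addNr /tens_zero locked_withE.
Qed.

HB.instance Definition _ := GRing.isZmodule.Build tensor
  tens_addA tens_addC tens_add0 tens_addN.

Lemma tens_piD z z' : tens_pi (z + z') = tens_pi z + tens_pi z'.
Proof. exact: tens_piD_subproof. Qed.

Definition tens_scale : R -> tensor -> tensor :=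
  locked_with tens_key (fun a t => tens_pi (a *: tens_repr t)).

Lemma tens_piZ a z : tens_pi (a *: z) = tens_scale a (tens_pi z).
Proof.
rewrite /tens_scale locked_withE.
apply: tens_pi_eq; rewrite -scalerBr rpredZ //; apply: tens_piB.
by rewrite tens_pi_repr.
Qed.

Lemma tens_scaleA a b t : tens_scale a (tens_scale b t) = tens_scale (a * b) t.
Proof. by rewrite -[t]tens_pi_repr -!tens_piZ scalerA. Qed.

Lemma tens_scale1 : left_id 1 tens_scale.
Proof. by move=> t; rewrite -[t]tens_pi_repr -!tens_piZ scale1r. Qed.

Lemma tens_scaleDr : right_distributive tens_scale +%R.
Proof.
move=> a t u; rewrite -[t]tens_pi_repr -[u]tens_pi_repr.
by rewrite -tens_piD -!tens_piZ scalerDr tens_piD.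
Qed.

Lemma tens_scaleDl t : {morph tens_scale^~ t : a b / a + b}.
Proof.
by move=> a b; rewrite -[t]tens_pi_repr -!tens_piZ scalerDl tens_piD.
Qed.

HB.instance Definition _ := GRing.Zmodule_isLmodule.Build R tensor
  tens_scaleA tens_scale1 tens_scaleDr tens_scaleDl.

Lemma tens_pi_is_linear : linear tens_pi.
Proof. by move=> a z z'; rewrite tens_piD tens_piZ. Qed.

HB.instance Definition _ :=
  GRing.isLinear.Build R F tensor *:%R tens_pi tens_pi_is_linear.

Definition tens : M -> N -> tensor :=
  locked_with tens_key (fun x y => tens_pi (e x y)).

Lemma tensE x y : tens x y = tens_pi (e x y).
Proof. by rewrite /tens locked_withE. Qed.

Lemma tens_pi_relation r : tens_relation r -> tens_pi r = 0.
Proof.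
move=> Hr; rewrite -[0](raddf0 tens_pi); apply: tens_pi_eq; rewrite subr0.
by apply/tens_nullP => S _; apply.
Qed.

Lemma tens_bilinear : bilinear_map tens.
Proof.
split=> [y a x x'|x a y y']; rewrite !tensE.
- have /tens_pi_relation := TensAddl (a *: x) x' y.
  have /tens_pi_relation := TensScalel a x y.
  rewrite !raddfB /= linearZ /= => /subr0_eq <-.
  by rewrite -addrA -opprD => /subr0_eq.
- have /tens_pi_relation := TensAddr x (a *: y) y'.
  have /tens_pi_relation := TensScaler a x y.
  rewrite !raddfB /= linearZ /= => /subr0_eq <-.
  by rewrite -addrA -opprD => /subr0_eq.
Qed.

(* The linear map induced by f; meaningful only when f is bilinear, the value
   being otherwise that of an arbitrary representative (see tens_liftE). *)
Definition tens_lift (P : lmodType R) : (M -> N -> P) -> tensor -> P :=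
  locked_with tens_key
    (fun f t => lincomb (fun xy => f xy.1 xy.2) (tens_repr t)).

Section Lift.
Context (P : lmodType R) (f : M -> N -> P).
Hypothesis f_bilinear : bilinear_map f.

Let g (z : F) : P := lincomb (fun xy => f xy.1 xy.2) z.

Let g_null z : z \in tens_null -> g z = 0.
Proof.
case: f_bilinear => fl fr.
move=> /tens_nullP /(_ (fun z => g z == 0)) H; apply/eqP; apply: H.
  split=> [|a u v]; rewrite !unfold_in /g ?linear0 //.
  by rewrite linearP /= => /eqP -> /eqP ->; rewrite scaler0 addr0.
have fDl x x' y : f (x + x') y = f x y + f x' y.
  by have /= := fl y 1 x x'; rewrite !scale1r.
have fDr x y y' : f x (y + y') = f x y + f x y'.
  by have /= := fr x 1 y y'; rewrite !scale1r.
have fZl a x y : f (a *: x) y = a *: f x y.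
  have /= := fl y a x 0; rewrite !addr0 => ->.
  by have /= := fDl 0 0 y; rewrite addr0 -{1}[f 0 y]addr0 => /addrI <-; rewrite addr0.
have fZr a x y : f x (a *: y) = a *: f x y.
  have /= := fr x a y 0; rewrite !addr0 => ->.
  by have /= := fDr x 0 0; rewrite addr0 -{1}[f x 0]addr0 => /addrI <-; rewrite addr0.
move=> r []; move=> *; rewrite unfold_in /g !linearB ?linearZ_LR /= !lincombU /=;
  apply/eqP.
- by rewrite fDl -addrA -opprD subrr.
- by rewrite fDr -addrA -opprD subrr.
- by rewrite fZl scalerN subrr.
- by rewrite fZr scalerN subrr.
Qed.

Let lift_pi z : tens_lift f (tens_pi z) = g z.
Proof.
rewrite /tens_lift locked_withE -/(g _); apply/subr0_eq; rewrite /g -linearB.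
by apply: g_null; apply: tens_piB; rewrite tens_pi_repr.
Qed.

Lemma tens_lift_linear : linear (tens_lift f).
Proof.
move=> a t u; rewrite -[t]tens_pi_repr -[u]tens_pi_repr -linearP !lift_pi.
by rewrite /g linearP.
Qed.

Lemma tens_liftE x y : tens_lift f (tens x y) = f x y.
Proof. by rewrite tensE lift_pi /g lincombU. Qed.

End Lift.

Lemma tens_ind (Q : tensor -> Prop) :
  (forall x y, Q (tens x y)) ->
  (forall a t u, Q t -> Q u -> Q (a *: t + u)) -> forall t, Q t.
Proof.
move=> Qt Ql t; rewrite -[t]tens_pi_repr; move: (tens_repr t) => z.
have Q0 : Q 0.
  by have := Ql (-1) _ _ (Qt 0 0) (Qt 0 0); rewrite scaleN1r addNr.
rewrite [z]monalgE raddf_sum; elim/big_ind: _ => // [u v Qu Qv|[x y] _].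
  by rewrite -[u]scale1r; apply: Ql.
have -> : << z@_(x, y) *g (x, y) >> = z@_(x, y) *: e x y.
  by apply/malgP => k; rewrite mcoeffZ !mcoeffU mulrnAr mulr1.
by rewrite /= linearZ /= -tensE -[X in Q X]addr0; exact: Ql (Qt _ _) Q0.
Qed.

End Tensor.

Arguments tensor {R} (M N)%_type.
Notation "M ⊗ N" := (tensor M N) (at level 40, left associativity) : type_scope.
Notation "x ⊗ y" := (tens x y) (at level 40, left associativity) : ring_scope.

Section TensorTheory.
Context (R : comNzRingType).

Lemma tens_ext (M N P : lmodType R) (f g : M ⊗ N -> P) :
  linear f -> linear g -> (forall x y, f (x ⊗ y) = g (x ⊗ y)) -> f =1 g.
Proof.
move=> fl gl fg; elim/tens_ind => // a t u ft gu.
by rewrite fl gl ft gu.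
Qed.

Lemma comp_linear (M N P : lmodType R) (f : N -> P) (g : M -> N) :
  linear f -> linear g -> linear (f \o g).
Proof. by move=> fl gl a x y; rewrite /= gl fl. Qed.

Context (M N M' N' P : lmodType R) (h : M -> N -> M' -> N' -> P).
Hypothesis h_inner : forall x y, bilinear_map (h x y).
Hypothesis h_outer : forall x' y', bilinear_map (fun x y => h x y x' y').

Let lin2 (a : R) (f g : M' ⊗ N' -> P) :
  linear f -> linear g -> linear (fun s => a *: f s + g s).
Proof.
move=> fl gl b s s'; rewrite fl gl !scalerDr !scalerA [a * b]mulrC.
by rewrite addrACA.
Qed.

Lemma tens_lift_outer s : bilinear_map (fun x y => tens_lift (h x y) s).
Proof.
split=> [y a x x'|x a y y'] /=; move: s.
- apply: tens_ext => [||u v]; first exact: tens_lift_linear.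
    by apply: lin2; exact: tens_lift_linear.
  by rewrite !tens_liftE //; exact: (proj1 (h_outer u v) y a x x').
- apply: tens_ext => [||u v]; first exact: tens_lift_linear.
    by apply: lin2; exact: tens_lift_linear.
  by rewrite !tens_liftE //; exact: (proj2 (h_outer u v) x a y y').
Qed.

Definition tens_lift2 (t : M ⊗ N) (s : M' ⊗ N') : P :=
  tens_lift (fun x y => tens_lift (h x y) s) t.

Lemma tens_lift2_linearl s : linear (tens_lift2^~ s).
Proof. exact: tens_lift_linear (tens_lift_outer s). Qed.

Lemma tens_lift2E x y x' y' : tens_lift2 (x ⊗ y) (x' ⊗ y') = h x y x' y'.
Proof.
by rewrite /tens_lift2 tens_liftE ?tens_liftE //; exact: tens_lift_outer.
Qed.

Lemma tens_lift2_linearr t : linear (tens_lift2 t).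
Proof.
move=> a s s'; elim/tens_ind: t => [x y|b t u IHt IHu].
  rewrite /tens_lift2 !(tens_liftE (tens_lift_outer _)).
  exact: tens_lift_linear.
rewrite !tens_lift2_linearl IHt IHu !scalerDr !scalerA [b * a]mulrC.
by rewrite addrACA.
Qed.

End TensorTheory.

Section TensorMaps.
Context (R : comNzRingType).

Definition tens_map (M M' N N' : lmodType R) (f : M -> M') (g : N -> N')
    : M ⊗ N -> M' ⊗ N' :=
  tens_lift (fun x y => f x ⊗ g y).

Definition tens_assoc (M N P : lmodType R) : (M ⊗ N) ⊗ P -> M ⊗ (N ⊗ P) :=
  tens_lift (fun t z => tens_lift (fun x y => x ⊗ (y ⊗ z)) t).

End TensorMaps.

Section TensorAlgebra.
Context (R : comNzRingType) (A B : algType R).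
Implicit Types (a c : A) (b d : B) (t s : A ⊗ B).

Definition tens_mul : A ⊗ B -> A ⊗ B -> A ⊗ B :=
  locked_with tens_key (tens_lift2 (fun a b c d => (a * c) ⊗ (b * d))).

Let tens_mul_def t s :
  tens_mul t s = tens_lift2 (fun a b c d => (a * c) ⊗ (b * d)) t s.
Proof. by rewrite /tens_mul locked_withE. Qed.

Let mul_inner a b : bilinear_map (fun c d => (a * c) ⊗ (b * d)).
Proof.
split=> [d k c c'|c k d d']; rewrite mulrDr -scalerAr.
- exact: (proj1 (tens_bilinear A B)).
- exact: (proj2 (tens_bilinear A B)).
Qed.

Let mul_outer c d : bilinear_map (fun a b => (a * c) ⊗ (b * d)).
Proof.
split=> [b k a a'|a k b b']; rewrite mulrDl -scalerAl.
- exact: (proj1 (tens_bilinear A B)).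
- exact: (proj2 (tens_bilinear A B)).
Qed.

Lemma tens_mulE a b c d : tens_mul (a ⊗ b) (c ⊗ d) = (a * c) ⊗ (b * d).
Proof. rewrite tens_mul_def; exact: (tens_lift2E mul_inner mul_outer). Qed.

Lemma tens_mul_linearl s : linear (tens_mul^~ s).
Proof.
move=> k t t'; rewrite !tens_mul_def.
exact: (tens_lift2_linearl mul_inner mul_outer).
Qed.

Lemma tens_mul_linearr t : linear (tens_mul t).
Proof.
move=> k s s'; rewrite !tens_mul_def.
exact: (tens_lift2_linearr mul_inner mul_outer).
Qed.

Let id_linear : linear (@id (A ⊗ B)). Proof. by []. Qed.

Lemma tens_mulA : associative tens_mul.
Proof.
move=> t s u; move: t.
apply: tens_ext => [||a b]; first exact: tens_mul_linearl.
  exact: comp_linear (tens_mul_linearl u) (tens_mul_linearl s).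
move: s; apply: tens_ext => [||c d].
- exact: comp_linear (tens_mul_linearr _) (tens_mul_linearl u).
- exact: comp_linear (tens_mul_linearl u) (tens_mul_linearr _).
move: u; apply: tens_ext => [||x y].
- exact: comp_linear (tens_mul_linearr _) (tens_mul_linearr _).
- exact: tens_mul_linearr.
by rewrite !tens_mulE !mulrA.
Qed.

Lemma tens_mul1l : left_id (1 ⊗ 1) tens_mul.
Proof.
apply: tens_ext => [||a b]; [exact: tens_mul_linearr | exact: id_linear |].
by rewrite tens_mulE !mul1r.
Qed.

Lemma tens_mul1r : right_id (1 ⊗ 1) tens_mul.
Proof.
apply: tens_ext => [||a b]; [exact: tens_mul_linearl | exact: id_linear |].
by rewrite tens_mulE !mulr1.
Qed.

Lemma tens_mulDl : left_distributive tens_mul +%R.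
Proof. by move=> t u s; have := tens_mul_linearl s 1 t u; rewrite !scale1r. Qed.

Lemma tens_mulDr : right_distributive tens_mul +%R.
Proof. by move=> t u s; have := tens_mul_linearr t 1 u s; rewrite !scale1r. Qed.

HB.instance Definition _ := GRing.Zmodule_isPzRing.Build (tensor A B)
  tens_mulA tens_mul1l tens_mul1r tens_mulDl tens_mulDr.

Lemma tensM a b c d : (a ⊗ b) * (c ⊗ d) = (a * c) ⊗ (b * d).
Proof. exact: tens_mulE. Qed.

End TensorAlgebra.

(* -------------------------------------------------------------------- *)
HB.mixin Record Algebra_isBialgebra (R : comNzRingType) U
    of GRing.Algebra R U := {
  comul_subdef : U -> U ⊗ U;
  counit_subdef : U -> R;
  comul_linear_subproof : linear comul_subdef;
  comul_monoid_morphism_subproof : monoid_morphism comul_subdef;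
  counit_scalar_subproof : scalar counit_subdef;
  counit_monoid_morphism_subproof : monoid_morphism counit_subdef;
  comulA_subproof : forall x : U,
    tens_assoc (tens_map comul_subdef id (comul_subdef x)) =
    tens_map id comul_subdef (comul_subdef x);
  counitl_subproof : forall x : U,
    tens_lift (fun y z => counit_subdef y *: z) (comul_subdef x) = x;
  counitr_subproof : forall x : U,
    tens_lift (fun y z => counit_subdef z *: y) (comul_subdef x) = x
}.

#[short(type="bialgType")]
HB.structure Definition Bialgebra (R : comNzRingType) :=
  {U of GRing.Algebra R U & Algebra_isBialgebra R U}.

Section BialgebraTheory.
Context (R : comNzRingType) (U : bialgType R).

Definition comul : U -> U ⊗ U := @comul_subdef R U.
Definition counit : U -> R := @counit_subdef R U.

Lemma comul_is_linear : linear comul.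
Proof. exact: comul_linear_subproof. Qed.
Lemma comul_is_monoid_morphism : monoid_morphism comul.
Proof. exact: comul_monoid_morphism_subproof. Qed.
Lemma counit_is_scalar : scalar counit.
Proof. exact: counit_scalar_subproof. Qed.
Lemma counit_is_monoid_morphism : monoid_morphism counit.
Proof. exact: counit_monoid_morphism_subproof. Qed.

HB.instance Definition _ :=
  GRing.isLinear.Build R U (tensor U U) *:%R comul comul_is_linear.
HB.instance Definition _ :=
  GRing.isMonoidMorphism.Build U (tensor U U) comul comul_is_monoid_morphism.
HB.instance Definition _ :=
  GRing.isLinear.Build R U R *%R counit counit_is_scalar.
HB.instance Definition _ :=
  GRing.isMonoidMorphism.Build U R counit counit_is_monoid_morphism.

Lemma comulA x :
  tens_assoc (tens_map comul id (comul x)) = tens_map id comul (comul x).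
Proof. exact: comulA_subproof. Qed.
Lemma counitl x : tens_lift (fun y z => counit y *: z) (comul x) = x.
Proof. exact: counitl_subproof. Qed.
Lemma counitr x : tens_lift (fun y z => counit z *: y) (comul x) = x.
Proof. exact: counitr_subproof. Qed.

End BialgebraTheory.

Lemma finite_msubset (I : choiceType) (a : multiset I) :
  finite_set [set b : multiset I | (b `<=` a)%mset].
Proof.
pose n := (\max_(i <- finsupp a) a i).+1.
pose g (f : {ffun finsupp a -> 'I_n}) : multiset I :=
  [fsfun x : finsupp a => f x : nat | 0%N].
apply: (@sub_finite_set _ _ (range g)); last exact/finite_image/finite_finset.
move=> b /= /msubsetP le_ba.
have lt_bn (x : finsupp a) : (b (val x) < n)%N.
  rewrite ltnS (leq_trans (le_ba _)) //.
  by rewrite (big_rem _ (valP x)) leq_maxl.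
exists [ffun x => Ordinal (lt_bn x)] => //.
apply/fsfunP => x; rewrite fsfun_ffun; case: insubP => [y xa <-|xa] /=.
  by rewrite ffunE.
by apply/esym/eqP; rewrite -leqn0; have := le_ba x; rewrite [a x]fsfun_dflt.
Qed.

Section BialgebraNotions.
Context (R : comNzRingType) (U : bialgType R).

Definition primitive : set U :=
  [set a | comul a = a ⊗ 1 + 1 ⊗ a].

(* A power series in U[[x]] is given by its sequence of coefficients. *)
Definition group_like (a : nat -> U) : Prop :=
  forall n, comul (a n) = \sum_(m < n.+1) a m ⊗ a (n - m)%N.

Definition antipode (S : U -> U) : Prop :=
  [/\ linear S,
      forall x, tens_lift (fun y z => S y * z) (comul x) = (counit x)%:A
    & forall x, tens_lift (fun y z => y * S z) (comul x) = (counit x)%:A].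

Definition is_Hopf_algebra : Prop := exists S : U -> U, antipode S.

(* multiset I is the type of functions I -> nat of finite support, with the
   pointwise order and difference. The sum over b is an honest finite sum by
   finite_msubset (a sum over an infinite support would be 0). *)
Definition structural_basis (I : choiceType) (Z : multiset I -> U) : Prop :=
  [/\ module_basis [set: U] Z,
      Z mset0 = 1
    & forall a : multiset I,
        comul (Z a) =
        \sum_(b \in [set b : multiset I | (b `<=` a)%mset])
          Z b ⊗ Z (a `\` b)%mset].

Definition generates (G : set U) : Prop :=
  forall A : {pred U}, GRing.subalg_closed A ->
    (forall u, G u -> u \in A) -> forall u, u \in A.

End BialgebraNotions.

(* Main.v *)
(* Call a group-like series 1 + g_1 x + g_2 x^2 + ... a curve.  The first
   coefficients g_1 of curves form a submodule L of the primitive elements, so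
   L has a basis b_i over the principal ideal domain, each b_i starting a curve
   h_i.  The key point is that the first nonzero coefficient a_n of any curve
   1 + a_n x^n + ... lies in L.  This is checked universally over the integers,
   on functions on words under the Cauchy product.  Modulo each prime p the
   generators of that ring are algebraically independent: functionals vanishing
   on decomposables give derivations showing that a relation of minimal degree
   has zero partial derivatives, hence is a p-th power, while the ring is
   reduced.  So the multiples of a truncated curve that extend by one degree
   form an ideal of the integers contained in no (p).

   Peeling off leading coefficients, every curve is an ordered product of
   series h_i(phi_i(x)); hence the ordered products Z_alpha of coefficients of
   the h_i span U.  They are independent: apply to the coproduct of a relation
   functionals into the fraction field that are dual to the Z_beta of smaller
   degree.  The antipode is the convolution inverse of the identity, computed
   by recursion on this basis. *)
Require Import Defs.
From HB Require Import structures.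
From mathcomp Require Import all_boot all_algebra finfield zify ring.
From mathcomp Require Import boolp.
From mathcomp Require mpoly.

Set Implicit Arguments.
Unset Strict Implicit.
Unset Printing Implicit Defensive.

Import GRing.Theory.

Local Open Scope ring_scope.

(** The free associative algebra on a_n, a_(n+1), ..., with the coproduct making 1 + a_n x^n + ...
    group-like, maps to U for every curve of this shape. So one curve over the free algebra, in
    powers of x^n, homogeneous and with coefficient a_n at x^n, settles the key point for all U:
    renaming x^n to x makes a_n a first coefficient. The graded dual of the free algebra is a
    commutative ring of quasi-symmetric functions, and a homogeneous curve is the same as a ring
    homomorphism from it to the integers. On a polynomial ring such homomorphisms are chosen freely
    on generators, but generators over the integers are hard to exhibit, and rational ones extend a
    truncated homomorphism only up to an uncontrolled denominator. Hence the detour through primes: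
    generators modulo p, lifted to the integers, give an extension up to a factor prime to p, and
    these factors over all p combine to 1. Truncation at a degree D keeps the variables finite in
    number. *)

(** * The ring of functions on words *)

Lemma sum_triangle (V : nmodType) (n : nat) (F : nat -> nat -> nat -> V) :
  \sum_(j < n.+1) \sum_(l < j.+1) F l (j - l)%N (n - j)%N =
  \sum_(l < n.+1) \sum_(j < (n - l).+1) F l j (n - l - j)%N.
Proof.
under eq_bigr => j _ do
  rewrite (big_ord_widen_cond n.+1 xpredT
    (fun l => F l (j - l)%N (n - j)%N) (ltn_ord j)).
rewrite (exchange_big_dep xpredT) //=; apply: eq_bigr => l _.
rewrite -(big_geq_mkord l n.+1 xpredT (fun j => F l (j - l)%N (n - j)%N)).
rewrite -{1}[l : nat]add0n big_addn subSn; last by rewrite -ltnS.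
by rewrite big_mkord; apply: eq_bigr => j _; rewrite addnK subnDA subnAC.
Qed.

(* The Cauchy product of two functions on words of a fixed length r is their
   product as power series in r variables. *)
Fixpoint wsplit (w : seq nat) : seq (seq nat * seq nat) :=
  if w is i :: w' then
    [seq (j :: s.1, (i - j)%N :: s.2) | j <- iota 0 i.+1, s <- wsplit w']
  else [:: ([::], [::])].

(** The value at a word of length r is the coefficient of the monomial in r variables with these
    exponents; a function is thus a family of power series, one for each r. *)
Definition wfun (k : Type) : Type := seq nat -> k.

Section WordRing.
Context (k : comNzRingType).
Implicit Types (f g h : wfun k) (w u : seq nat).

Definition wmul f g : wfun k := fun w => \sum_(s <- wsplit w) f s.1 * g s.2.
Definition wshift f i : wfun k := fun w => f (i :: w).

Lemma wmul_cons f g i w :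
  wmul f g (i :: w) = \sum_(j < i.+1) wmul (wshift f j) (wshift g (i - j)) w.
Proof.
rewrite {1}/wmul.
have -> : wsplit (i :: w) = [seq (j :: s.1, (i - j)%N :: s.2) |
  j <- iota 0 i.+1, s <- wsplit w] by [].
rewrite (big_allpairs_dep (h := fun j s => (j :: s.1, (i - j)%N :: s.2))).
by rewrite -{1}[i.+1]subn0 -/(index_iota 0 i.+1) big_mkord.
Qed.

Lemma wmul_suml (I : Type) (r : seq I) (F : I -> wfun k) g w :
  wmul (fun u => \sum_(i <- r) F i u) g w = \sum_(i <- r) wmul (F i) g w.
Proof.
rewrite /wmul exchange_big /=; apply: eq_bigr => s _.
by rewrite mulr_suml.
Qed.

Lemma wmulC : commutative wmul.
Proof.
move=> f g; apply/funext => w; elim: w f g => [|i w IH] f g.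
  by rewrite /wmul !big_seq1 mulrC.
rewrite !wmul_cons (reindex_inj rev_ord_inj) /=; apply: eq_bigr => j _.
by rewrite IH subSS subKn // -ltnS.
Qed.

Lemma wmul_sumr (I : Type) (r : seq I) (F : I -> wfun k) g w :
  wmul g (fun u => \sum_(i <- r) F i u) w = \sum_(i <- r) wmul g (F i) w.
Proof.
by rewrite wmulC wmul_suml; apply: eq_bigr => i _; rewrite wmulC.
Qed.

Lemma wmulA : associative wmul.
Proof.
move=> f g h; apply/funext => w; elim: w f g h => [|i w IH] f g h.
  by rewrite /wmul /= !big_seq1 /= ?big_seq1 mulrA.
have E f' g' j : wshift (wmul f' g') j =
    (fun u => \sum_(l < j.+1) wmul (wshift f' l) (wshift g' (j - l)) u).
  by apply/funext => u; rewrite /wshift wmul_cons.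
rewrite !wmul_cons.
under eq_bigr => j _ do rewrite E wmul_sumr.
under [RHS]eq_bigr => j _.
  rewrite E wmul_suml; under eq_bigr => l _ do rewrite -IH.
  over.
by rewrite (sum_triangle i (fun a b c =>
  wmul (wshift f a) (wmul (wshift g b) (wshift h c)) w)).
Qed.

(** The words of sum zero are the words of zeros, one for each length, so this is the constant
    series 1 in every number of variables. *)
Definition wone : wfun k := fun w => (sumn w == 0%N)%:R.

Lemma wmul1 : left_id wone wmul.
Proof.
move=> f; apply/funext => w; elim: w f => [|i w IH] f.
  by rewrite /wmul big_seq1 mul1r.
rewrite wmul_cons big_ord_recl /= subn0 big1 ?addr0.
  have -> : wshift wone 0 = wone by apply/funext.
  by rewrite IH.
by move=> j _; rewrite /wmul big1 // => s _; rewrite mul0r.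
Qed.

Definition wadd f g : wfun k := fun w => f w + g w.
Definition wopp f : wfun k := fun w => - f w.

HB.instance Definition _ := gen_eqMixin (wfun k).
HB.instance Definition _ := gen_choiceMixin (wfun k).

Lemma waddA : associative wadd.
Proof. by move=> f g h; apply/funext => w; rewrite /wadd addrA. Qed.
Lemma waddC : commutative wadd.
Proof. by move=> f g; apply/funext => w; rewrite /wadd addrC. Qed.
Lemma wadd0 : left_id ((fun=> 0) : wfun k) wadd.
Proof. by move=> f; apply/funext => w; rewrite /wadd add0r. Qed.
Lemma waddN : left_inverse ((fun=> 0) : wfun k) wopp wadd.
Proof. by move=> f; apply/funext => w; rewrite /wadd addNr. Qed.

HB.instance Definition _ := GRing.isZmodule.Build (wfun k)
  waddA waddC wadd0 waddN.

Lemma wmulDl : left_distributive wmul +%R.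
Proof.
move=> f g h; apply/funext => w; rewrite /wmul /GRing.add /= /wadd -big_split.
by apply: eq_bigr => s _; rewrite mulrDl.
Qed.

Lemma wone_neq0 : wone != 0.
Proof.
by apply/eqP => /(congr1 (@^~ [::])) /eqP; rewrite /wone /= oner_eq0.
Qed.

HB.instance Definition _ := GRing.Zmodule_isComNzRing.Build (wfun k)
  wmulA wmulC wmul1 wmulDl wone_neq0.

Lemma wmulE f g w : (f * g) w = \sum_(s <- wsplit w) f s.1 * g s.2.
Proof. by []. Qed.
Lemma waddE f g w : (f + g) w = f w + g w. Proof. by []. Qed.
Lemma wsumE (I : Type) (r : seq I) (P : pred I) (F : I -> wfun k) w :
  (\sum_(i <- r | P i) F i) w = \sum_(i <- r | P i) F i w.
Proof. by elim/big_rec2: _ => // i x y _ <-. Qed.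
Lemma woneE w : (1 : wfun k) w = (sumn w == 0%N)%:R. Proof. by []. Qed.

Definition wconst (c : k) : wfun k := fun w => c *+ (sumn w == 0%N).

Lemma wconst_is_zmod_morphism : zmod_morphism wconst.
Proof.
by move=> a b; apply/funext => w; rewrite /wconst mulrnBl.
Qed.

Lemma wconstM c f w : (wconst c * f) w = c * f w.
Proof.
have -> : c * f w = c * (1 * f) w by rewrite mul1r.
rewrite !wmulE mulr_sumr; apply: eq_bigr => s _.
by rewrite mulrA; congr (_ * _); rewrite /wconst woneE mulr_natr.
Qed.

Lemma wconst_is_monoid_morphism : monoid_morphism wconst.
Proof.
split=> [|a b]; apply/funext => w; first by [].
by rewrite wconstM /wconst mulrnAr.
Qed.

HB.instance Definition _ :=
  GRing.isZmodMorphism.Build k (wfun k) wconst wconst_is_zmod_morphism.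
HB.instance Definition _ :=
  GRing.isMonoidMorphism.Build k (wfun k) wconst wconst_is_monoid_morphism.

End WordRing.

(** * Quasi-symmetric functions and their grading *)

Definition wpos (w : seq nat) := [seq i <- w | (0 < i)%N].

Lemma wpos_idem w : wpos (wpos w) = wpos w.
Proof. by rewrite /wpos filter_id. Qed.

Lemma wpos_cat u w : wpos (u ++ w) = wpos u ++ wpos w.
Proof. exact: filter_cat. Qed.

Lemma sumn_wpos w : sumn (wpos w) = sumn w.
Proof. by elim: w => //= -[|i] w /= ->. Qed.

Lemma sumn0_wpos w : sumn w = 0%N -> wpos w = [::].
Proof. by elim: w => //= -[|i] w /= IH // /IH. Qed.

Lemma size_le_sumn w : all (leq 1) w -> (size w <= sumn w)%N.
Proof. by elim: w => //= i w IH /andP[i0 /IH]; lia. Qed.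

Lemma mem_wsplit_cons i w (s : seq nat * seq nat) : s \in wsplit (i :: w) ->
  exists (j : nat) (t : seq nat * seq nat),
    [/\ (j <= i)%N, t \in wsplit w & s = (j :: t.1, (i - j)%N :: t.2)].
Proof.
rewrite [wsplit _]/[seq (j :: s.1, (i - j)%N :: s.2) |
  j <- iota 0 i.+1, s <- wsplit w] => /allpairsPdep[j [t [jP tP ->]]].
by exists j, t; split=> //; move: jP; rewrite mem_iota add0n ltnS.
Qed.

Lemma mem_wsplit w (s : seq nat * seq nat) : s \in wsplit w ->
  (sumn s.1 + sumn s.2 = sumn w)%N.
Proof.
elim: w s => [s|i w IH s]; first by rewrite inE => /eqP ->.
by move=> /mem_wsplit_cons[j [t [jP /IH tE ->]]] /=; lia.
Qed.

Lemma size_wsplit w (s : seq nat * seq nat) :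
  s \in wsplit w -> size s.1 = size w /\ size s.2 = size w.
Proof.
elim: w s => [s|i w IH s]; first by rewrite inE => /eqP ->.
by move=> /mem_wsplit_cons[j [t [_ /IH[E1 E2] ->]]] /=; rewrite E1 E2.
Qed.

Section Good.
Context (n : nat).

(** The letters allowed index the coefficients that a series 1 + a_n x^n + ... may have. Zero
    letters stay, as exponents of absent variables. *)
Definition wgood (w : seq nat) := all (fun i => (i == 0%N) || (n <= i)%N) w.

Lemma wgood_cat u w : wgood (u ++ w) = wgood u && wgood w.
Proof. exact: all_cat. Qed.

Lemma wgood_wpos w : wgood (wpos w) = wgood w.
Proof. by elim: w => //= -[|i] w /= ->. Qed.

Lemma wsplit_good w (s : seq nat * seq nat) :
  s \in wsplit w -> wgood s.1 -> wgood s.2 -> wgood w.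
Proof.
elim: w s => [//|i w IH s] /mem_wsplit_cons[j [t [jP /IH tP ->]]] /=.
move=> /andP[Hj t1] /andP[Hij t2]; rewrite (tP t1 t2) andbT.
by move: Hj Hij; lia.
Qed.

Fixpoint wlist (l e : nat) : seq (seq nat) :=
  if l is l'.+1 then [::] :: [seq i :: w | i <- iota 0 e.+1, w <- wlist l' e]
  else [:: [::]].

Lemma mem_wlist l e w : (size w <= l)%N -> (sumn w <= e)%N -> w \in wlist l e.
Proof.
elim: l w => [|l IH] [|i w] //= sw we; rewrite in_cons /=.
apply/(@allpairsPdep _ _ _ (fun i w => i :: w) (iota 0 e.+1)
  (fun=> wlist l e)); exists i, w; split=> //; last by apply: IH => //; lia.
by rewrite mem_iota; lia.
Qed.

(** The compositions of [e] into parts at least [n]. Positivity is asked separately because [n] may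
    be 0 here, and zero letters would make the set infinite. *)
Definition words (e : nat) : seq (seq nat) :=
  undup [seq w <- wlist e e |
    [&& all (leq 1) w, all (leq n) w & sumn w == e]].

Lemma words_uniq e : uniq (words e). Proof. exact: undup_uniq. Qed.

Lemma mem_words e w :
  (w \in words e) = [&& all (leq 1) w, all (leq n) w & sumn w == e].
Proof.
rewrite mem_undup mem_filter; case: and3P => //= -[w1 _ /eqP we].
by apply: mem_wlist; rewrite -we // size_le_sumn.
Qed.

Lemma mem_words_good w : wgood w -> wpos w \in words (sumn w).
Proof.
move=> gw; rewrite mem_words sumn_wpos eqxx andbT.
apply/andP; split; first exact: filter_all.
by elim: w gw => //= -[|i] w IH //= /andP[-> /IH ->].
Qed.

Lemma wordsP e w : w \in words e -> [/\ wpos w = w, wgood w & sumn w = e].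
Proof.
rewrite mem_words => /and3P[w1 wn /eqP ->]; split=> //; first exact/all_filterP.
by apply/allP => i /(allP wn) ->; rewrite orbT.
Qed.

Section Ring.
Context (k : comNzRingType).
Implicit Types (f g F G : wfun k).

(** Invariance under [wpos] is quasi-symmetry: a coefficient depends only on the sequence of nonzero
    exponents. The homogeneous pieces are dual to those of the free algebra on a_n, a_(n+1), .... *)
Definition inA f :=
  (forall w, f w = f (wpos w)) /\ (forall w, ~~ wgood w -> f w = 0).
Definition hom e f := inA f /\ forall w, sumn w != e -> f w = 0.

(** A zero letter splits only as 0 + 0, so deleting it commutes with splitting; and letters that are
    0 or at least [n] are closed under addition, so each splitting of a bad word has a bad half. *)
Lemma inA_mul f g : inA f -> inA g -> inA (f * g).
Proof.
move=> [fz fg] [gz gg]; split=> [w|w bw].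
  have shz h (hz : forall w, h w = h (wpos w)) j u :
      wshift h j u = wshift h j (wpos u) :> k.
    by rewrite /wshift hz [RHS]hz /= wpos_idem.
  rewrite -[f * g]/(wmul f g).
  elim: w f g fz gz {fg gg} => //= i w IH f g fz gz.
  have E : wmul f g (i :: w) = wmul f g (i :: wpos w).
    rewrite !wmul_cons; apply: eq_bigr => j _.
    by rewrite IH //; exact: shz.
  case: i E => [|i] E //=; rewrite E wmul_cons big_ord_recl big_ord0 addr0.
  have sh0 h (hz : forall w, h w = h (wpos w)) : wshift h 0 = h :> wfun k.
    by apply/funext => u; rewrite /wshift hz [RHS]hz.
  by rewrite !sh0.
rewrite wmulE big_seq big1 // => s /wsplit_good sP.
case: (boolP (wgood s.1)) => [g1|/fg ->]; last by rewrite mul0r.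
case: (boolP (wgood s.2)) => [g2|/gg ->]; last by rewrite mulr0.
by rewrite sP in bw.
Qed.

Lemma hom_mul a b f g : hom a f -> hom b g -> hom (a + b)%N (f * g).
Proof.
move=> [fA fh] [gA gh]; split; first exact: inA_mul.
move=> w we; rewrite wmulE big_seq big1 // => s /mem_wsplit se.
case: (eqVneq (sumn s.1) a) => [E1|/fh ->]; last by rewrite mul0r.
case: (eqVneq (sumn s.2) b) => [E2|/gh ->]; last by rewrite mulr0.
by rewrite -se E1 E2 eqxx in we.
Qed.

Lemma inA0 : inA 0. Proof. by []. Qed.

Lemma hom0 e : hom e 0. Proof. by []. Qed.

Lemma hom_add e f g : hom e f -> hom e g -> hom e (f + g).
Proof.
move=> [[fz fb] fh] [[gz gb] gh]; split; first split=> w.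
- by rewrite !waddE fz gz.
- by move=> wb; rewrite waddE fb ?gb ?addr0.
- by move=> w we; rewrite waddE fh ?gh ?addr0.
Qed.

Lemma inA_add f g : inA f -> inA g -> inA (f + g).
Proof.
move=> [fz fb] [gz gb]; split=> w; first by rewrite !waddE fz gz.
by move=> wb; rewrite waddE fb ?gb ?addr0.
Qed.

Lemma hom_const c : hom 0 (wconst c).
Proof.
split; first split=> w; rewrite /wconst ?sumn_wpos // ?eqn0Ngt.
  case: (posnP (sumn w)) => [/sumn0_wpos w0|//].
  by rewrite -wgood_wpos w0.
by move=> w /negbTE ->.
Qed.

Lemma hom_constM e c f : hom e f -> hom e (wconst c * f).
Proof. by rewrite -[e in X in _ -> X]add0n; exact: hom_mul (hom_const c). Qed.

Lemma hom1 : hom 0 (1 : wfun k).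
Proof. exact: (hom_const 1). Qed.

Lemma hom_sum e (I : Type) (r : seq I) (P : pred I) (F : I -> wfun k) :
  (forall i, P i -> hom e (F i)) -> hom e (\sum_(i <- r | P i) F i).
Proof.
move=> H; elim/big_rec: _ => [|i x Pi Hx]; first exact: hom0.
by apply: hom_add => //; exact: H.
Qed.

Lemma inA_sum (I : Type) (r : seq I) (P : pred I) (F : I -> wfun k) :
  (forall i, P i -> inA (F i)) -> inA (\sum_(i <- r | P i) F i).
Proof.
move=> H; elim/big_rec: _ => [|i x Pi Hx]; first exact: inA0.
by apply: inA_add => //; exact: H.
Qed.

(** For a composition [u], this is the monomial quasi-symmetric function, dual to the word [u]. *)
Definition wdelta (u : seq nat) : wfun k := fun w => (wpos w == u)%:R.

Lemma hom_delta e u : u \in words e -> hom e (wdelta u).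
Proof.
move=> /wordsP[uP ug us]; split; first split=> w; rewrite /wdelta ?wpos_idem //.
  rewrite -wgood_wpos; by case: (wpos w =P u) => // ->; rewrite ug.
by move=> w; rewrite -sumn_wpos; case: (wpos w =P u) => // ->; rewrite us eqxx.
Qed.

Lemma wdelta_expand e f :
  hom e f -> f = \sum_(u <- words e) wconst (f u) * wdelta u.
Proof.
move=> [[fz fb] fh]; apply/funext => w; rewrite wsumE.
under eq_bigr => u _ do rewrite wconstM /wdelta.
have [we|wne] := eqVneq (sumn w) e; last first.
  rewrite fh // big_seq big1 // => u /wordsP[_ _ us].
  case: eqP => [E|]; last by rewrite mulr0.
  by rewrite -us -E sumn_wpos eqxx in wne.
case: (boolP (wgood w)) => [gw|bw]; last first.
  rewrite fb // big_seq big1 // => u /wordsP[_ ug _].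
  case: eqP => [E|]; last by rewrite mulr0.
  by rewrite -wgood_wpos E ug in bw.
rewrite (bigD1_seq (wpos w)) ?words_uniq //=; last first.
  by rewrite -we; exact: mem_words_good.
rewrite eqxx mulr1 -fz big1 ?addr0 // => u /negbTE.
by rewrite eq_sym => ->; rewrite mulr0.
Qed.

Lemma hom_ext e f g :
  hom e f -> hom e g -> {in words e, f =1 g} -> f = g.
Proof.
move=> fh gh E; rewrite (wdelta_expand fh) (wdelta_expand gh).
by rewrite big_seq [RHS]big_seq; apply: eq_bigr => u /E ->.
Qed.

Definition pairing (Q : seq nat -> k) e f := \sum_(u <- words e) Q u * f u.
(** Deconcatenation, the coproduct dual to concatenation of words, followed by the form [Q] on the
    left half. *)
Definition der (Q : seq nat -> k) e f : wfun k :=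
  fun w => pairing Q e (fun u => f (u ++ w)).

(** Splitting a concatenation is splitting its two halves separately; in other words,
    deconcatenation is multiplicative. *)
Lemma wmul_cat f g u w : wmul f g (u ++ w) =
  \sum_(t <- wsplit w) wmul (fun u => f (u ++ t.1)) (fun u => g (u ++ t.2)) u.
Proof.
elim: u f g => [|i u IH] f g.
  rewrite /= /wmul; apply: eq_bigr => t _; by rewrite /= big_seq1.
rewrite cat_cons wmul_cons.
under eq_bigr => j _ do rewrite IH.
by rewrite exchange_big /=; apply: eq_bigr => t _; rewrite wmul_cons.
Qed.

Lemma pairing_sum Q e (I : Type) (r : seq I) (P : pred I) (F : I -> wfun k) :
  pairing Q e (\sum_(i <- r | P i) F i) =
  \sum_(i <- r | P i) pairing Q e (F i).
Proof.
rewrite exchange_big /=; apply: eq_bigr => u _.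
by rewrite wsumE mulr_sumr.
Qed.

Lemma pairing_constM Q e c f : pairing Q e (wconst c * f) = c * pairing Q e f.
Proof.
by rewrite mulr_sumr; apply: eq_bigr => u _; rewrite wconstM mulrCA.
Qed.

Lemma pairing_hom Q e a f : hom a f -> a != e -> pairing Q e f = 0.
Proof.
move=> [_ fh] ae; rewrite /pairing big_seq big1 // => u /wordsP[_ _ us].
by rewrite fh ?mulr0 // us eq_sym.
Qed.

Definition wcomp a f : wfun k := fun w => f w *+ (sumn w == a).

Lemma hom_wcomp a f : inA f -> hom a (wcomp a f).
Proof.
move=> [fz fb]; split; first split=> w; rewrite /wcomp.
- by rewrite sumn_wpos -fz.
- by move=> /fb ->; rewrite mul0rn.
- by move=> w /negbTE ->.
Qed.

Lemma wmul_wcomp e f g w : sumn w = e ->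
  (f * g) w = \sum_(a < e.+1) (wcomp a f * wcomp (e - a)%N g) w.
Proof.
move=> we; under eq_bigr => a _ do rewrite wmulE.
rewrite exchange_big /= wmulE big_seq [RHS]big_seq; apply: eq_bigr => -[u v].
move=> /mem_wsplit /=; rewrite we => se.
have u1 : (sumn u < e.+1)%N by lia.
rewrite (bigD1 (Ordinal u1)) //= /wcomp eqxx.
have -> : (e - sumn u)%N = sumn v by lia.
rewrite eqxx !mulr1n big1 ?addr0 // => a aP.
case: (eqVneq (sumn u) a) => [E|]; last by rewrite mulr0n mul0r.
by case/eqP: aP; apply: val_inj.
Qed.

Lemma wcomp0 f : inA f -> wcomp 0 f = wconst (f [::]).
Proof.
move=> [fz _]; apply/funext => w; rewrite /wcomp /wconst.
by case: eqP => // /sumn0_wpos w0; rewrite fz w0.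
Qed.

Lemma pairing_wcomp Q e f : pairing Q e (wcomp e f) = pairing Q e f.
Proof.
rewrite /pairing big_seq [RHS]big_seq; apply: eq_bigr => u /wordsP[_ _ us].
by rewrite /wcomp us eqxx.
Qed.

Definition indec (Q : seq nat -> k) e := forall a b f g,
  (0 < a)%N -> (0 < b)%N -> (a + b = e)%N -> hom a f -> hom b g ->
  pairing Q e (f * g) = 0.

(** Decompose both factors by degree: [Q] kills all products of two positive degrees, and only the
    bidegrees (0, e) and (e, 0) remain. So [Q] is a derivation over the augmentation sending [f] to
    [f [::]]. *)
Lemma pairing_mul Q e f g : (0 < e)%N -> indec Q e -> inA f -> inA g ->
  pairing Q e (f * g) = pairing Q e f * g [::] + f [::] * pairing Q e g.
Proof.
move=> e0 QP fA gA.
have -> : pairing Q e (f * g) =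
    \sum_(a < e.+1) pairing Q e (wcomp a f * wcomp (e - a)%N g).
  rewrite -pairing_sum /pairing big_seq [RHS]big_seq.
  by apply: eq_bigr => u /wordsP[_ _ us]; rewrite wsumE (wmul_wcomp _ _ us).
case: e e0 QP => // e _ QP.
rewrite big_ord_recl big_ord_recr /= /bump add1n subn0 subnn !wcomp0 //.
rewrite [wcomp e.+1 f * _]mulrC !pairing_constM !pairing_wcomp.
rewrite big1 ?add0r; first by rewrite addrC [pairing _ _ f * _]mulrC.
by move=> a _; apply: QP; [| | |exact: hom_wcomp..];
  have := ltn_ord a; rewrite /bump /=; lia.
Qed.

End Ring.
End Good.

(** * Reducedness, derivations and evaluation of weighted polynomials *)

Module Generators.
Import mpoly.

Section Reduced.
Context (k : idomainType).
Implicit Types (f g : wfun k).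

(** Words of one length carry a ring of power series, which is a domain: multiply the lowest nonzero
    coefficients with respect to the first variable. Words of different lengths do not interact, so
    the whole ring has zero divisors and only reducedness survives. *)
Lemma wmul_eq0_size l f g :
  (forall w, size w = l -> (f * g) w = 0) ->
  (forall w, size w = l -> f w = 0) \/ (forall w, size w = l -> g w = 0).
Proof.
elim: l f g => [|l IH] f g fg0.
  have /eqP := fg0 [::] erefl; rewrite wmulE big_seq1 mulf_eq0.
  by case/orP => /eqP E; [left | right] => w /size0nil ->.
pose nz (h : wfun k) (i : nat) :=
  `[< exists w, size w = l /\ h (i :: w) != 0 :> k >].
have nzN (h : wfun k) i : ~~ nz h i ->
  forall w, size w = l -> wshift h i w = 0 :> k.
  move=> /asboolPn H w wl; apply/eqP/negPn/negP => hw; apply: H.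
  by exists w.
have nz0 (h : wfun k) : ~ (exists i, nz h i) -> forall w, size w = l.+1 ->
  h w = 0 :> k.
  move=> H [//|i w] [wl]; apply: (nzN h i) => //.
  by apply/negP => hi; apply: H; exists i.
case: (pselect (exists i, nz f i)) => [fnz|]; last by left; exact: nz0.
case: (pselect (exists i, nz g i)) => [gnz|]; last by right; exact: nz0.
case: (ex_minnP fnz) => i fi imin; case: (ex_minnP gnz) => j gj jmin.
case: (IH (wshift f i) (wshift g j)).
- move=> w wl; have := fg0 ((i + j)%N :: w); rewrite /= wl => /(_ erefl).
  rewrite -[(f * g) _]/(wmul f g _) wmul_cons.
  have ij : (i < (i + j).+1)%N by lia.
  rewrite (bigD1 (Ordinal ij)) //= addKn big1 ?addr0 // => a ai.
  rewrite /wmul big_seq big1 // => -[u v] uv /=.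
  have [ul vl] : size u = l /\ size v = l.
    by have [] := size_wsplit uv; rewrite wl.
  have [ltai|] := ltnP a i.
    rewrite (nzN f a) ?mul0r //; apply/negP => /imin.
    by rewrite leqNgt ltai.
  rewrite leq_eqVlt => /orP[/eqP E|ltia].
    by case/eqP: ai; apply: val_inj.
  rewrite (nzN g (i + j - a)%N) ?mulr0 //; apply/negP => /jmin.
  by move: ltia; have := ltn_ord a; lia.
- by move=> H; case/asboolP: fi => w [wl /eqP[]]; apply: H.
- by move=> H; case/asboolP: gj => w [wl /eqP[]]; apply: H.
Qed.

Lemma wfun_reduced f q : f ^+ q = 0 -> f = 0.
Proof.
move=> fq0; apply/funext => w; move: {2}(size w) (erefl (size w)) => l.
move: w; have : forall w, size w = l -> (f ^+ q) w = 0 by rewrite fq0.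
elim: q {fq0} => [|q IH] H.
  (* For exponent 0 the hypothesis reads 1 = 0, which the zero word of length [l] refutes. *)
  by have := H (nseq l 0) (size_nseq _ _); rewrite expr0 woneE sumn_nseq
    => /eqP; rewrite oner_eq0.
by rewrite exprS in H; case: (wmul_eq0_size H) => // /IH.
Qed.

End Reduced.

Section Deriv.
Context (n : nat) (k : comNzRingType).
Implicit Types (f g : wfun k) (Q : seq nat -> k) (e : nat).

Lemma hom0_const f : hom n 0 f -> f = wconst (f [::]).
Proof.
move=> [[fz _] fh]; apply/funext => w; rewrite /wconst.
by case: eqP => [/sumn0_wpos E|/eqP/fh //]; rewrite fz E.
Qed.

Lemma pairing_ext Q e f g :
  {in words n e, f =1 g} -> pairing n Q e f = pairing n Q e g.
Proof.
by move=> E; rewrite /pairing big_seq [RHS]big_seq; apply: eq_bigr => u /E ->.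
Qed.

Lemma der0 Q e : der n Q e 0 = 0.
Proof.
by apply/funext => w; rewrite /der /pairing big1 // => u _; rewrite mulr0.
Qed.

Lemma derD Q e f g : der n Q e (f + g) = der n Q e f + der n Q e g.
Proof.
apply/funext => w; rewrite waddE /der /pairing -big_split /=.
by apply: eq_bigr => u _; rewrite waddE mulrDr.
Qed.

Lemma der_constM Q e c f :
  der n Q e (wconst c * f) = wconst c * der n Q e f.
Proof.
apply/funext => w; rewrite wconstM /der /pairing mulr_sumr.
by apply: eq_bigr => u _; rewrite wconstM mulrCA.
Qed.

(** This is [pairing_mul] for each splitting of the right half: its augmentation evaluates at the
    empty left half and so gives back [f] and [g] themselves. Multiplicativity of deconcatenation
    does the rest. *)
Lemma derM Q e f g : (0 < e)%N -> indec n Q e -> inA n f -> inA n g ->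
  der n Q e (f * g) = der n Q e f * g + f * der n Q e g.
Proof.
move=> e0 Qd fA gA; apply/funext => w.
have shA h (t : seq nat) : inA n h ->
  inA n ((fun u => h (u ++ t) : k) : wfun k).
  move=> [hz hb]; split=> u; first by rewrite hz [RHS]hz !wpos_cat wpos_idem.
  by move=> ub; rewrite hb // wgood_cat (negbTE ub).
rewrite waddE !wmulE -big_split /= /der.
under eq_bigr => t _ do rewrite -
  (pairing_mul e0 Qd (shA f t.1 fA) (shA g t.2 gA)).
rewrite /pairing exchange_big /=; apply: eq_bigr => u _.
by rewrite -mulr_sumr -[(f * g) _]/(wmul f g _) wmul_cat.
Qed.

Lemma der_hom Q e c f : hom n (e + c)%N f -> hom n c (der n Q e f).
Proof.
move=> [[fz fb] fh]; split; first split=> w.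
- by apply: pairing_ext => u _; rewrite fz [RHS]fz !wpos_cat wpos_idem.
- move=> wb; rewrite /der /pairing big1 // => u _; rewrite fb ?mulr0 //.
  by rewrite wgood_cat negb_and wb orbT.
- move=> w wc; rewrite /der /pairing big_seq big1 // => u /wordsP[_ _ ue].
  by rewrite fh ?mulr0 // sumn_cat ue eqn_add2l.
Qed.

Lemma der_lt Q e a f : hom n a f -> (a < e)%N -> der n Q e f = 0.
Proof.
move=> [_ fh] ae; apply/funext => w; rewrite /der /pairing big_seq big1 //.
move=> u /wordsP[_ _ ue]; rewrite fh ?mulr0 // sumn_cat ue; lia.
Qed.

Lemma der_eq Q e f : hom n e f -> der n Q e f = wconst (pairing n Q e f).
Proof.
rewrite -{1}[e]addn0 => /(@der_hom Q) /hom0_const ->; congr (wconst _).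
by apply: pairing_ext => u _; rewrite cats0.
Qed.

End Deriv.

Section Eval.
Context (n : nat) (k : comNzRingType) (r : nat).
Context (d : 'I_r -> nat) (X : 'I_r -> wfun k).
Hypothesis Xh : forall i, hom n (d i) (X i).
Implicit Types (F G : {mpoly k[r]}) (m : 'X_{1..r}).

Definition wt m := (\sum_i d i * m i)%N.
Definition isw e F := forall m, m \in msupp F -> wt m = e.

Lemma wtD m1 m2 : wt (m1 + m2)%MM = (wt m1 + wt m2)%N.
Proof.
by rewrite /wt -big_split /=; apply: eq_bigr => i _; rewrite mnmDE mulnDr.
Qed.

Lemma wt1 i : wt U_(i)%MM = d i.
Proof.
rewrite /wt (bigD1 i) //= mnm1E eqxx muln1 big1 ?addn0 // => j ji.
by rewrite mnm1E eq_sym (negbTE ji) muln0.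
Qed.

Lemma isw0 e : isw e 0.
Proof. by move=> m; rewrite msupp0. Qed.

Lemma iswD e F G : isw e F -> isw e G -> isw e (F + G).
Proof.
by move=> Fw Gw m /msuppD_le; rewrite mem_cat => /orP[/Fw|/Gw].
Qed.

Lemma iswZ e c F : isw e F -> isw e (c *: F).
Proof. by move=> Fw m /msuppZ_le /Fw. Qed.

Lemma isw_sum e (I : Type) (s : seq I) (P : pred I) (E : I -> {mpoly k[r]}) :
  (forall i, P i -> isw e (E i)) -> isw e (\sum_(i <- s | P i) E i).
Proof.
move=> H; elim/big_rec: _ => [|i x Pi Hx]; first exact: isw0.
by apply: iswD => //; exact: H.
Qed.

Lemma iswM a b F G : isw a F -> isw b G -> isw (a + b)%N (F * G).
Proof.
move=> Fw Gw m /msuppM_le /allpairsP[[m1 m2] /= [m1F m2G ->]].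
by rewrite wtD (Fw _ m1F) (Gw _ m2G).
Qed.

Lemma iswX m : isw (wt m) 'X_[m].
Proof. by move=> m'; rewrite msuppX inE => /eqP ->. Qed.

(* Locked: unification must not unfold polynomial evaluation. *)
Fact ev_key : unit. Proof. by []. Qed.
Definition ev : {mpoly k[r]} -> wfun k :=
  locked_with ev_key (mmap (@wconst k) X).

Lemma evE : ev = mmap (@wconst k) X. Proof. by rewrite /ev unlock. Qed.

Lemma ev_is_zmod_morphism : zmod_morphism ev.
Proof. by rewrite evE; exact: mmap_is_additive. Qed.

Lemma ev_is_monoid_morphism : monoid_morphism ev.
Proof.
by rewrite evE; split=> [|F G]; [exact: rmorph1 | exact: rmorphM].
Qed.

HB.instance Definition _ :=
  GRing.isZmodMorphism.Build {mpoly k[r]} (wfun k) ev ev_is_zmod_morphism.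
HB.instance Definition _ :=
  GRing.isMonoidMorphism.Build {mpoly k[r]} (wfun k) ev ev_is_monoid_morphism.

Lemma evZ c F : ev (c *: F) = wconst c * ev F.
Proof. by rewrite evE; exact: mmapZ. Qed.

Lemma evX i : ev 'X_i = X i.
Proof. by rewrite evE mmapX mmap1U. Qed.

Lemma mpolyX_ind (P : 'X_{1..r} -> Prop) :
  P 0%MM -> (forall i m, P m -> P (U_(i) + m)%MM) -> forall m, P m.
Proof.
move=> P0 PS m; move: {2}(mdeg m) (erefl (mdeg m)) => l.
elim: l m => [|l IH] m ml; first by move/eqP: ml; rewrite mdeg_eq0 => /eqP ->.
have [i mi] : exists i, m i != 0%N.
  apply: contrapT => H; have : m = 0%MM; last by move=> E;
    rewrite E mdeg0 in ml.
  by apply/mnmP => i; rewrite mnm0E; apply/eqP/negPn/negP => mi; apply: H;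
    exists i.
have E : m = (U_(i) + (m - U_(i)))%MM.
  apply/mnmP => j; rewrite mnmDE mnmBE mnm1E; case: eqP => [<-|_]; last by lia.
  by move: mi; lia.
by rewrite E; apply: PS; apply: IH; move: ml; rewrite {1}E mdegD mdeg1; lia.
Qed.

Lemma ev_hom e F : isw e F -> hom n e (ev F).
Proof.
move=> Fw; rewrite (mpolyE F) rmorph_sum /= big_seq; apply: hom_sum => m mF.
rewrite -(Fw m mF) evZ; apply: hom_constM.
elim/mpolyX_ind: {mF} m => [|i m IH].
  rewrite mpolyX0 rmorph1 /wt big1 => [|i _]; last by rewrite mnm0E muln0.
  exact: hom1.
by rewrite mpolyXD rmorphM /= evX wtD wt1; apply: hom_mul.
Qed.

Lemma isw_deriv e F i m : isw e F -> m \in msupp F^`M(i) -> (wt m + d i)%N = e.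
Proof.
move=> Fw; rewrite mcoeff_msupp mcoeff_deriv => H.
rewrite -(Fw (m + U_(i))%MM) ?wtD ?wt1 // mcoeff_msupp.
by apply: contraNneq H => ->; rewrite mul0rn.
Qed.

Lemma inA_ev F : inA n (ev F).
Proof.
rewrite (mpolyE F) rmorph_sum /=; apply: inA_sum => m _.
have [] : hom n (wt m) (ev (F@_m *: 'X_[m])); last by [].
by apply: ev_hom; apply: iswZ; exact: iswX.
Qed.

(** The chain rule, which need only be checked on monomials, one variable at a time. *)
Lemma der_ev Q e F : (0 < e)%N -> indec n Q e ->
  der n Q e (ev F) = \sum_i ev F^`M(i) * der n Q e (X i).
Proof.
move=> e0 Qd; elim/mpolyind: F => [|c m F _ _ IH].
  by rewrite rmorph0 der0 big1 // => i _; rewrite linear0 rmorph0 mul0r.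
rewrite rmorphD /= derD IH; under [RHS]eq_bigr => i _ do
  rewrite linearD linearZ /= rmorphD /= mulrDl.
rewrite big_split /=; congr (_ + _); rewrite evZ der_constM.
under [RHS]eq_bigr => i _ do rewrite evZ -mulrA.
rewrite -mulr_sumr; congr (_ * _) => {c IH F}.
elim/mpolyX_ind: m => [|j m IH].
  rewrite mpolyX0 rmorph1 (der_lt _ (hom1 n k)) // big1 // => i _.
  by rewrite -mpolyC1 mderivC rmorph0 mul0r.
rewrite mpolyXD rmorphM /= derM //; try exact: inA_ev.
rewrite IH evX; under [RHS]eq_bigr => i _ do
  rewrite mderivM rmorphD !rmorphM /= mulrDl evX.
rewrite big_split /= [X j * _]mulr_sumr; congr (_ + _); last first.
  by apply: eq_bigr => i _; rewrite mulrA.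
rewrite (bigD1 j) //= mderivX mnm1E eqxx scale1r.
have -> : (U_(j) - U_(j))%MM = 0%MM :> 'X_{1..r}.
  by apply/mnmP => i; rewrite mnmBE subnn mnm0E.
rewrite mpolyX0 rmorph1 mul1r mulrC big1 ?addr0 // => i ij.
by rewrite mderivX mnm1E eq_sym (negbTE ij) scale0r rmorph0 !mul0r.
Qed.

End Eval.

(** * Algebraic independence modulo a prime *)

(** Vanishing partial derivatives force every exponent to be divisible by [p], and the coefficients
    in the prime field are their own p-th powers. The weight drops to [e %/ p], which feeds the
    induction below. *)
Lemma mpoly_Fp_root (p : nat) (r : nat) (d : 'I_r -> nat) e
    (F : {mpoly 'F_p[r]}) :
  prime p -> isw d e F -> (forall i, F^`M(i) = 0) ->
  exists G, isw d (e %/ p) G /\ F = G ^+ p.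
Proof.
move=> pp Fw dF.
have pF : p \in [pchar 'F_p] by exact: pchar_Fp.
have supp m : m \in msupp F -> forall i, (p %| m i)%N.
  move=> mF i; case: (posnP (m i)) => [->|mi]; first exact: dvdn0.
  have E : m = ((m - U_(i)) + U_(i))%MM.
    apply/mnmP => j; rewrite mnmDE mnmBE mnm1E.
    by case: eqP => [<-|_]; rewrite ?subnK ?subn0 ?addn0.
  have := congr1 (mcoeff (m - U_(i))%MM) (dF i).
  rewrite mcoeff_deriv -E mcoeff0 mnmBE mnm1E eqxx -mulr_natr => /eqP.
  move: mF; rewrite mcoeff_msupp mulf_eq0 => /negbTE -> /=.
  by rewrite subn1 prednK // -(dvdn_pcharf pF).
pose q (m : 'X_{1..r}) := [multinom (m i %/ p)%N | i < r].
have qE m : m \in msupp F -> m = (q m *+ p)%MM.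
  move=> mF; apply/mnmP => i; rewrite mulmnE mnmE divnK //; exact: supp.
exists (\sum_(m <- msupp F) F@_m *: 'X_[q m]); split.
  rewrite big_seq; apply: isw_sum => m mF; apply: iswZ.
  suff -> : (e %/ p = wt d (q m))%N by exact: iswX.
  rewrite -(Fw m mF) {1}(qE m mF) /wt.
  under eq_bigr => i _ do rewrite mulmnE mulnA.
  by rewrite -big_distrl /= mulnK // prime_gt0.
have pM : p \in [pchar {mpoly 'F_p[r]}].
  by rewrite inE pp /= -(rmorph_nat (@mpolyC r 'F_p)) (pcharf0 pF) rmorph0.
rewrite -(pFrobenius_autE pM) rmorph_sum /= {1}(mpolyE F) big_seq [RHS]big_seq.
apply: eq_bigr => m mF; rewrite pFrobenius_autE exprZn mpolyXn -qE //.
by have := expf_card F@_m; rewrite card_Fp // => ->.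
Qed.

(** The derivation of [Q i] applied to the relation is triangular in the degrees: it kills [X j] of
    smaller degree, is a Kronecker delta on those of degree [d i], and the partials along larger
    degrees are already known to vanish. What is left is a relation of smaller weight for the i-th
    partial. *)
Lemma ev_indep (n p r : nat) (d : 'I_r -> nat) (X : 'I_r -> wfun 'F_p)
    (Q : 'I_r -> seq nat -> 'F_p) e (F : {mpoly 'F_p[r]}) :
  prime p -> (forall i, hom n (d i) (X i)) -> (forall i, 0 < d i)%N ->
  (forall i, indec n (Q i) (d i)) ->
  (forall i j, pairing n (Q i) (d i) (X j) = (i == j)%:R) ->
  isw d e F -> ev X F = 0 -> F = 0.
Proof.
move=> pp Xh d0 Qd QX; elim/ltn_ind: e F => e IH F Fw F0.
have [e0|e_gt0] := posnP e.
  have E m : m \in msupp F -> m = 0%MM.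
    move=> /Fw; rewrite e0 => /eqP; rewrite sum_nat_eq0 => /forallP H.
    apply/mnmP => i; rewrite mnm0E; apply/eqP.
    by have := H i; rewrite /= muln_eq0 (gtn_eqF (d0 i)).
  apply/mpolyP => m; rewrite mcoeff0; apply/eqP; rewrite mcoeff_eq0.
  apply/negP => mF; have m0 := E m mF; move: mF; rewrite m0 => F0s.
  have : ev X F [::] = F@_0.
    rewrite (mpolyE F) rmorph_sum /= wsumE (bigD1_seq 0%MM) //= ?msupp_uniq //.
    rewrite big_seq_cond big1 ?addr0; last by move=> m' /andP[/E -> /eqP].
    rewrite evZ mpolyX0 rmorph1 mulr1 /wconst /= mulr1n.
    by rewrite -mpolyE.
  by rewrite F0 => /esym/eqP; rewrite mcoeff_eq0 F0s.
have dF : forall i, F^`M(i) = 0.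
  (* Descending induction on [d i], with [l] bounding its distance to [e]; it starts with variables
     of degree above [e], which do not occur in [F]. *)
  suff H l i : (e < d i + l)%N -> F^`M(i) = 0 by move=> i; apply: (H e.+1); lia.
  elim: l i => [|l IHl] i.
    rewrite addn0 => eltd; apply/mpolyP => m; rewrite mcoeff0; apply/eqP.
    rewrite mcoeff_eq0; apply/negP => /(isw_deriv Fw); lia.
  have [lede|] := leqP (d i) e; last first.
    move=> edi _; apply/mpolyP => m; rewrite mcoeff0; apply/eqP.
    rewrite mcoeff_eq0; apply/negP => /(isw_deriv Fw); lia.
  rewrite addnS ltnS => eil.
  apply: (IH (e - d i)%N); first by have := d0 i; lia.
    by move=> m /(isw_deriv Fw); lia.
  have := der_ev Xh F (d0 i) (Qd i).
  rewrite F0 der0 (bigD1 i isT) (der_eq _ (Xh i)) QX eqxx.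
  rewrite (rmorph1 (@wconst 'F_p) : wconst (true%:R : 'F_p) = 1).
  rewrite mulr1 big1 /=; first by rewrite addr0 => <-.
  move=> j ji.
  have [dlt|dgt|de] := ltngtP (d j) (d i).
  - by rewrite (der_lt _ (Xh j)) ?mulr0.
  - by rewrite IHl ?rmorph0 ?mul0r //; lia.
  - have Xj := Xh j; rewrite de in Xj.
    by rewrite (der_eq _ Xj) QX eq_sym (negbTE ji) rmorph0 mulr0.
have [G [Gw E]] := mpoly_Fp_root pp Fw dF.
rewrite E in F0 *; suff -> : G = 0 by rewrite expr0n gtn_eqF ?prime_gt0.
apply: (IH (e %/ p)%N) => //; first by rewrite ltn_Pdiv ?prime_gt1.
by apply: (@wfun_reduced _ _ p); rewrite -rmorphXn.
Qed.

(** * Generators over a field *)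

Section Generators.
Context (n : nat) (K : fieldType).
Implicit Types (f g : wfun K) (Q : seq nat -> K) (e : nat).

(** The products [wdelta u * wdelta v] over these pairs span the decomposable elements of degree
    [e]. *)
Definition wprods e : seq (seq nat * seq nat) :=
  flatten [seq [seq (u, v) | u <- words n a, v <- words n (e - a)]
          | a <- iota 1 e.-1].

Lemma mem_wprods e a b u v : (0 < a)%N -> (0 < b)%N -> (a + b = e)%N ->
  u \in words n a -> v \in words n b -> (u, v) \in wprods e.
Proof.
move=> a0 b0 abe uW vW; apply/flattenP; eexists.
  by apply: map_f; rewrite mem_iota; instantiate (1 := a); lia.
by apply/allpairsP; exists (u, v); split=> //=; have -> : (e - a = b)%N by lia.
Qed.

Lemma wprodsP e t : t \in wprods e -> exists a b,
  [/\ (0 < a)%N, (0 < b)%N, (a + b = e)%N,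
      t.1 \in words n a & t.2 \in words n b].
Proof.
move=> /flattenP[s /mapP[a]]; rewrite mem_iota => aP -> /allpairsP[[u v]] /=.
by move=> [uW vW ->]; exists a, (e - a)%N; split=> //; move: aP; lia.
Qed.

Definition wvec e f : 'rV[K]_(size (words n e)) :=
  \row_j f (nth [::] (words n e) j).

Lemma sum_words e (F : seq nat -> K) :
  \sum_(u <- words n e) F u =
  \sum_(j < size (words n e)) F (nth [::] (words n e) j).
Proof. by rewrite (big_nth [::]) big_mkord. Qed.

(** The rows of [M] are the decomposables, so the columns of a column base [Qm] of its cokernel are
    a basis of the forms vanishing on them. The rows of a pseudo-inverse of [Qm] give dual elements,
    and a vector killed by [Qm] lies in the row space of [M]. *)
Lemma gens_deg e : exists s (X : 'I_s -> wfun K) (Q : 'I_s -> seq nat -> K),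
  [/\ forall j, hom n e (X j),
      forall j, indec n (Q j) e,
      forall i j, pairing n (Q i) e (X j) = (i == j)%:R
    & forall g, hom n e g -> (forall j, pairing n (Q j) e g = 0) ->
      exists c : nat -> K, g = \sum_(t < size (wprods e)) wconst (c t) *
        (wdelta K (nth ([::], [::]) (wprods e) t).1 *
         wdelta K (nth ([::], [::]) (wprods e) t).2)].
Proof.
pose W := words n e; pose N := size W; pose P := wprods e.
pose prod (t : seq nat * seq nat) : wfun K := wdelta K t.1 * wdelta K t.2.
pose pr t := prod (nth ([::], [::]) P t).
have hprod t : t \in P -> hom n e (prod t).
  move=> /wprodsP[a [b [_ _ <- t1 t2]]];
    exact: hom_mul (hom_delta _ t1) (hom_delta _ t2).
have hpr (t : 'I_(size P)) : hom n e (pr t) by apply: hprod; exact: mem_nth.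
pose M := \matrix_(t < size P) wvec e (pr t).
pose C := cokermx M; pose Qm := col_base C.
pose X (j : 'I_(\rank C)) : wfun K :=
  \sum_(i < N) wconst (pinvmx Qm j i) * wdelta K (nth [::] W i).
pose Q (j : 'I_(\rank C)) (u : seq nat) : K :=
  if insub (index u W) is Some i then Qm i j else 0.
have QE j (i : 'I_N) : Q j (nth [::] W i) = Qm i j.
  by rewrite /Q index_uniq ?words_uniq //= valK.
have pairE j f : pairing n (Q j) e f = (wvec e f *m Qm) 0 j.
  rewrite /pairing sum_words mxE; apply: eq_bigr => i _.
  by rewrite QE mulrC [wvec e f _ _]mxE.
have Xh j : hom n e (X j).
  apply: hom_sum => i _; apply: hom_constM; apply: hom_delta; exact: mem_nth.
have vecX j : wvec e (X j) = row j (pinvmx Qm).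
  apply/rowP => i; rewrite mxE [RHS]mxE /X wsumE (bigD1 i) //= wconstM /wdelta.
  have nW l : (l < N)%N -> wpos (nth [::] W l) = nth [::] W l.
    by move=> lN; have [] := wordsP (mem_nth [::] lN : _ \in words n e).
  rewrite nW // eqxx mulr1 big1 ?addr0 // => l li.
  rewrite wconstM nW // nth_uniq ?words_uniq // eq_sym (inj_eq val_inj).
  by rewrite (negbTE li) mulr0.
have MQ : M *m Qm = 0.
  apply: (row_free_inj (row_base_free C)).
  by rewrite -mulmxA mulmx_base mulmx_coker mul0mx.
exists (\rank C), X, Q; split=> //.
- move=> j a b f g a0 b0 abe fh gh.
  rewrite (wdelta_expand fh) (wdelta_expand gh) mulr_suml pairing_sum.
  rewrite big_seq big1 // => u uW; rewrite mulr_sumr pairing_sum.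
  rewrite big_seq big1 // => v vW.
  rewrite mulrACA -rmorphM pairing_constM -/(prod (u, v)).
  have tP : (u, v) \in P by exact: mem_wprods uW vW.
  rewrite pairE; have tP' := tP; rewrite -index_mem in tP'.
  have -> : wvec e (prod (u, v)) = row (Ordinal tP') M.
    by rewrite rowK /pr /= nth_index.
  by rewrite -row_mul MQ row0 mxE mulr0.
- move=> i j; rewrite pairE vecX -row_mul mulVpmx ?col_base_full //.
  by rewrite !mxE eq_sym.
- move=> g gh gQ.
  have : (wvec e g <= M)%MS.
    rewrite submxE -/C -(mulmx_base C) mulmxA.
    suff -> : wvec e g *m col_base C = 0 by rewrite mul0mx.
    by apply/rowP => j; rewrite -pairE gQ mxE.
  move=> /submxP[D gD].
  exists (fun t => if insub t is Some i then D 0 i else 0).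
  apply: (hom_ext gh).
    by apply: hom_sum => t _; apply: hom_constM; exact: (hpr t).
  move=> u uW; have uW' := uW; rewrite -index_mem in uW'.
  have -> : g u = wvec e g 0 (Ordinal uW') by rewrite mxE nth_index.
  rewrite gD mxE wsumE; apply: eq_bigr => t _.
  by rewrite mxE mxE wconstM valK /= nth_index.
Qed.

(** Degrees are glued one at a time. Duality persists because a form of one degree pairs to zero
    with elements of any other degree. *)
Lemma gens_upto D : exists r (d : 'I_r -> nat) (X : 'I_r -> wfun K)
    (Q : 'I_r -> seq nat -> K),
  [/\ forall i, [/\ hom n (d i) (X i), (0 < d i)%N & (d i <= D)%N],
      forall i, indec n (Q i) (d i),
      forall i j, pairing n (Q i) (d i) (X j) = (i == j)%:R
    & forall e g, (0 < e <= D)%N -> hom n e g ->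
      (forall i, d i = e -> pairing n (Q i) e g = 0) ->
      exists c : nat -> K, g = \sum_(t < size (wprods e)) wconst (c t) *
        (wdelta K (nth ([::], [::]) (wprods e) t).1 *
         wdelta K (nth ([::], [::]) (wprods e) t).2)].
Proof.
elim: D => [|D [r [d [X [Q [Xh Qd QX gen]]]]]].
  exists 0%N, (fun=> 0%N), (fun=> 0), (fun=> fun=> 0).
  by split=> [[]//|[]//|[]//|[|e] g].
have [s [X' [Q' [Xh' Qd' QX' gen']]]] := gens_deg D.+1.
pose glue T (a : 'I_r -> T) (b : 'I_s -> T) (i : 'I_(r + s)) :=
  match split i with inl i => a i | inr i => b i end.
have glueL T a b i : @glue T a b (lshift s i) = a i.
  by rewrite /glue -[lshift s i]/(unsplit (inl i)) unsplitK.
have glueR T a b i : @glue T a b (rshift r i) = b i.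
  by rewrite /glue -[rshift r i]/(unsplit (inr i)) unsplitK.
exists (r + s)%N, (glue _ d (fun=> D.+1)), (glue _ X X'), (glue _ Q Q'); split.
- move=> i; case: (split_ordP i) => j ->; rewrite ?glueL ?glueR //.
  by have [Xj dj djD] := Xh j; split=> //; lia.
- by move=> i; case: (split_ordP i) => j ->; rewrite ?glueL ?glueR.
- move=> i j; case: (split_ordP i) => i' ->; case: (split_ordP j) => j' ->.
  + by rewrite !glueL QX (inj_eq (@lshift_inj _ _)).
  + rewrite !glueL glueR (pairing_hom _ (Xh' j')) ?eq_lrshift //.
    by have [_ _] := Xh i'; lia.
  + rewrite !glueR glueL; have [Xj _ dj] := Xh j'.
    by rewrite (pairing_hom _ Xj) ?eq_rlshift //; lia.
  + by rewrite !glueR QX' (inj_eq (@rshift_inj _ _)).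
- move=> e g eD gh gQ; case: (eqVneq e D.+1) => [eE|eD'].
    rewrite eE in gh gQ *; apply: gen' => // j.
    by have := gQ (rshift r j); rewrite !glueR; apply.
  apply: gen => //; first by lia.
  by move=> i di; have := gQ (lshift s i); rewrite !glueL; apply.
Qed.

Section Generation.
Context (r : nat) (d : 'I_r -> nat) (X : 'I_r -> wfun K)
  (Q : 'I_r -> seq nat -> K) (D : nat).
Hypothesis Xh : forall i, hom n (d i) (X i).
Hypothesis QX : forall i j, pairing n (Q i) (d i) (X j) = (i == j)%:R.
Hypothesis gen : forall e g, (0 < e <= D)%N -> hom n e g ->
  (forall i, d i = e -> pairing n (Q i) e g = 0) ->
  exists c : nat -> K, g = \sum_(t < size (wprods e)) wconst (c t) *
    (wdelta K (nth ([::], [::]) (wprods e) t).1 *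
     wdelta K (nth ([::], [::]) (wprods e) t).2).

Definition evimg e f := exists F, isw d e F /\ f = ev X F.

Lemma evimgD e f g : evimg e f -> evimg e g -> evimg e (f + g).
Proof.
move=> [F [Fw ->]] [G [Gw ->]]; exists (F + G).
by split; [exact: iswD | rewrite rmorphD].
Qed.

Lemma evimgZ e c f : evimg e f -> evimg e (wconst c * f).
Proof.
move=> [F [Fw ->]]; exists (c *: F).
by split; [exact: iswZ | rewrite evZ].
Qed.

Lemma evimg_sum e (I : Type) (s : seq I) (P : pred I) (E : I -> wfun K) :
  (forall i, P i -> evimg e (E i)) -> evimg e (\sum_(i <- s | P i) E i).
Proof.
move=> H; elim/big_rec: _ => [|i x Pi Hx]; last by apply: evimgD => //;
  exact: H.
by exists 0; split; [exact: isw0 | rewrite rmorph0].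
Qed.

(** Subtracting the component along the generators of degree [e] leaves a function killed by all the
    forms, hence a combination of products of lower degree, to which induction applies. *)
Lemma hom_evimg e f : (e <= D)%N -> hom n e f -> evimg e f.
Proof.
elim/ltn_ind: e f => e IH f eD fh.
case: (posnP e) => [e0|e_gt0].
  rewrite e0 in fh *; rewrite (hom0_const fh) -[wconst _]mulr1; apply: evimgZ.
  exists 1; rewrite rmorph1; split=> // m.
  rewrite -mpolyC1 msuppC oner_eq0 inE => /eqP ->.
  by rewrite /wt big1 // => i _; rewrite mnm0E muln0.
pose h := \sum_(i | d i == e) wconst (pairing n (Q i) e f) * X i.
have hh : hom n e h.
  by apply: hom_sum => i /eqP <-; apply: hom_constM.
have gh : hom n e (f - h).
  rewrite -mulN1r -(rmorph1 (@wconst K)) -(rmorphN (@wconst K)).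
  by apply: hom_add => //; apply: hom_constM.
have [|i di|c E] := gen _ gh; first by rewrite e_gt0.
  rewrite -mulN1r -(rmorph1 (@wconst K)) -(rmorphN (@wconst K)).
  have -> : pairing n (Q i) e (f + wconst (-1) * h) =
      pairing n (Q i) e f + pairing n (Q i) e (wconst (-1) * h).
    by rewrite /pairing -big_split; apply: eq_bigr => u _; rewrite waddE mulrDr.
  have QXi j : pairing n (Q i) e (X j) = (i == j)%:R by rewrite -di.
  rewrite pairing_constM pairing_sum (bigD1 i) ?di //= pairing_constM QXi.
  rewrite eqxx mulr1 big1 ?addr0 ?mulN1r ?subrr // => j /andP[/eqP dj ji].
  by rewrite pairing_constM QXi eq_sym (negbTE ji) mulr0.
rewrite -[f](subrK h) E; apply: evimgD.
  apply: evimg_sum => t _; apply: evimgZ.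
  have [a [b [a0 b0 abe t1 t2]]] := wprodsP (mem_nth ([::], [::]) (ltn_ord t)).
  have [F [Fw ->]] : evimg a (wdelta K (nth ([::], [::]) (wprods e) t).1).
    by apply: IH; [lia | lia | exact: hom_delta].
  have [G [Gw ->]] : evimg b (wdelta K (nth ([::], [::]) (wprods e) t).2).
    by apply: IH; [lia | lia | exact: hom_delta].
  by exists (F * G); rewrite rmorphM -abe; split=> //; exact: iswM.
apply: evimg_sum => i /eqP di; apply: evimgZ; exists 'X_i.
by rewrite evX; split=> //; rewrite -di -wt1; exact: iswX.
Qed.

End Generation.
End Generators.

(** * From the prime field to the integers *)

Section Reduction.
Context (n p : nat).
Hypothesis pp : prime p.

Definition wred (f : wfun int) : wfun 'F_p := fun w => (f w)%:~R.
(** Representatives below [p], chosen value by value: a mere section of [wred], not a ring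
    homomorphism. *)
Definition wlift (f : wfun 'F_p) : wfun int := fun w => (f w : nat)%:Z.

Lemma wred_is_zmod_morphism : zmod_morphism wred.
Proof. by move=> f g; apply/funext => w; rewrite /wred rmorphB. Qed.

Lemma wred_is_monoid_morphism : monoid_morphism wred.
Proof.
split=> [|f g]; apply/funext => w; first by rewrite /wred !woneE; case: eqP.
rewrite /wred !wmulE rmorph_sum; apply: eq_bigr => s _; exact: rmorphM.
Qed.

HB.instance Definition _ :=
  GRing.isZmodMorphism.Build (wfun int) (wfun 'F_p) wred wred_is_zmod_morphism.
HB.instance Definition _ :=
  GRing.isMonoidMorphism.Build (wfun int) (wfun 'F_p) wred
    wred_is_monoid_morphism.

Lemma Fp_lift (x : 'F_p) : ((x : nat)%:Z)%:~R = x.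
Proof. exact: natr_Zp. Qed.

Lemma wlift_hom e f : hom n e f -> hom n e (wlift f).
Proof.
move=> [[fz fb] fh]; split; first split=> w; rewrite /wlift.
- by rewrite -fz.
- by move=> /fb ->.
- by move=> w /fh ->.
Qed.

Lemma wredK f : wred (wlift f) = f.
Proof. by apply/funext => w; rewrite /wred /wlift Fp_lift. Qed.

Lemma wred_ev r (X : 'I_r -> wfun 'F_p) (F : {mpoly int[r]}) :
  wred (ev (fun i => wlift (X i)) F) = ev X (map_mpoly intr F).
Proof.
elim/mpolyind: F => [|c m F _ _ IH]; first by rewrite !(rmorph0, raddf0).
rewrite !(rmorphD, raddfD) /= IH; congr (_ + _).
rewrite map_mpolyZ !evZ rmorphM /= map_mpolyX.
congr (_ * _).
  by apply/funext => w; rewrite /wred /wconst; case: eqP;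
    rewrite ?mulr1n ?mulr0n.
rewrite !evE !mmapX rmorph_prod /=; apply: eq_bigr => i _.
by rewrite rmorphXn /= wredK.
Qed.

Lemma Fp_intr_eq0 (a : int) : ((a%:~R : 'F_p) == 0) = (p%:Z %| a)%Z.
Proof.
have E (m : nat) : ((m%:Z)%:~R : 'F_p) = m%:R by [].
rewrite {1}[a]intEsign rmorphM rmorph_sign mulf_eq0 signr_eq0 /= E.
by rewrite -(dvdn_pcharf (pchar_Fp pp)).
Qed.

Definition mdivp (r : nat) (F : {mpoly int[r]}) : {mpoly int[r]} :=
  \sum_(m <- msupp F) (F@_m %/ p%:Z)%Z *: 'X_[m].

Lemma isw_reduce (r : nat) (d : 'I_r -> nat) e (F : {mpoly int[r]}) :
  isw d e F -> isw d e (map_mpoly (intr : int -> 'F_p) F).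
Proof.
move=> Fw m; rewrite mcoeff_msupp mcoeff_map_mpoly => H; apply: Fw.
by rewrite mcoeff_msupp; apply: contraNneq H => ->.
Qed.

Lemma mpoly_lift (r : nat) (d : 'I_r -> nat) e (F : {mpoly 'F_p[r]}) :
  isw d e F -> exists G, isw d e G /\ map_mpoly intr G = F.
Proof.
move=> Fw; exists (\sum_(m <- msupp F) (F@_m : nat)%:Z *: 'X_[m]); split.
  rewrite big_seq; apply: isw_sum => m /Fw <-; apply: iswZ; exact: iswX.
rewrite [RHS](mpolyE F) (raddf_sum (map_mpoly (intr : int -> 'F_p))) /=.
by apply: eq_bigr => m _; rewrite map_mpolyZ map_mpolyX /= Fp_lift.
Qed.

(* A relation over the integers would be divisible by every power of p. *)
Lemma ev_indep_int r (d : 'I_r -> nat) (X : 'I_r -> wfun 'F_p)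
    (Q : 'I_r -> seq nat -> 'F_p) e (F : {mpoly int[r]}) :
  (forall i, hom n (d i) (X i)) -> (forall i, 0 < d i)%N ->
  (forall i, indec n (Q i) (d i)) ->
  (forall i j, pairing n (Q i) (d i) (X j) = (i == j)%:R) ->
  isw d e F -> ev (fun i => wlift (X i)) F = 0 -> F = 0.
Proof.
move=> Xh d0 Qd QX Fw F0.
have H s : exists F1, [/\ isw d e F1, ev (fun i => wlift (X i)) F1 = 0
    & F = (p%:Z ^+ s) *: F1].
  elim: s => [|s [F1 [F1w F10 ->]]]; first by exists F; rewrite expr0 scale1r.
  have dvd m : (p%:Z %| F1@_m)%Z.
    rewrite -Fp_intr_eq0 -mcoeff_map_mpoly.
    have -> : map_mpoly (intr : int -> 'F_p) F1 = 0; last by rewrite mcoeff0.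
    apply: (ev_indep pp Xh d0 Qd QX (isw_reduce F1w)).
    by rewrite -wred_ev F10 rmorph0.
  have E : F1 = p%:Z *: mdivp F1.
    rewrite {1}(mpolyE F1) scaler_sumr; apply: eq_bigr => m _.
    by rewrite scalerA mulrC divzK.
  exists (mdivp F1); split.
  - rewrite /mdivp big_seq; apply: isw_sum => m /F1w <-; apply: iswZ.
    exact: iswX.
  - move: F10; rewrite {1}E evZ => F10; apply/funext => w.
    have /eqP := congr1 (@^~ w) F10;
      rewrite wconstM mulf_eq0 => /orP[|/eqP->//].
    by rewrite eqz_nat gtn_eqF ?prime_gt0.
  - by rewrite {1}E scalerA -exprSr.
apply/mpolyP => m; rewrite mcoeff0.
have [F1 [_ _ /(congr1 (mcoeff m))]] := H `|F@_m|%N.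
rewrite mcoeffZ => E; apply/eqP; rewrite -absz_eq0.
have : (p ^ `|F@_m| %| `|F@_m|)%N.
  by rewrite {2}E abszM abszX /= dvdn_mulr.
case: posnP => [->//|H0] /dvdn_leq => /(_ H0).
by rewrite leqNgt ltn_expl ?prime_gt1.
Qed.

(** Nakayama by determinants. Modulo [p] each [wdelta] of degree [e] is a polynomial in the
    generators, so over the integers the polynomials [G0] are obtained from the [wdelta] by a matrix
    [A] = 1 - p T. Its determinant [c] is 1 modulo [p], and the adjugate expresses [c] times each
    [wdelta] through the lifted generators. *)
Lemma local_generators D : exists r (d : 'I_r -> nat) (X : 'I_r -> wfun int),
  [/\ forall i, hom n (d i) (X i),
      forall e F, isw d e F -> ev X F = 0 -> F = 0
    & forall e, (e <= D)%N -> exists2 c : int, ~~ (p%:Z %| c)%Z &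
        exists G : seq nat -> {mpoly int[r]}, forall u, u \in words n e ->
          isw d e (G u) /\ wconst c * wdelta int u = ev X (G u)].
Proof.
have [r [d [X [Q [Xh Qd QX gen]]]]] := gens_upto n 'F_p D.
have Xhom i : hom n (d i) (X i) by have [] := Xh i.
pose Y i := wlift (X i).
have Yh i : hom n (d i) (Y i) by exact: wlift_hom.
exists r, d, Y; split=> //.
  by move=> e F; apply: (ev_indep_int Xhom _ Qd QX) => i; have [] := Xh i.
move=> e eD; pose W := words n e; pose N := size W.
have /choice[G0 G0P] : forall i : 'I_N, exists G, isw d e G /\
    forall w, (p%:Z %| (wdelta int (nth [::] W i) - ev Y G) w)%Z.
  move=> i.
  have [|F [Fw FE]] := hom_evimg Xhom QX gen eD
    (_ : hom n e (wdelta 'F_p (nth [::] W i))).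
    by apply: hom_delta; exact: mem_nth.
  have [G [Gw GE]] := mpoly_lift Fw; exists G; split=> // w.
  rewrite -Fp_intr_eq0; apply/eqP.
  rewrite -[LHS]/(wred (wdelta int (nth [::] W i) - ev Y G) w) rmorphB /=.
  rewrite wred_ev GE -FE; apply/eqP; rewrite subr_eq0; apply/eqP.
  by rewrite /wred /wdelta; case: eqP.
pose T (i j : 'I_N) :=
  ((wdelta int (nth [::] W i) - ev Y (G0 i)) (nth [::] W j) %/ p%:Z)%Z.
pose A : 'M[int]_N := 1%:M - \matrix_(i, j) (p%:Z * T i j).
have AE i : \sum_j wconst (A i j) * wdelta int (nth [::] W j) = ev Y (G0 i).
  have [Gw Gd] := G0P i.
  have dh j : hom n e (wdelta int (nth [::] W (j : 'I_N))).
    by apply: hom_delta; exact: mem_nth.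
  apply: (hom_ext (e := e) (n := n)).
  - by apply: hom_sum => j _; exact: hom_constM.
  - exact: ev_hom.
  move=> u uW; have uN := uW; rewrite -index_mem in uN.
  rewrite -(nth_index [::] uW) -/W -[index u W]/(val (Ordinal uN)).
  move: (Ordinal uN) => l {uN uW u}.
  have nW i' : wpos (nth [::] W (i' : 'I_N)) = nth [::] W i'.
    by have [] := wordsP (mem_nth [::] (ltn_ord i') : _ \in words n e).
  have dE i' : wdelta int (nth [::] W (i' : 'I_N)) (nth [::] W l) =
    (i' == l)%:R.
    by rewrite /wdelta nW nth_uniq ?words_uniq // eq_sym.
  rewrite wsumE (bigD1 l) //= wconstM dE eqxx mulr1 big1 ?addr0; last first.
    by move=> j jl; rewrite wconstM dE (negbTE jl) mulr0.
  have BE (f g : wfun int) w : (f - g) w = f w - g w by [].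
  rewrite !mxE mulrC divzK //.
  by rewrite BE dE opprB addrC subrK.
exists (\det A).
  rewrite -Fp_intr_eq0 -det_map_mx.
  have p0 : ((p%:Z)%:~R : 'F_p) = 0 by apply/eqP; rewrite Fp_intr_eq0.
  have -> : map_mx (intr : int -> 'F_p) A = 1%:M.
    apply/matrixP => i j; rewrite !mxE rmorphB rmorphM /= p0 mul0r subr0.
    by case: eqP.
  by rewrite det1 oner_eq0.
exists (fun u => \sum_j (if insub (index u W) is Some i then (\adj A) i j
  else 0) *: G0 j) => u uW.
have uN := uW; rewrite -index_mem in uN.
rewrite insubT /=; set i := Sub _ _; split.
  by apply: isw_sum => j _; apply: iswZ; have [] := G0P j.
rewrite [RHS](rmorph_sum (ev Y)) /=; under [RHS]eq_bigr => j _.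
  rewrite evZ -AE mulr_sumr.
  under eq_bigr => l _ do rewrite mulrA -rmorphM.
  over.
rewrite [RHS]exchange_big /=.
under [RHS]eq_bigr => l _ do rewrite -mulr_suml -rmorph_sum.
have adjE l : \sum_j (\adj A) i j * A j l = \det A *+ (i == l).
  by have /matrixP/(_ i l) := mul_adj_mx A; rewrite !mxE.
under [RHS]eq_bigr => l _ do rewrite adjE.
rewrite [RHS](bigD1 i) //= eqxx mulr1n nth_index // big1 ?addr0 // => j ji.
by rewrite eq_sym (negbTE ji) rmorph0 mul0r.
Qed.

End Reduction.

Lemma int_ideal1 (I : int -> Prop) :
  (forall a b, I a -> I b -> I (a + b)) -> (forall a b, I b -> I (a * b)) ->
  (forall p, prime p -> exists2 c : int, ~~ (p%:Z %| c)%Z & I c) -> I 1.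
Proof.
move=> ID IM Ip.
have ex : exists g : nat, `[< I g%:Z >] && (0 < g)%N.
  (* The prime 2 serves only to produce a nonzero element. *)
  have [c c2 Ic] := Ip 2 isT; exists `|c|%N; apply/andP; split.
    by apply/asboolP; rewrite abszEsg; exact: IM.
  by rewrite absz_gt0; apply: contraNneq c2 => ->; exact: dvdz0.
case: (ex_minnP ex) => g /andP[/asboolP Ig g0] gmin.
have [g1|g1] := leqP g 1.
  have gE : g = 1%N by lia.
  by rewrite gE in Ig.
have [c pc Ic] := Ip _ (pdiv_prime g1).
have [u [v uv]] := Bezoutz g%:Z c.
have Igcd : I (gcdz g%:Z c) by rewrite -uv; apply: ID; exact: IM.
have le_gcd : (g <= gcdn g `|c|)%N.
  by apply: gmin; rewrite gcdn_gt0 g0 andbT; apply/asboolP.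
have gE : gcdn g `|c| = g.
  by apply/eqP; rewrite eqn_leq le_gcd andbT dvdn_leq ?dvdn_gcdl.
case/negP: pc; rewrite /dvdz /=; apply: dvdn_trans (pdiv_dvd g) _.
by rewrite -gE dvdn_gcdr.
Qed.

(** * Extending a truncated homomorphism to the integers *)

Section Extension.
Context (n : nat).
Hypothesis n0 : (0 < n)%N.
Implicit Types (f g : wfun int) (beta : seq nat -> int).

(** Multiplicativity up to degree [D] of the linear forms with values [beta] on the [wdelta].
    Dually, the sums of [beta w] times [w] over the words of each degree are the coefficients of a
    truncated curve. *)
Definition wmult beta D := forall a b f g, (a + b <= D)%N ->
  hom n a f -> hom n b g ->
  pairing n beta (a + b) (f * g) = pairing n beta a f * pairing n beta b g.

Lemma pairing_eq beta beta' e f : {in words n e, beta =1 beta'} ->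
  pairing n beta e f = pairing n beta' e f.
Proof.
by move=> E; rewrite /pairing big_seq [RHS]big_seq; apply: eq_bigr => u /E ->.
Qed.

Lemma words0 : words n 0 = [:: [::]]. Proof. by []. Qed.

Lemma words_lt e : (0 < e < n)%N -> words n e = [::].
Proof.
move=> en; case E : (words n e) => [//|u s].
have : u \in words n e by rewrite E mem_head.
rewrite mem_words; case: u {E} => [|i u] /=; first by lia.
by case/and3P => _ /andP[ni _] /eqP; lia.
Qed.

Lemma words_n : words n n = [:: [:: n]].
Proof.
apply/perm_small_eq => //; apply: uniq_perm => [||w]; rewrite ?words_uniq //.
rewrite mem_words inE; apply/idP/eqP => [|-> /=]; last first.
  by rewrite !andbT addn0 eqxx leqnn n0.
case: w => [|i [|j w]] /=; first by lia.
  by case/and3P => _ _ /eqP <-; rewrite addn0.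
by case/and3P => _ /and3P[] ? ? _ /eqP; lia.
Qed.

Lemma pairing0_wconst beta c : pairing n beta 0 (wconst c) = beta [::] * c.
Proof. by rewrite /pairing words0 big_seq1 /wconst /= mulr1n. Qed.

Lemma wmult_0l beta b f g : beta [::] = 1 -> hom n 0 f ->
  pairing n beta b (f * g) = pairing n beta 0 f * pairing n beta b g.
Proof.
move=> b0 /hom0_const ->; rewrite pairing_constM pairing0_wconst b0.
by rewrite mul1r.
Qed.

Lemma wmult_pos beta D : beta [::] = 1 ->
  (forall a b f g, (0 < a)%N -> (0 < b)%N -> (a + b <= D)%N ->
    hom n a f -> hom n b g ->
    pairing n beta (a + b) (f * g) = pairing n beta a f * pairing n beta b g) ->
  wmult beta D.
Proof.
move=> b0 H [|a] [|b] f g abD fh gh; rewrite ?add0n ?addn0.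
- exact: wmult_0l.
- exact: wmult_0l.
- by rewrite mulrC wmult_0l // mulrC.
- exact: H.
Qed.

(** A multiplicative form is evaluation at its values on the generators; the values [c i] in degrees
    above [D] are free because such variables do not occur in weight at most [D]. *)
Lemma meval_ev r (d : 'I_r -> nat) (X : 'I_r -> wfun int) beta D
    (c : 'I_r -> int) e (F : {mpoly int[r]}) :
  beta [::] = 1 -> wmult beta D -> (forall i, hom n (d i) (X i)) ->
  (forall i, (d i <= D)%N -> c i = pairing n beta (d i) (X i)) ->
  (e <= D)%N -> isw d e F -> F.@[c] = pairing n beta e (ev X F).
Proof.
move=> b0 bM Xh cE eD Fw.
rewrite {2}(mpolyE F) mevalE (rmorph_sum (ev X)) pairing_sum.
rewrite big_seq [RHS]big_seq; apply: eq_bigr => m mF.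
rewrite /= evZ pairing_constM -mevalX; congr (_ * _).
have := Fw m mF; elim/mpolyX_ind: m e eD {mF Fw F} => [|i m IH] e eD.
  rewrite /wt big1 => [<-|i _]; last by rewrite mnm0E muln0.
  by rewrite mpolyX0 meval1 (rmorph1 (ev X)) -(rmorph1 (@wconst int))
    pairing0_wconst b0.
rewrite wtD wt1 => eE; rewrite mpolyXD mevalM mevalXU rmorphM /= evX -eE.
have mD : (wt d m <= D)%N by lia.
rewrite bM ?eE // -?IH // ?cE //; first lia.
by apply: (ev_hom Xh); exact: iswX.
Qed.

(* The multiples of beta that extend to degree d form an ideal of int, and the
   algebraically independent generators modulo p show that this ideal is not
   contained in (p). *)
Lemma extend_degree beta D : beta [::] = 1 -> wmult beta D ->
  exists beta0 : seq nat -> int, forall a b f g, (0 < a)%N -> (0 < b)%N ->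
    (a + b = D.+1)%N -> hom n a f -> hom n b g ->
    pairing n beta0 D.+1 (f * g) = pairing n beta a f * pairing n beta b g.
Proof.
move=> b0 bM.
pose I (c : int) := exists beta0 : seq nat -> int, forall a b f g,
  (0 < a)%N -> (0 < b)%N -> (a + b = D.+1)%N -> hom n a f -> hom n b g ->
  pairing n beta0 D.+1 (f * g) = c * (pairing n beta a f * pairing n beta b g).
suff [beta0 H] : I 1.
  by exists beta0 => a b f g ? ? ? ? ?; rewrite (H a b) ?mul1r.
apply: int_ideal1 => [c c' [x xP] [y yP]|c c' [x xP]|p pp].
- exists (fun w => x w + y w) => a b f g a1 b1 abD fh gh.
  rewrite mulrDl -(xP a b f g) // -(yP a b f g) // -big_split /=.
  by apply: eq_bigr => u _; rewrite mulrDl.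
- exists (fun w => c * x w) => a b f g a1 b1 abD fh gh.
  rewrite -mulrA -(xP a b f g) // /pairing mulr_sumr.
  by apply: eq_bigr => u _; rewrite mulrA.
have [r [d [X [Xh indep span]]]] := local_generators n pp D.+1.
have [c pc [G GP]] := span D.+1 (leqnn _).
exists c => //.
(* The new form is evaluation at [cv] of the polynomials [G w] representing [c] times [wdelta w].
   Generators of degree above [D] may take any value, and 0 is chosen. *)
pose cv i := if (d i <= D)%N then pairing n beta (d i) (X i) else 0.
have cvE i : (d i <= D)%N -> cv i = pairing n beta (d i) (X i).
  by rewrite /cv => ->.
have span1 e f : (e <= D.+1)%N -> hom n e f -> exists2 c' : int, c' != 0 &
    exists F, isw d e F /\ wconst c' * f = ev X F.
  move=> eD fh; have [c' pc' [G' GP']] := span e eD; exists c'.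
    by apply: contraNneq pc' => ->; exact: dvdz0.
  exists (\sum_(u <- words n e) f u *: G' u); split.
    by rewrite big_seq; apply: isw_sum => u /GP'[Gw _]; exact: iswZ.
  rewrite {1}(wdelta_expand fh) mulr_sumr (rmorph_sum (ev X)) big_seq
    [RHS]big_seq.
  apply: eq_bigr => u /GP'[_ E]; by rewrite /= evZ -E mulrCA.
exists (fun w => (G w).@[cv]) => a b f g a1 b1 abD fh gh.
have [ca ca0 [Ff [Fw FE]]] : exists2 c' : int, c' != 0 &
    exists F, isw d a F /\ wconst c' * f = ev X F by apply: span1 => //; lia.
have [cb cb0 [Fg [Gw GE]]] : exists2 c' : int, c' != 0 &
    exists F, isw d b F /\ wconst c' * g = ev X F by apply: span1 => //; lia.
pose H := \sum_(u <- words n D.+1) (f * g) u *: G u.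
have Hw : isw d D.+1 H.
  by rewrite /H big_seq; apply: isw_sum => u /GP[uw _]; exact: iswZ.
have HE : ev X H = wconst c * (f * g).
  have fgh : hom n D.+1 (f * g) by rewrite -abD; exact: hom_mul.
  rewrite [in RHS](wdelta_expand fgh) mulr_sumr /H (rmorph_sum (ev X)) big_seq.
  rewrite [RHS]big_seq; apply: eq_bigr => u /GP[_ E].
  by rewrite /= evZ -E mulrCA.
(* The representing polynomials are only known to agree after evaluation at [X]; independence makes
   them equal as polynomials, so [cv] can be substituted. The nonzero factor [ca * cb] is cancelled
   at the end. *)
have /subr0_eq E : c *: (Ff * Fg) - (ca * cb) *: H = 0.
  apply: (indep D.+1).
    rewrite -scaleN1r; apply: iswD; last by do 2!apply: iswZ.
    by apply: iswZ; rewrite -abD; exact: iswM.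
  rewrite rmorphB /= !evZ rmorphM /= -FE -GE HE rmorphM.
  by rewrite /= [wconst ca * f * _]mulrACA [X in X - _]mulrCA subrr.
have := congr1 (meval cv) E; rewrite !mevalZ mevalM.
rewrite (meval_ev b0 bM Xh cvE _ Fw) ?(meval_ev b0 bM Xh cvE _ Gw); try lia.
rewrite -FE -GE !pairing_constM [_ * _ * (_ * _)]mulrACA [LHS]mulrCA =>
  /mulfI E'.
have -> : pairing n (fun w => (G w).@[cv]) D.+1 (f * g) = H.@[cv].
  rewrite /H (raddf_sum (meval cv)); apply: eq_bigr => u _.
  by rewrite /= mevalZ mulrC.
by rewrite E' // mulf_neq0.
Qed.

(** The vanishing in degrees not divisible by [n] makes the dual curve a series in x^n, so that its
    coefficient at x^n, the word [[:: n]], can become a first coefficient. *)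
Definition wcurve beta D := [/\ beta [::] = 1, beta [:: n] = 1,
  forall e, (e <= D)%N -> ~~ (n %| e)%N -> {in words n e, beta =1 fun=> 0}
  & wmult beta D].

(** Up to degree [n] a product of two positive degrees has a factor of degree strictly between 0 and
    [n], where there are no words. *)
Lemma wcurve_start : wcurve (fun w => ((w == [::]) || (w == [:: n]))%:R) n.
Proof.
split; rewrite ?eqxx ?orbT //.
- move=> e en ne w wW; case: eqP wW => [->|_] /=.
    by rewrite mem_words /=; case: eqP ne => // <-; rewrite dvdn0.
  case: eqP => [->|//]; rewrite mem_words => /and3P[_ _ /eqP] /=.
  by rewrite addn0 => nE; rewrite -nE dvdnn in ne.
- apply: wmult_pos => // a b f g a1 b1 abn fh gh.
  have -> : f = 0.
    by rewrite (wdelta_expand fh) words_lt ?big_nil //; lia.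
  rewrite mul0r /pairing big1 ?[X in X * _]big1 ?mul0r // => u _;
    exact: mulr0.
Qed.

(** In a new degree not divisible by [n] the value 0 is imposed. This is multiplicative: of two
    degrees with such a sum, one is itself not divisible by [n], and there [beta] already
    vanishes. *)
Lemma wcurve_extend beta D : (n <= D)%N -> wcurve beta D ->
  exists beta', wcurve beta' D.+1 /\
    forall w, (sumn w <= D)%N -> beta' w = beta w.
Proof.
move=> nD [b0 bn bs bM].
have [beta0 H] := extend_degree b0 bM.
pose beta' w := if sumn w == D.+1 then (if (n %| D.+1)%N then beta0 w else 0)
  else beta w.
have bE w : (sumn w <= D)%N -> beta' w = beta w.
  by rewrite /beta' => wD; case: eqP => // E; move: wD; rewrite E ltnn.
have pE e f : (e <= D)%N -> pairing n beta' e f = pairing n beta e f.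
  by move=> eD; apply: pairing_eq => u /wordsP[_ _ us]; apply: bE; rewrite us.
exists beta'; split=> //; split.
- by rewrite bE.
- by rewrite bE //= addn0.
- move=> e eD ne w wW; have [_ _ ws] := wordsP wW.
  rewrite /beta'; case: eqP => [E|ws'].
    by rewrite -E ws (negbTE ne).
  by apply: (bs e) => //; lia.
- apply: wmult_pos; first by rewrite bE.
  move=> a b f g a1 b1 abD fh gh.
  rewrite (pE a) ?(pE b); try lia.
  have [abE|ab] := eqVneq (a + b)%N D.+1; last by rewrite pE ?bM //; lia.
  rewrite abE; have [nd|nd] := boolP (n %| D.+1)%N.
    rewrite -(H a b) //; apply: pairing_eq => u /wordsP[_ _ us].
    by rewrite /beta' us eqxx nd.
  have z e h : (e <= D)%N -> ~~ (n %| e)%N -> pairing n beta e h = 0.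
    move=> eD ne; rewrite /pairing big_seq big1 // => u /(bs e eD ne) ->.
    exact: mul0r.
  transitivity (0 : int).
    rewrite /pairing big_seq big1 // => u /wordsP[_ _ us].
    by rewrite /beta' us eqxx (negbTE nd) mul0r.
  have [na|na] := boolP (n %| a)%N; last by rewrite z ?mul0r //; lia.
  rewrite [X in _ * X]z ?mulr0 //; first by lia.
  by apply: contra nd => nb; rewrite -abE dvdn_add.
Qed.

(** Stage [l] of the chosen extensions is valid up to degree [n + l] and agrees with the earlier
    ones, so the value at [w] may be read at stage [sumn w]. *)
Theorem universal_curve : exists beta, forall D, wcurve beta D.
Proof.
have /choice[ext extP] : forall x : nat * (seq nat -> int), exists beta',
    (n <= x.1)%N -> wcurve x.2 x.1 -> wcurve beta' x.1.+1 /\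
    forall w, (sumn w <= x.1)%N -> beta' w = x.2 w.
  move=> [D beta]; case: (pselect ((n <= D)%N /\ wcurve beta D)) => [[nD bD]|N].
    by have [beta' P] := wcurve_extend nD bD; exists beta'.
  by exists beta => nD bD; case: N.
pose fix b l : seq nat -> int := if l is l'.+1 then ext ((n + l')%N, b l')
  else fun w => ((w == [::]) || (w == [:: n]))%:R.
have bP l : wcurve (b l) (n + l)%N.
  elim: l => [|l IH]; first by rewrite addn0; exact: wcurve_start.
  by rewrite addnS; have [] := extP ((n + l)%N, b l) (leq_addr _ _) IH.
have bS l w : (sumn w <= n + l)%N -> b l.+1 w = b l w.
  by have [_] := extP ((n + l)%N, b l) (leq_addr _ _) (bP l); apply.
have bmono w l l' : (l <= l')%N -> (sumn w <= n + l)%N -> b l' w = b l w.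
  elim: l' => [|l' IH]; first by rewrite leqn0 => /eqP ->.
  rewrite leq_eqVlt => /orP[/eqP -> //|]; rewrite ltnS => ll' wl.
  by rewrite bS ?IH //; lia.
have bE w l : (sumn w <= n + l)%N -> b l w = b (sumn w) w.
  move=> wl; have [le_wl|/ltnW le_lw] := leqP (sumn w) l.
    by apply: bmono => //; exact: leq_addl.
  by rewrite (bmono w l (sumn w)).
exists (fun w => b (sumn w) w) => D; have [c0 cn cs cM] := bP D.
have pE e f : (e <= D)%N ->
    pairing n (fun w => b (sumn w) w) e f = pairing n (b D) e f.
  by move=> eD; apply: pairing_eq => u /wordsP[_ _ us]; rewrite bE // us; lia.
split.
- by rewrite /=; have [] := bP 0%N.
- by rewrite -(bE _ D) //= addn0 leq_addr.
- move=> e eD ne w wW; have [_ _ ws] := wordsP wW.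
  by rewrite -(bE _ D) ?(cs e) ?ws //; lia.
- move=> a b' f g abD fh gh; rewrite !pE ?cM //; lia.
Qed.

End Extension.

End Generators.

(** * Tensor calculus and the ring of power series *)

Section TensorLemmas.
Context (R : comNzRingType) (M N : lmodType R).
Implicit Types (x : M) (y : N).

Lemma tensDl x x' y : (x + x') ⊗ y = x ⊗ y + x' ⊗ y.
Proof. by have /= := (tens_bilinear M N).1 y 1 x x'; rewrite !scale1r. Qed.
Lemma tensDr x y y' : x ⊗ (y + y') = x ⊗ y + x ⊗ y'.
Proof. by have /= := (tens_bilinear M N).2 x 1 y y'; rewrite !scale1r. Qed.
Lemma tens0l y : (0 : M) ⊗ y = 0.
Proof. by apply: (addrI (0 ⊗ y)); rewrite -tensDl !addr0. Qed.
Lemma tens0r x : x ⊗ (0 : N) = 0.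
Proof. by apply: (addrI (x ⊗ 0)); rewrite -tensDr !addr0. Qed.
Lemma tensZl (a : R) x y : (a *: x) ⊗ y = a *: (x ⊗ y).
Proof.
by have /= := (tens_bilinear M N).1 y a x 0; rewrite tens0l !addr0.
Qed.
Lemma tensZr (a : R) x y : x ⊗ (a *: y) = a *: (x ⊗ y).
Proof.
by have /= := (tens_bilinear M N).2 x a y 0; rewrite tens0r !addr0.
Qed.
Lemma tens_suml (I : Type) (r : seq I) (P : pred I) (F : I -> M) y :
  (\sum_(i <- r | P i) F i) ⊗ y = \sum_(i <- r | P i) F i ⊗ y.
Proof.
by elim/big_rec2: _ => [|i z x _ <-]; rewrite ?tens0l // tensDl.
Qed.
Lemma tens_sumr (I : Type) (r : seq I) (P : pred I) (F : I -> N) x :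
  x ⊗ (\sum_(i <- r | P i) F i) = \sum_(i <- r | P i) x ⊗ F i.
Proof.
by elim/big_rec2: _ => [|i z y _ <-]; rewrite ?tens0r // tensDr.
Qed.

End TensorLemmas.

Definition ser (T : Type) : Type := nat -> T.

Section SeriesRing.
Context (T : pzRingType).
Implicit Types (f g h : ser T).

HB.instance Definition _ := gen_eqMixin (ser T).
HB.instance Definition _ := gen_choiceMixin (ser T).

Definition sadd f g : ser T := fun n => f n + g n.
Definition sopp f : ser T := fun n => - f n.
Definition smul f g : ser T := fun n => \sum_(j < n.+1) f j * g (n - j)%N.
Definition sone : ser T := fun n => (n == 0%N)%:R.

Lemma saddA : associative sadd.
Proof. by move=> f g h; apply/funext => n; rewrite /sadd addrA. Qed.
Lemma saddC : commutative sadd.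
Proof. by move=> f g; apply/funext => n; rewrite /sadd addrC. Qed.
Lemma sadd0 : left_id ((fun=> 0) : ser T) sadd.
Proof. by move=> f; apply/funext => n; rewrite /sadd add0r. Qed.
Lemma saddN : left_inverse ((fun=> 0) : ser T) sopp sadd.
Proof. by move=> f; apply/funext => n; rewrite /sadd addNr. Qed.

HB.instance Definition _ := GRing.isZmodule.Build (ser T)
  saddA saddC sadd0 saddN.

Lemma smulA : associative smul.
Proof.
move=> f g h; apply/funext => n; rewrite /smul.
under eq_bigr => j _ do rewrite mulr_sumr.
under [RHS]eq_bigr => j _ do rewrite mulr_suml.
rewrite (sum_triangle n (fun a b c => f a * g b * h c)).
by apply: eq_bigr => j _; apply: eq_bigr => l _; rewrite mulrA.
Qed.

Lemma smul1l : left_id sone smul.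
Proof.
move=> f; apply/funext => n; rewrite /smul big_ord_recl subn0 mul1r.
by rewrite big1 ?addr0 // => j _; rewrite mul0r.
Qed.

Lemma smul1r : right_id sone smul.
Proof.
move=> f; apply/funext => n; rewrite /smul big_ord_recr /= subnn mulr1.
rewrite big1 ?add0r // => j _; rewrite /sone gtn_eqF ?mulr0 // subn_gt0.
exact: ltn_ord.
Qed.

Lemma smulDl : left_distributive smul +%R.
Proof.
move=> f g h; apply/funext => n; rewrite /smul /GRing.add /= /sadd -big_split.
by apply: eq_bigr => j _; rewrite mulrDl.
Qed.

Lemma smulDr : right_distributive smul +%R.
Proof.
move=> f g h; apply/funext => n; rewrite /smul /GRing.add /= /sadd -big_split.
by apply: eq_bigr => j _; rewrite mulrDr.
Qed.

HB.instance Definition _ := GRing.Zmodule_isPzRing.Build (ser T)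
  smulA smul1l smul1r smulDl smulDr.

Lemma smulE f g n : (f * g) n = \sum_(j < n.+1) f j * g (n - j)%N.
Proof. by []. Qed.
Lemma soneE n : (1 : ser T) n = (n == 0%N)%:R. Proof. by []. Qed.
Lemma smul0E f g : (f * g) 0%N = f 0%N * g 0%N.
Proof. by rewrite smulE big_ord1. Qed.

(** Each coefficient is determined by all the preceding ones; [G n] is therefore the list of the
    first [n.+1] coefficients. *)
Lemma ser_linv f : f 0%N = 1 -> exists g, g 0%N = 1 /\ g * f = 1.
Proof.
move=> f0; pose fix G n : seq T := if n is n'.+1 then
  let s := G n' in rcons s (- \sum_(j < n'.+1) s`_j * f (n'.+1 - j)%N)
  else [:: 1].
have sG n : size (G n) = n.+1 by elim: n => //= n IH; rewrite size_rcons IH.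
have GS n j : (j <= n)%N -> (G n.+1)`_j = (G n)`_j.
  by move=> jn; rewrite /= nth_rcons sG ltnS jn.
have GE n j : (j <= n)%N -> (G n)`_j = (G j)`_j.
  elim: n => [|n IH]; first by rewrite leqn0 => /eqP ->.
  rewrite leq_eqVlt => /orP[/eqP -> //|]; rewrite ltnS => jn.
  by rewrite GS ?IH.
exists (fun n => (G n)`_n); split=> //; apply/funext => -[|n].
  by rewrite smul0E /= f0 mulr1.
rewrite smulE big_ord_recr /= subnn f0 mulr1 nth_rcons sG ltnn eqxx.
rewrite (eq_bigr (fun j : 'I_n.+1 => (G n)`_j * f (n.+1 - j)%N)) ?subrr //.
by move=> j _; rewrite (GE n) // -ltnS.
Qed.

Lemma ser_inv f : f 0%N = 1 -> exists g, [/\ g 0%N = 1, g * f = 1 & f * g = 1].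
Proof.
move=> /ser_linv[g [g0 gf]]; have [h [_ hg]] := ser_linv g0.
exists g; split=> //; suff -> : f = h by [].
by rewrite -[f]mul1r -hg -mulrA gf mulr1.
Qed.

End SeriesRing.

(** * Group-like series and curves *)

Section GroupLike.
Context (R : comNzRingType) (U : bialgType R).
Implicit Types (g h : ser U).

Definition scomul g : ser (U ⊗ U) := fun n => comul (g n).
Definition sinl g : ser (U ⊗ U) := fun n => g n ⊗ (1 : U).
Definition sinr g : ser (U ⊗ U) := fun n => (1 : U) ⊗ g n.

Lemma scomulM g h : scomul (g * h) = scomul g * scomul h.
Proof.
apply/funext => n; rewrite /scomul smulE rmorph_sum smulE.
by apply: eq_bigr => j _; rewrite rmorphM.
Qed.
Lemma sinlM g h : sinl (g * h) = sinl g * sinl h.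
Proof.
apply/funext => n; rewrite /sinl smulE tens_suml smulE.
by apply: eq_bigr => j _; rewrite tensM mulr1.
Qed.
Lemma sinrM g h : sinr (g * h) = sinr g * sinr h.
Proof.
apply/funext => n; rewrite /sinr smulE tens_sumr smulE.
by apply: eq_bigr => j _; rewrite tensM mulr1.
Qed.
Lemma scomul1 : scomul 1 = 1.
Proof.
apply/funext => -[|n]; rewrite /scomul soneE; first exact: rmorph1.
exact: rmorph0.
Qed.
Lemma sinl1 : sinl 1 = 1.
Proof.
by apply/funext => -[|n]; rewrite /sinl soneE //= tens0l.
Qed.
Lemma sinr1 : sinr 1 = 1.
Proof.
by apply/funext => -[|n]; rewrite /sinr soneE //= tens0r.
Qed.
Lemma sinC g h : sinl g * sinr h = sinr h * sinl g.
Proof.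
apply/funext => n; rewrite !smulE (reindex_inj rev_ord_inj) /=.
apply: eq_bigr => j _; rewrite !tensM !mulr1 !mul1r subSS subKn //.
by rewrite -ltnS.
Qed.

(** Group-likeness becomes one equation between series over [U ⊗ U]. Since [scomul], [sinl] and
    [sinr] are multiplicative and the last two have commuting images, stability under products and
    inverses is then formal. *)
Lemma group_likeE g : group_like g <-> scomul g = sinl g * sinr g.
Proof.
have E n : (sinl g * sinr g) n = \sum_(m < n.+1) g m ⊗ g (n - m)%N.
  by rewrite smulE; apply: eq_bigr => m _; rewrite tensM mulr1 mul1r.
split=> [H|H n]; first by apply/funext => n; rewrite E -H.
by rewrite -E -H.
Qed.

Lemma group_like_mul g h : group_like g -> group_like h -> group_like (g * h).
Proof.
move=> /group_likeE gg /group_likeE hh; apply/group_likeE.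
rewrite scomulM gg hh sinlM sinrM -!mulrA; congr (_ * _).
by rewrite !mulrA -sinC.
Qed.

Lemma group_like1 : group_like (1 : ser U).
Proof. by apply/group_likeE; rewrite scomul1 sinl1 sinr1 mulr1. Qed.

Lemma group_like_inv g h : group_like g -> h * g = 1 -> g * h = 1 ->
  group_like h.
Proof.
move=> /group_likeE gg hg gh; apply/group_likeE.
have H : sinl h * sinr h * scomul g = 1.
  rewrite gg sinC -!mulrA [sinl h * _]mulrA -sinlM hg sinl1 mul1r -sinrM hg.
  exact: sinr1.
by rewrite -[LHS]mul1r -H -mulrA -scomulM gh scomul1 mulr1.
Qed.

Definition curve g := group_like g /\ g 0%N = 1.

Lemma curve1 : curve 1.
Proof. by split; [exact: group_like1 | rewrite soneE]. Qed.

Lemma curve_mul g h : curve g -> curve h -> curve (g * h).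
Proof.
move=> [gg g0] [hh h0]; split; first exact: group_like_mul.
by rewrite smul0E g0 h0 mulr1.
Qed.

Lemma curve_inv g : curve g -> exists h, curve h /\ h * g = 1.
Proof.
move=> [gg g0]; have [h [h0 hg gh]] := ser_inv g0.
by exists h; split=> //; split=> //; exact: group_like_inv gg hg gh.
Qed.

Lemma coef_exp_lt (phi : {poly R}) m n :
  phi`_0 = 0 -> (n < m)%N -> (phi ^+ m)`_n = 0.
Proof.
move=> phi0; elim: m n => [//|m IH] n nm;
  rewrite exprS coefM big1 // => -[j jn] _.
case: j jn => [|j] jn /=; first by rewrite phi0 mul0r.
by rewrite IH ?mulr0 //; lia.
Qed.

(** The substitution g(phi(x)), meant for phi(0) = 0: powers of phi beyond the n-th then do not
    reach degree [n], whence the finite sum. *)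
Definition scomp g (phi : {poly R}) : ser U :=
  fun n => \sum_(m < n.+1) (phi ^+ m)`_n *: g m.

Lemma scompE g (phi : {poly R}) n l : phi`_0 = 0 -> (n <= l)%N ->
  scomp g phi n = \sum_(m < l.+1) (phi ^+ m)`_n *: g m.
Proof.
move=> phi0 nl; rewrite /scomp (big_ord_widen l.+1
  (fun m => (phi ^+ m)`_n *: g m)) // big_mkcond /=.
apply: eq_bigr => m _; case: ltnP => // nm.
by rewrite coef_exp_lt ?scale0r.
Qed.

(** Scalars pass through tensors, so both sides are the sum of [x^n] phi^(i+j) times [g i ⊗ g j];
    the terms with i + j > n are zero because phi(0) = 0. *)
Lemma curve_comp g (phi : {poly R}) : phi`_0 = 0 -> curve g ->
  curve (scomp g phi).
Proof.
move=> phi0 [gg g0]; split; last first.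
  by rewrite /scomp big_ord1 expr0 coef1 eqxx scale1r.
move=> n; rewrite {1}/scomp rmorph_sum /=.
under eq_bigr => m _ do rewrite linearZ /= gg.
under [RHS]eq_bigr => l _.
  rewrite (@scompE g phi l n phi0 (ltn_ord l)).
  rewrite (@scompE g phi (n - l) n phi0 (leq_subr l n)) tens_suml.
  under eq_bigr => i _.
    rewrite tens_sumr; under eq_bigr => j _ do rewrite tensZl tensZr scalerA.
    over.
  over.
rewrite exchange_big /=; under [RHS]eq_bigr => i _ do rewrite exchange_big /=.
transitivity (\sum_(i < n.+1) \sum_(j < n.+1)
    (phi ^+ (i + j))`_n *: (g i ⊗ g j)); last first.
  apply: eq_bigr => i _; apply: eq_bigr => j _.
  by rewrite exprD coefM scaler_suml.
pose F i j (k : nat) := (phi ^+ (i + j))`_n *: (g i ⊗ g j).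
transitivity (\sum_(m < n.+1) \sum_(i < m.+1) F i (m - i)%N (n - m)%N).
  apply: eq_bigr => m _; rewrite scaler_sumr; apply: eq_bigr => i _.
  by rewrite /F subnKC // -ltnS.
rewrite sum_triangle; apply: eq_bigr => i _.
rewrite (big_ord_widen n.+1 (fun j => F i j (n - i - j)%N)) ?ltnS ?leq_subr //.
rewrite big_mkcond; apply: eq_bigr => j _ /=; case: ltnP => // ij.
by rewrite coef_exp_lt ?scale0r //; move: ij; have := ltn_ord i; lia.
Qed.

End GroupLike.

(** * The first nonzero coefficient of a curve is the first coefficient of a curve *)

Section Leading.
Context (R : comNzRingType) (U : bialgType R) (n : nat) (g : ser U).
Hypothesis n0 : (0 < n)%N.
Hypothesis gc : curve g.
Hypothesis glow : forall i, (0 < i < n)%N -> g i = 0.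

Definition word_val (w : seq nat) : U := \prod_(i <- w) g i.

Lemma word_val_wpos w : word_val w = word_val (wpos w).
Proof.
rewrite /word_val /wpos big_filter; elim: w => [|[|i] w IH];
  rewrite ?big_nil //.
  by rewrite !big_cons /= gc.2 mul1r IH.
by rewrite !big_cons /= IH.
Qed.

Lemma word_val_bad w : ~~ wgood n w -> word_val w = 0.
Proof.
elim: w => //= i w IH; rewrite negb_and negb_or /word_val big_cons.
case/orP => [/andP[i0]|/IH]; last by rewrite /word_val => ->; rewrite mulr0.
by rewrite -ltnNge => iltn; rewrite glow ?mul0r // lt0n i0.
Qed.

Lemma comul_word_val w :
  comul (word_val w) = \sum_(s <- wsplit w) word_val s.1 ⊗ word_val s.2.
Proof.
elim: w => [|i w IH]; first by rewrite /word_val big_seq1 !big_nil rmorph1.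
have -> : wsplit (i :: w) = [seq (j :: s.1, (i - j)%N :: s.2) |
  j <- iota 0 i.+1, s <- wsplit w] by [].
rewrite (big_allpairs_dep (h := fun j s => (j :: s.1, (i - j)%N :: s.2))).
rewrite /word_val big_cons rmorphM /= -/(word_val w) IH gc.1 mulr_suml.
have -> : (0%N :: iota 1 i) = index_iota 0 i.+1 by rewrite /index_iota subn0.
rewrite big_mkord.
apply: eq_bigr => j _; rewrite mulr_sumr; apply: eq_bigr => s _ /=.
by rewrite tensM !big_cons.
Qed.

Lemma word_val_expand a w : sumn w = a ->
  word_val w = \sum_(u <- words n a) wdelta R u w *: word_val u.
Proof.
move=> wa; have [gw|bw] := boolP (wgood n w); last first.
  rewrite word_val_bad // big_seq big1 // => u /wordsP[_ ug _].
  rewrite /wdelta; case: eqP => [E|_]; last by rewrite scale0r.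
  by rewrite -wgood_wpos E ug in bw.
rewrite (bigD1_seq (wpos w)) ?words_uniq //=; last first.
  by rewrite -wa; exact: mem_words_good.
rewrite /wdelta eqxx scale1r -word_val_wpos big1 ?addr0 // => u.
by rewrite eq_sym => /negbTE ->; rewrite scale0r.
Qed.

(** The duality behind the ring of words: in the coproduct of the word [w], the coefficient of
    [u ⊗ v] is the value at [w] of the product of the functions dual to [u] and [v]. *)
Lemma comul_word_val_expand e w : sumn w = e ->
  comul (word_val w) = \sum_(a < e.+1) \sum_(u <- words n a)
    \sum_(v <- words n (e - a)%N)
      (wdelta R u * wdelta R v) w *: (word_val u ⊗ word_val v).
Proof.
move=> we; rewrite comul_word_val.
under [RHS]eq_bigr => a _ do (under eq_bigr => u _ do (under eq_bigr => v _ do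
  rewrite wmulE scaler_suml); under eq_bigr => u _ do rewrite exchange_big /=).
under [RHS]eq_bigr => a _ do rewrite exchange_big /=.
rewrite [RHS]exchange_big /= big_seq [RHS]big_seq; apply: eq_bigr => -[x y].
move=> /mem_wsplit /= se; rewrite we in se.
have xe : (sumn x < e.+1)%N by lia.
rewrite (bigD1 (Ordinal xe)) //= [X in _ + X]big1 ?addr0; last first.
  move=> a ax; rewrite big_seq big1 // => u /wordsP[_ _ ua].
  rewrite big1 // => v _; rewrite /wdelta; case: (wpos x =P u) => [E|_].
    case/eqP: ax; apply: val_inj; by rewrite /= -ua -E sumn_wpos.
  by rewrite mul0r scale0r.
rewrite (@word_val_expand (sumn x) x) // (@word_val_expand (e - sumn x)%N y);
  last lia.
rewrite tens_suml; apply: eq_bigr => u _; rewrite tens_sumr.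
by apply: eq_bigr => v _; rewrite tensZl tensZr scalerA.
Qed.

(** The universal curve is specialised by sending the letter i to [g i]. By duality,
    multiplicativity of [beta] says that the series [H] is group-like; it lives in degrees divisible
    by [n], so keeping only these degrees gives a curve again. *)
Lemma leading_coef_lift : exists h, curve h /\ h 1%N = g n.
Proof.
have [beta bP] := Generators.universal_curve n0.
pose H e : U := \sum_(u <- words n e) (beta u)%:~R *: word_val u.
exists (fun m => H (n * m)%N); split; last first.
  rewrite muln1 /H Generators.words_n // big_seq1; have [_ -> _ _] := bP n.
  by rewrite scale1r /word_val big_seq1.
have H0 : H 0%N = 1.
  rewrite /H Generators.words0 big_seq1; have [-> _ _ _] := bP n.
  by rewrite scale1r /word_val big_nil.
split; last by rewrite muln0.
move=> m; set e := (n * m)%N; rewrite {1}/H rmorph_sum /= big_seq.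
have [b0 bn bs bM] := bP e.
have E w : w \in words n e -> comul ((beta w)%:~R *: word_val w) =
    \sum_(a < e.+1) \sum_(u <- words n a) \sum_(v <- words n (e - a)%N)
      (beta w * (wdelta int u * wdelta int v) w)%:~R *:
        (word_val u ⊗ word_val v).
  move=> /wordsP[_ _ we]; rewrite linearZ /= (comul_word_val_expand we).
  rewrite scaler_sumr; apply: eq_bigr => a _; rewrite scaler_sumr.
  apply: eq_bigr => u _; rewrite scaler_sumr; apply: eq_bigr => v _.
  rewrite scalerA; congr (_ *: _); rewrite rmorphM; congr (_ * _).
  rewrite !wmulE rmorph_sum; apply: eq_bigr => s _; rewrite rmorphM.
  by rewrite /wdelta; congr (_ * _); case: eqP.
rewrite (eq_bigr _ E) -big_seq exchange_big /=.
transitivity (\sum_(a < e.+1) H a ⊗ H (e - a)%N).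
  apply: eq_bigr => a _; rewrite exchange_big /= tens_suml big_seq [RHS]big_seq.
  apply: eq_bigr => u uW; rewrite exchange_big /= tens_sumr big_seq
    [RHS]big_seq.
  apply: eq_bigr => v vW; rewrite tensZl tensZr scalerA -scaler_suml.
  congr (_ *: _); rewrite -rmorph_sum /= -rmorphM /=; congr (_%:~R).
  have ae : (a + (e - a))%N = e by rewrite subnKC // -ltnS.
  have pd b x : x \in words n b -> pairing n beta b (wdelta int x) = beta x.
    move=> xW; rewrite /pairing (bigD1_seq x) ?words_uniq //= /wdelta.
    have [-> _ _] := wordsP xW; rewrite eqxx mulr1 big_seq_cond big1 ?addr0 //.
    by move=> y /andP[/wordsP[-> _ _] /negbTE ->]; rewrite mulr0.
  rewrite -(pd _ _ uW) -(pd _ _ vW) -bM ?ae //; exact: hom_delta.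
have Hz a : (a <= e)%N -> ~~ (n %| a)%N -> H a = 0.
  move=> ae na; rewrite /H big_seq big1 // => u /(bs a ae na) ->.
  by rewrite scale0r.
rewrite (bigID (fun a : 'I_e.+1 => n %| a)%N) /= [X in _ + X]big1 ?addr0;
  last first.
  by move=> a na; rewrite Hz ?tens0l // -ltnS.
have inb (i : 'I_m.+1) : (n * i < e.+1)%N.
  by rewrite ltnS leq_pmul2l // -ltnS.
rewrite (reindex_onto (fun i : 'I_m.+1 => Ordinal (inb i))
  (fun a : 'I_e.+1 => inord (a %/ n))) /=; last first.
  move=> a /divnK aE; apply: val_inj; rewrite /= inordK ?[(n * _)%N]mulnC //.
  by rewrite ltnS -(leq_pmul2r n0) aE mulnC -ltnS.
apply: eq_big => [i|i _]; last by rewrite /e -mulnBr.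
by rewrite dvdn_mulr //= mulKn // inord_val eqxx.
Qed.

End Leading.

From mathcomp Require Import classical_sets fsbigop.
From mathcomp Require Import wochoice finmap multiset monalg.

Local Open Scope classical_set_scope.
Local Open Scope ring_scope.

(** * Submodules of free modules over a principal ideal domain *)

(** A well order is given by unique minima of nonempty sets. Minima of sets of at most three
    elements yield all four properties, and antisymmetry is the uniqueness. *)
Lemma well_order_total (T : eqType) (le : rel T) : well_order le ->
  [/\ reflexive le, antisymmetric le, transitive le & total le].
Proof.
move=> wo; have min (s : seq T) x : x \in s ->
  exists z : T, z \in s /\ {in s, forall y, le z y}.
  move=> xs; have [|z [[zs zmin] _]] := wo (mem s); first by exists x.
  by exists z.
have tot : total le.
  move=> x y; have [|z [zs zmin]] := min [:: x; y] x; first exact: mem_head.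
  move: zs; rewrite !inE => /orP[] /eqP zE; rewrite zE in zmin.
    by rewrite zmin // !inE eqxx orbT.
  by rewrite [le y x]zmin ?orbT // !inE eqxx.
have refl : reflexive le by move=> x; have := tot x x; rewrite orbb.
have anti : antisymmetric le.
  move=> x y /andP[xy yx].
  have [|z [_ zu]] := wo (mem [:: x; y]); first by exists x; rewrite inE eqxx.
  have Ex : z = x.
    apply: zu; split; first by rewrite inE eqxx.
    by move=> t; rewrite !inE => /orP[] /eqP ->.
  have Ey : z = y.
    apply: zu; split; first by rewrite !inE eqxx orbT.
    by move=> t; rewrite !inE => /orP[] /eqP ->.
  by rewrite -Ex -Ey.
split=> // y x z xy yz.
have [|t [ts tmin]] := min [:: x; y; z] x; first exact: mem_head.
have tx : le t x by apply: tmin; rewrite !inE eqxx.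
have ty : le t y by apply: tmin; rewrite !inE eqxx orbT.
have tz : le t z by apply: tmin; rewrite !inE eqxx !orbT.
move: ts; rewrite !inE => /or3P[] /eqP E; first by rewrite -E.
  by have -> : x = y by apply: anti; rewrite xy -{1}E tx.
by have <- : y = z by apply: anti; rewrite yz -{1}E ty.
Qed.

Section Lincomb.
Context (R : comNzRingType) (I : choiceType).

Lemma lincomb_linear_comp (M N : lmodType R) (f : {linear M -> N}) (b : I -> M)
    (c : {malg R[I]}) : f (lincomb b c) = lincomb (f \o b) c.
Proof.
by rewrite /lincomb linear_sum; apply: eq_bigr => i _; rewrite linearZ.
Qed.

Lemma mcoeff_lincomb (J : choiceType) (b : J -> {malg R[I]})
  (c : {malg R[J]}) i :
  (lincomb b c)@_i = \sum_(j <- msupp c) c@_j * (b j)@_i.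
Proof.
by rewrite /lincomb raddf_sum; apply: eq_bigr => j _; rewrite /= mcoeffZ.
Qed.

Lemma lincomb_inj_basis (M : lmodType R) (S : set M) (b : I -> M) :
  (forall i, S (b i)) ->
  (forall x, S x -> exists c : {malg R[I]}, x = lincomb b c) ->
  (forall c : {malg R[I]}, lincomb b c = 0 -> c = 0) -> module_basis S b.
Proof.
move=> bS span indep; split=> // x /span[c xE]; exists c; split=> // c' xE'.
by apply/subr0_eq/indep; rewrite raddfB /= -xE -xE' subrr.
Qed.

End Lincomb.

Section FreeSubmodule.
Context (R : idomainType).
Hypothesis pid : principal_ideal_domain R.
Context (I : choiceType) (le : rel I).
Hypothesis le_wo : well_order le.
Context (L : set {malg R[I]}).
Hypothesis L0 : L 0.
Hypothesis LP : forall a c c', L c -> L c' -> L (a *: c + c').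

Let le_refl : reflexive le. Proof. by have [] := well_order_total le_wo. Qed.
Let le_anti : antisymmetric le.
Proof. by have [] := well_order_total le_wo. Qed.
Let le_trans : transitive le. Proof. by have [] := well_order_total le_wo. Qed.
Let le_total : total le. Proof. by have [] := well_order_total le_wo. Qed.

Lemma seq_max (s : seq I) : s != [::] ->
  exists2 i, i \in s & {in s, forall j, le j i}.
Proof.
elim: s => // i [|j s] IH _.
  by exists i; rewrite ?mem_head // => j; rewrite inE => /eqP ->.
have [//|m ms mmax] := IH; case/orP: (le_total i m) => im.
  exists m; first by rewrite inE ms orbT.
  by move=> l; rewrite inE => /orP[/eqP ->|/mmax].
exists i; first exact: mem_head.
move=> l; rewrite inE => /orP[/eqP ->//|/mmax lm]; exact: le_trans lm im.
Qed.

Definition below i (c : {malg R[I]}) := {in msupp c, forall j, le j i}.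

Definition lead_ideal i : {pred R^o} :=
  fun a => `[< exists c, [/\ L c, below i c & c@_i = a] >].

Lemma lead_ideal_closed i : GRing.submod_closed (lead_ideal i).
Proof.
split.
  apply/asboolP; exists 0; split; rewrite ?mcoeff0 //.
  by move=> j; rewrite msupp0 inE.
move=> a x y /asboolP[c [Lc bc <-]] /asboolP[c' [Lc' bc' <-]].
apply/asboolP; exists (a *: c + c'); split; first exact: LP.
  move=> j /(fsubsetP (msuppD_le _ _)); rewrite inE => /orP[|/bc'//].
  by move=> /(fsubsetP (msuppZ_le _ _)) /bc.
by rewrite mcoeffD mcoeffZ.
Qed.

(** For each index [i], the coefficients at [i] of the elements of [L] supported up to [i] form an
    ideal, generated by some [d i] and attained by some [l i]. The [l i] with [d i] nonzero are a
    basis: a minimal index at which spanning fails is refuted by cancelling the leading term, and in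
    a relation the largest index has no partner. *)
Lemma pid_submodule_free_malg :
  exists (J : choiceType) (b : J -> {malg R[I]}), module_basis L b.
Proof.
have /choice[d dP] : forall i, exists d : R,
    forall x : R, (x \in lead_ideal i) <-> exists c : R, x = c * d.
  by move=> i; exact: pid (lead_ideal_closed i).
have /choice[l lP] : forall i, exists c, [/\ L c, below i c & c@_i = d i].
  move=> i; have /asboolP : (d i : R) \in lead_ideal i; last by [].
  by apply/dP; exists 1; rewrite mul1r.
pose J : choiceType := {i : I | d i != 0}.
exists J, (fun j : J => l (val j)); apply: lincomb_inj_basis.
- by move=> j; have [] := lP (val j).
- have span i : forall c, L c -> below i c ->
      exists c' : {malg R[J]}, c = lincomb (fun j : J => l (val j)) c'.
    apply: contrapT => Ni; pose bad j := `[< ~ forall c, L c -> below j c ->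
      exists c' : {malg R[J]}, c = lincomb (fun j : J => l (val j)) c' >].
    have [|m [[mbad mmin] _]] := le_wo (A := bad); first by exists i;
      apply/asboolP.
    case/asboolP: mbad => c Lc bc.
    have [k ck] : exists k : R, c@_m = k * d m.
      by apply/dP/asboolP; exists c.
    have [c1 [Ly by_ y0]] : exists c1 : {malg R[J]},
        let y := c - lincomb (fun j : J => l (val j)) c1 in
        [/\ L y, below m y & y@_m = 0].
      have [dm|dm] := eqVneq (d m) 0.
        by exists 0; rewrite /= linear0 subr0; split=> //; rewrite ck dm mulr0.
      exists (k *: << (exist _ m dm : J) >>); rewrite linearZ /= lincombU /=.
      have [Ll bl lm] := lP m; split.
      - by rewrite addrC -scaleNr; exact: LP.
      - move=> j /(fsubsetP (msuppB_le _ _)); rewrite inE => /orP[/bc//|].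
        by move=> /(fsubsetP (msuppZ_le _ _)) /bl.
      - by rewrite mcoeffB mcoeffZ lm ck subrr.
    set y := c - _ in Ly by_ y0.
    suff [c2 yE] : exists c2 : {malg R[J]},
      y = lincomb (fun j : J => l (val j)) c2.
      by exists (c1 + c2); rewrite raddfD /= -yE /y addrC subrK.
    have [s0|s0] := eqVneq (msupp y : seq I) [::].
      exists 0; rewrite linear0; apply/malgP => j; rewrite mcoeff0.
      by apply: mcoeff_outdom; rewrite -[_ \in _]/(j \in (msupp y : seq I)) s0.
    have [j jy jmax] := seq_max s0.
    have jm : j != m.
      apply/eqP => jm; move: jy.
      by rewrite -[_ \in _]/(j \in msupp y) -mcoeff_neq0 jm y0 eqxx.
    have : ~~ bad j.
      apply/negP => /mmin mj; case/eqP: jm; apply: le_anti.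
      by rewrite mj by_.
    by move=> /asboolPn /contrapT; apply.
  move=> c Lc; have [s0|s0] := eqVneq (msupp c : seq I) [::].
    exists 0; rewrite linear0; apply/malgP => j; rewrite mcoeff0.
    by apply: mcoeff_outdom; rewrite -[_ \in _]/(j \in (msupp c : seq I)) s0.
  by have [j _ jmax] := seq_max s0; exact: span Lc jmax.
- move=> c c0; apply/eqP/negPn/negP => cn0.
  pose s := [seq val j | j <- (msupp c : seq J)].
  have s0 : s != [::].
    apply: contra cn0 => /eqP s0; apply/eqP/malgP => j; rewrite mcoeff0.
    apply: mcoeff_outdom; apply/negP => jc.
    have : val j \in s by apply: map_f.
    by rewrite s0.
  have [_ /mapP[j jc ->] jmax] := seq_max s0.
  have := congr1 (mcoeff (val j)) c0; rewrite mcoeff0 mcoeff_lincomb.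
  rewrite (bigD1_seq j) ?fset_uniq //= big_seq_cond big1 ?addr0.
    have [_ _ ->] := lP (val j); move=> /eqP; rewrite mulf_eq0.
    rewrite (negbTE (valP j)) orbF => /eqP cj.
    by move: jc; rewrite -[_ \in _]/(j \in msupp c) -mcoeff_neq0 cj eqxx.
  move=> i /andP[ic ij]; have [_ bi _] := lP (val i).
  have nij : val j \notin msupp (l (val i)).
    apply/negP => /bi lij; case/eqP: ij; apply: val_inj; apply: le_anti.
    by rewrite lij andbT; apply: jmax; exact: map_f.
  by rewrite (mcoeff_outdom nij) mulr0.
Qed.

End FreeSubmodule.

Lemma pid_submodule_free (R : idomainType) (M : lmodType R) (P L : set M) :
  principal_ideal_domain R -> free_submodule P -> (forall x, L x -> P x) ->
  L 0 -> (forall a x y, L x -> L y -> L (a *: x + y)) -> free_submodule L.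
Proof.
move=> pid [I [e [eP eb]]] LP L0 Lc.
have [le le_wo] := well_ordering_principle I.
pose L' : set {malg R[I]} := fun c => L (lincomb e c).
have L'0 : L' 0 by rewrite /L' linear0.
have L'P a c c' : L' c -> L' c' -> L' (a *: c + c').
  by rewrite /L' linearP; exact: Lc.
have P0 : P 0 by exact: LP.
have [J [b [bL bb]]] := pid_submodule_free_malg pid le_wo L'0 L'P.
exists J, (lincomb e \o b); apply: lincomb_inj_basis.
- by move=> j; exact: bL.
- move=> x Lx; have [c [xE _]] := eb x (LP x Lx).
  have [|c' [cE _]] := bb c; first by rewrite /L' -xE.
  by exists c'; rewrite -lincomb_linear_comp /= -cE.
- move=> c; rewrite -lincomb_linear_comp /= => c0.
  have [c0' [_ c0u]] := eb 0 P0.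
  have bc0 : lincomb b c = 0.
    by rewrite -(c0u (lincomb b c)) ?(c0u 0) ?linear0.
  have [u [_ uu]] := bb 0 L'0.
  by rewrite -(uu c) ?(uu 0) ?linear0.
Qed.

(** * Ordered products of coefficients and their coproduct *)

Section SubMultisets.
Context (I : choiceType).
Implicit Types (a b : multiset I) (s : seq I).

(** Lists the multisets below [a] with support in [s], one letter at a time, so that the sums over
    sub-multisets in a structural basis can be expanded by induction along [s]. *)
Fixpoint msubs s a : seq (multiset I) :=
  if s is i :: s' then
    [seq (msetn j i `+` b)%mset | j <- iota 0 (a i).+1, b <- msubs s' a]
  else [:: mset0].

Lemma msubsE s a : msubs s a = if s is i :: s' then
  [seq (msetn j i `+` b)%mset | j <- iota 0 (a i).+1, b <- msubs s' a]
  else [:: mset0].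
Proof. by case: s. Qed.

Lemma msetDE a b i : ((a `+` b)%mset : multiset I) i = (a i + b i)%N.
Proof. by rewrite msetE2. Qed.

Lemma msetBE a b i : ((a `\` b)%mset : multiset I) i = (a i - b i)%N.
Proof. by rewrite msetE2. Qed.

Lemma mem_msubs s a b : uniq s ->
  reflect (forall i, if i \in s then (b i <= a i)%N else b i == 0%N)
          (b \in msubs s a).
Proof.
elim: s b => [b _|i s IH b /andP[si us]].
  rewrite inE; apply: (iffP eqP) => [-> i|H]; first by rewrite mset0E.
  by apply/msetP => i; rewrite mset0E; apply/eqP; exact: H.
rewrite msubsE; apply: (iffP allpairsP) => [[[j c] /= [jP cP ->]] l|H].
  rewrite msetDE msetnE inE; move/(IH _ us)/(_ l): cP.
  case: (l =P i) => [->|_] /=; last by [].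
  rewrite (negbTE si) => /eqP ->; rewrite addn0.
  by move: jP; rewrite -[_ \in _]/(j \in iota 0 (a i).+1) mem_iota.
exists (b i, (b `\` msetn (b i) i)%mset) => /=; split.
- by have := H i; rewrite mem_head -[_ \in _]/(b i \in iota 0 (a i).+1)
  mem_iota.
- apply/(IH _ us) => l; rewrite msetBE msetnE; case: (l =P i) => [->|/eqP li].
    by rewrite (negbTE si) subnn.
  by have := H l; rewrite inE (negbTE li) subn0.
- apply/msetP => l; rewrite msetDE msetBE msetnE.
  by case: (l =P i) => [->|_]; rewrite ?subnn ?addn0 // subn0.
Qed.

Lemma msubs_uniq s a : uniq s -> uniq (msubs s a).
Proof.
elim: s => [//|i s IH] /andP[si us]; rewrite msubsE.
apply: allpairs_uniq; [exact: iota_uniq | exact: IH |].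
move=> [j b] [j' b'] /allpairsPdep[x [y [_ yP [-> ->]]]].
move=> /allpairsPdep[x' [y' [_ yP' [-> ->]]]] /= E.
have /(_ i) := (mem_msubs _ _ us yP); rewrite (negbTE si) => /eqP yi.
have /(_ i) := (mem_msubs _ _ us yP'); rewrite (negbTE si) => /eqP yi'.
have xE : x = x'.
  have := congr1 (fun c : multiset I => c i) E.
  by rewrite /= !msetDE !msetnxx yi yi' !addn0.
congr (_, _) => //; apply/msetP => l.
have := congr1 (fun c : multiset I => c l) E.
by rewrite /= !msetDE xE => /addnI.
Qed.

Lemma sum_msubset (V : nmodType) s a (F : multiset I -> V) :
  uniq s -> {subset finsupp a <= s} ->
  \sum_(b \in [set b : multiset I | (b `<=` a)%mset]) F b =
  \sum_(b <- msubs s a) F b.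
Proof.
move=> us sa; rewrite (fsbig_seq _ _ (msubs_uniq a us)).
apply: eq_fsbigl; apply/seteqP; split=> b /=.
  move=> /msubsetP ba; apply/(mem_msubs _ _ us) => i; case: ifP => // si.
  have : (b i <= a i)%N by exact: ba.
  by rewrite (fsfun_dflt (f := a)) ?leqn0 => [/eqP//|]; apply/negP => /sa;
    rewrite si.
move=> /(mem_msubs _ _ us) H; apply/msubsetP => i.
by have := H i; case: ifP => // _ /eqP ->.
Qed.

End SubMultisets.

Section StructuralProduct.
Context (R : comNzRingType) (U : bialgType R) (I : choiceType) (le : rel I).
Hypothesis le_anti : antisymmetric le.
Hypothesis le_trans : transitive le.
Hypothesis le_total : total le.
Context (h : I -> ser U).
Hypothesis hc : forall i, curve (h i).
Implicit Types (a b : multiset I) (s : seq I).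

(** The order [le] fixes the order of the factors, as [U] need not be commutative. *)
Definition curve_prod a : U := \prod_(i <- sort le (finsupp a)) h i (a i).

(** Indices outside the support contribute [h i 0 = 1], so one sorted list can serve for a multiset
    and all its parts. *)
Lemma curve_prodE s a : uniq s -> sorted le s -> {subset finsupp a <= s} ->
  curve_prod a = \prod_(i <- s) h i (a i).
Proof.
move=> us ss sa.
have -> : \prod_(i <- s) h i (a i) =
    \prod_(i <- s | i \in finsupp a) h i (a i).
  rewrite [RHS]big_mkcond; apply: eq_bigr => i _; case: ifP => // /negbT ia.
  by rewrite fsfun_dflt // (hc i).2.
rewrite -big_filter /curve_prod; congr (\prod_(i <- _) _).
apply: (sorted_eq le_trans le_anti); first exact: sort_sorted.
  exact: sorted_filter.
rewrite perm_sort; apply: uniq_perm; rewrite ?fset_uniq ?filter_uniq // => i.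
by rewrite mem_filter; case: (boolP (i \in finsupp a)) => //= /sa ->.
Qed.

Lemma comul_prod s a : uniq s -> comul (\prod_(i <- s) h i (a i)) =
  \sum_(b <- msubs s a)
    (\prod_(i <- s) h i (b i)) ⊗ (\prod_(i <- s) h i (a i - b i)%N).
Proof.
elim: s => [_|i s IH /andP[si us]]; first by rewrite big_seq1 !big_nil rmorph1.
rewrite msubsE (big_allpairs_dep (h := fun j b => (msetn j i `+` b)%mset)).
rewrite big_cons rmorphM /= IH // (hc i).1 mulr_suml.
have -> : (0%N :: iota 1 (a i)) = index_iota 0 (a i).+1.
  by rewrite /index_iota subn0.
rewrite big_mkord; apply: eq_bigr => j _; rewrite mulr_sumr.
rewrite big_seq [RHS]big_seq; apply: eq_bigr => b /(mem_msubs _ _ us) bP.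
have bi : b i = 0%N by apply/eqP; have := bP i; rewrite (negbTE si).
rewrite tensM !big_cons msetDE msetnxx bi addn0.
have E l : l \in s -> ((msetn j i `+` b)%mset : multiset I) l = b l.
  rewrite msetDE msetnE; case: eqP => // ->; by rewrite (negbTE si).
congr (tens (_ * _) (_ * _)); rewrite big_seq [RHS]big_seq.
  by apply: eq_bigr => l ls; rewrite E.
by apply: eq_bigr => l ls; rewrite E.
Qed.

Lemma comul_curve_prod a : comul (curve_prod a) =
  \sum_(b \in [set b : multiset I | (b `<=` a)%mset])
    curve_prod b ⊗ curve_prod (a `\` b)%mset.
Proof.
pose s := sort le (finsupp a).
have us : uniq s by rewrite sort_uniq fset_uniq.
have ss : sorted le s by exact: sort_sorted.
have sa : {subset finsupp a <= s} by move=> i; rewrite mem_sort.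
rewrite (sum_msubset _ us sa) {1}/curve_prod comul_prod //.
rewrite big_seq [RHS]big_seq; apply: eq_bigr => b /(mem_msubs _ _ us) bP.
rewrite (@curve_prodE s b) // ?(@curve_prodE s (a `\` b)%mset) //.
- by congr tens; apply: eq_bigr => i _; rewrite msetBE.
- move=> i; rewrite mem_finsupp msetBE => H; apply: sa; rewrite mem_finsupp.
  by apply: contraNneq H => ->.
- move=> i; rewrite mem_finsupp; have := bP i.
  by case: (i \in s) => // /eqP ->; rewrite eqxx.
Qed.

Lemma curve_prod0 : curve_prod mset0 = 1.
Proof.
by rewrite (@curve_prodE [::]) ?big_nil // => i; rewrite mem_finsupp mset0E.
Qed.

Lemma curve_prod1 i : curve_prod [mset i]%mset = h i 1%N.
Proof.
rewrite (@curve_prodE [:: i]) ?big_seq1 ?msetnxx // => j.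
by rewrite mem_finsupp msetnE inE; case: (j == i).
Qed.

End StructuralProduct.

(** * The coefficients of curves span *)

Section Submodules.
Context (R : comNzRingType) (U : bialgType R).

Definition submodP (W : U -> Prop) :=
  W 0 /\ forall a x y, W x -> W y -> W (a *: x + y).

Lemma submodP_Z W a x : submodP W -> W x -> W (a *: x).
Proof. by move=> [W0 WP] Wx; rewrite -[_ *: _]addr0; exact: WP. Qed.

Lemma submodP_sum W (I : Type) (r : seq I) (P : pred I) (F : I -> U) :
  submodP W -> (forall i, P i -> W (F i)) -> W (\sum_(i <- r | P i) F i).
Proof.
move=> [W0 WP] H; elim/big_rec: _ => // i x Pi Wx.
by rewrite -[F i]scale1r; apply: WP => //; exact: H.
Qed.

Lemma submodP_mull W (u : U) : submodP W -> submodP (fun x => W (u * x)).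
Proof.
move=> [W0 WP]; split=> [|a x y]; first by rewrite mulr0.
by rewrite mulrDr -scalerAr; exact: WP.
Qed.

Lemma submodP_mulr W (u : U) : submodP W -> submodP (fun x => W (x * u)).
Proof.
move=> [W0 WP]; split=> [|a x y]; first by rewrite mul0r.
by rewrite mulrDl -scalerAl; exact: WP.
Qed.

Lemma scomp_Xn (g : ser U) s n : (0 < s)%N ->
  scomp g 'X^s n = if (s %| n)%N then g (n %/ s)%N else 0.
Proof.
move=> s0; rewrite /scomp.
under eq_bigr => m _ do rewrite -exprM coefXn.
case: ifP => [/dvdnP[q ->]|sn].
  have qs : (q < (q * s).+1)%N by rewrite ltnS leq_pmulr.
  rewrite mulnK // (bigD1 (Ordinal qs)) //= [(s * q)%N]mulnC eqxx scale1r.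
  rewrite big1 ?addr0 // => m mq; case: eqP => [E|]; last by rewrite scale0r.
  case/eqP: mq; apply: val_inj; apply/eqP.
  by rewrite /= -(eqn_pmul2r s0) [(m * s)%N]mulnC -E.
rewrite big1 // => m _; case: eqP => [E|]; last by rewrite scale0r.
by rewrite E dvdn_mulr in sn.
Qed.

(* The product of two coefficients is a single coefficient of g(x^s) h(x^t)
   when s and t are coprime and large. *)
Lemma curve_coef_mul (g h : ser U) i j : curve g -> curve h ->
  exists f k, curve f /\ g i * h j = f k.
Proof.
move=> gc hc; pose t := i.+1; pose s := (i.+1 * j.+1).+1.
(* Here [s] is 1 modulo [t] and exceeds [t * j]. If q s + q' t = s i + t j, the size of [s] gives q
   <= i, and reduction modulo [t] gives [t] dividing i - q, which is less than [t]; so q = i and a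
   single term survives. *)
exists (scomp g 'X^s * scomp h 'X^t), (s * i + t * j)%N; split.
  by apply: curve_mul; apply: curve_comp => //; rewrite coefXn.
have il : (s * i < (s * i + t * j).+1)%N by rewrite ltnS leq_addr.
rewrite smulE (bigD1 (Ordinal il)) //= !scomp_Xn // dvdn_mulr // mulKn //.
rewrite addKn dvdn_mulr // mulKn // big1 ?addr0 // => l ln.
rewrite !scomp_Xn //; case: (boolP (s %| l)%N) => [/dvdnP[q lE]|];
  last by rewrite mul0r.
case: (boolP (t %| _)%N) => [/dvdnP[q' E]|]; last by rewrite mulr0.
case/eqP: ln; apply: val_inj; rewrite /= lE mulnC; congr (_ * _)%N.
have lb := ltn_ord l; rewrite lE in E lb.
have {}E : (q * s + q' * t = s * i + t * j)%N by rewrite -E; lia.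
have qi : (q <= i)%N.
  rewrite leqNgt; apply/negP => iq.
  have : (t * s <= q * s)%N by rewrite leq_mul2r iq orbT.
  by move: E; rewrite /s /t; nia.
have : (t %| i - q)%N.
  rewrite -(@dvdn_addl (t * (j.+1 * (i - q) + j))) ?dvdn_mulr //.
  apply/dvdnP; exists q'; have [z zE] : exists z, i = (z + q)%N.
    by exists (i - q)%N; rewrite subnK.
  by move: E; rewrite /s /t zE addnK; nia.
case: (posnP (i - q)) => [iq _|iq /(dvdn_leq iq)]; last by rewrite /t; lia.
by apply/eqP; rewrite eqn_leq qi /= -subn_eq0 iq.
Qed.

Definition curve_span (x : U) := forall W, submodP W ->
  (forall g i, curve g -> W (g i)) -> W x.

Lemma curve_spanM x y : curve_span x -> curve_span y -> curve_span (x * y).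
Proof.
move=> xs ys W Ws WC; apply: (xs (fun x => W (x * y)) (submodP_mulr y Ws)).
move=> g i gc; apply: (ys (fun y => W (g i * y)) (submodP_mull (g i) Ws)).
by move=> h j hc; have [f [k [fc ->]]] := curve_coef_mul i j gc hc; exact: WC.
Qed.

(** A product of two coefficients of curves is again a coefficient of a curve, so the module they
    span is already a subalgebra. *)
Lemma generates_curve_span (G : set U) : generates G ->
  (forall u, G u -> exists g i, curve g /\ u = g i) -> forall u, curve_span u.
Proof.
move=> Ggen GC u; have := Ggen (fun x => `[< curve_span x >]).
suff H : GRing.subalg_closed (fun x : U => `[< curve_span x >]).
  move=> /(_ H) /(_ _ u) HH; apply/asboolP/HH => x /GC[g [i [gc ->]]].
  by apply/asboolP => W _; apply.
split.
- by apply/asboolP => W _ WC; have := WC _ 0%N (curve1 U); rewrite soneE.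
- move=> a x y /asboolP xs /asboolP ys; apply/asboolP => W Ws WC.
  by apply: Ws.2; [exact: xs | exact: ys].
- by move=> x y /asboolP xs /asboolP ys; apply/asboolP; exact: curve_spanM.
Qed.

End Submodules.

(** * Factoring truncated curves into reparametrised basis curves *)

Section Peel.
Context (R : comNzRingType) (U : bialgType R) (I : choiceType) (le : rel I).
Hypothesis le_anti : antisymmetric le.
Hypothesis le_trans : transitive le.
Hypothesis le_total : total le.
Context (h : I -> ser U).
Hypothesis hc : forall i, curve (h i).
Implicit Types (s : seq I) (phi : I -> {poly R}).

Definition comp_prod s phi : ser U := \prod_(i <- s) scomp (h i) (phi i).

Lemma curve_comp_prod s phi :
  (forall i, (phi i)`_0 = 0) -> curve (comp_prod s phi).
Proof.
move=> phi0; rewrite /comp_prod; elim/big_rec: _ => [|i x _ xc].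
  exact: curve1.
by apply: curve_mul => //; exact: curve_comp.
Qed.

(** An arbitrary submodule [W] is what lets the induction go through: the factor [h i m] on the left
    is absorbed by replacing [W] with its preimage under multiplication by it. *)
Lemma comp_prod_submod s phi (W : U -> Prop) l : uniq s -> submodP W ->
  (forall a : I -> nat, W (\prod_(i <- s) h i (a i))) -> W (comp_prod s phi l).
Proof.
elim: s W l => [|i s IH] W l.
  move=> _ Ws /(_ (fun=> 0%N)); rewrite /comp_prod !big_nil soneE => W1.
  by case: l => [|l] //; exact: Ws.1.
move=> /andP[si us] Ws WP; rewrite /comp_prod big_cons smulE.
apply: submodP_sum => // j _; rewrite /scomp mulr_suml.
apply: submodP_sum => // m _; rewrite -scalerAl; apply: submodP_Z => //.
apply: (IH (fun y => W (h i m * y))) => //; first exact: submodP_mull.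
move=> b; have := WP (fun l => if l == i then (m : nat) else b l).
rewrite big_cons eqxx; congr (W (_ * _)); rewrite big_seq [RHS]big_seq.
by apply: eq_bigr => x xs; case: eqP => // xi; rewrite xi (negbTE si) in xs.
Qed.

(** To first order the change is m c phi^(m-1) X^k; as phi(0) = 0, its coefficient at X^k is nonzero
    only for m = 1. *)
Lemma exp_perturb (phi : {poly R}) c k m : (0 < k)%N -> phi`_0 = 0 ->
  exists q : {poly R}, (phi + c *: 'X^k) ^+ m = phi ^+ m + 'X^k * q /\
    q`_0 = c *+ (m == 1%N).
Proof.
move=> k0 phi0; elim: m => [|m [q [E q0]]].
  by exists 0; rewrite !expr0 mulr0 addr0 coef0.
exists (phi * q + c *: phi ^+ m + c *: ('X^k * q)); split.
  rewrite !exprS E -!mul_polyC; ring.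
rewrite !coefD !coefZ !coefM !big_ord1 subnn phi0 mul0r add0r coefXn.
rewrite (_ : (0%N == k) = false) ?mul0r ?mulr0 ?addr0; last by case: k k0 {E}.
case: m {E q0} => [|m]; first by rewrite expr0 coef1 eqxx mulr1.
by rewrite exprS coefM big_ord1 phi0 mul0r mulr0.
Qed.

Lemma scomp_perturb (g : ser U) (phi : {poly R}) c k : (0 < k)%N ->
  phi`_0 = 0 ->
  (forall l, (l < k)%N -> scomp g (phi + c *: 'X^k) l = scomp g phi l) /\
  scomp g (phi + c *: 'X^k) k = scomp g phi k + c *: g 1%N.
Proof.
move=> k0 phi0; split=> [l lk|].
  apply: eq_bigr => m _; have [q [-> _]] := exp_perturb c m k0 phi0.
  by rewrite coefD coefXnM lk addr0.
have k1 : (1 < k.+1)%N by [].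
rewrite /scomp (bigD1 (Ordinal k1)) //= [in RHS](bigD1 (Ordinal k1)) //=.
rewrite !expr1 coefD coefZ coefXn eqxx mulr1 scalerDl addrAC; congr (_ + _).
congr (_ + _); apply: eq_bigr => m m1.
have [q [-> q0]] := exp_perturb c m k0 phi0.
by rewrite coefD coefXnM ltnn subnn q0
  (_ : (m == 1%N :> nat) = false) ?addr0 //;
  apply/negbTE.
Qed.

(** All factors have constant term 1 and change only from degree [k] on. In degree [k] of a product
    the change of each factor thus meets only constant terms, and the changes add up whatever the
    order of the factors. *)
Lemma comp_prod_perturb s phi (c : I -> R) k : (0 < k)%N ->
  (forall i, (phi i)`_0 = 0) ->
  (forall l, (l < k)%N ->
    comp_prod s (fun i => phi i + c i *: 'X^k) l = comp_prod s phi l) /\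
  comp_prod s (fun i => phi i + c i *: 'X^k) k =
    comp_prod s phi k + \sum_(i <- s) c i *: h i 1%N.
Proof.
move=> k0 phi0; pose psi i := phi i + c i *: 'X^k.
have psi0 i : (psi i)`_0 = 0.
  by rewrite coefD phi0 add0r coefZ coefXn (ltn_eqF k0) mulr0.
elim: s => [|i s [IHl IHk]]; first by rewrite /comp_prod !big_nil addr0.
have [pl pk] := scomp_perturb (h i) (c i) k0 (phi0 i).
have Cs (f : I -> {poly R}) : (forall i, (f i)`_0 = 0) -> comp_prod s f 0%N = 1.
  by move=> f0; have [] := curve_comp_prod s f0.
have Ci (f : {poly R}) : f`_0 = 0 -> scomp (h i) f 0%N = 1.
  by move=> f0; have [] := curve_comp f0 (hc i).
have E f : comp_prod (i :: s) f = scomp (h i) (f i) * comp_prod s f.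
  by rewrite /comp_prod big_cons.
split=> [l lk|]; rewrite !E.
  rewrite !smulE; apply: eq_bigr => j _.
  by rewrite pl ?IHl // (leq_ltn_trans _ lk) // ?leq_subr // -ltnS.
rewrite !smulE big_cons; have Cpsi := Cs _ psi0; have Cphi := Cs _ phi0.
have Dpsi := Ci _ (psi0 i); have Dphi := Ci _ (phi0 i);
  rewrite {}/psi in psi0 Cpsi Dpsi.
case: k k0 IHl IHk pl pk psi0 Cpsi Dpsi => // k _ IHl IHk pl pk psi0 Cpsi Dpsi.
rewrite big_ord_recl big_ord_recr [in RHS]big_ord_recl [in RHS]big_ord_recr /=.
rewrite /bump !add1n subn0 subnn Cpsi Cphi Dpsi Dphi.
rewrite !mul1r !mulr1 IHk pk.
rewrite (eq_bigr (fun j : 'I_k => scomp (h i) (phi i) j.+1 *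
  comp_prod s phi (k.+1 - j.+1)%N)); last first.
  by move=> j _; have jk := ltn_ord j; rewrite pl ?IHl //; lia.
rewrite [in RHS](eq_bigr (fun j : 'I_k => scomp (h i) (phi i) j.+1 *
  comp_prod s phi (k.+1 - j.+1)%N)) //.
by rewrite -!addrA; congr (_ + _); rewrite addrC -!addrA.
Qed.

Lemma comp_prod_widen s s' phi : uniq s -> uniq s' -> sorted le s ->
  sorted le s' -> {subset s <= s'} ->
  comp_prod s' (fun i => if i \in s then phi i else 0) = comp_prod s phi.
Proof.
move=> us us' ss ss' sub.
have c0 i : scomp (h i) 0 = 1.
  apply/funext => n; rewrite /scomp soneE; case: n => [|n].
    by rewrite big_ord1 expr0 coef1 scale1r (hc i).2.
  rewrite big1 // => m _; rewrite expr0n; case: (m == 0%N :> nat) => /=.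
    by rewrite coef1 scale0r.
  by rewrite coef0 scale0r.
rewrite /comp_prod; transitivity
  (\prod_(i <- s' | i \in s) scomp (h i) (phi i)).
  by rewrite [RHS]big_mkcond; apply: eq_bigr => i _; case: ifP => // _;
    exact: c0.
rewrite -big_filter; congr (\prod_(i <- _) _).
apply: (sorted_eq le_trans le_anti) => //; first exact: sorted_filter.
apply: uniq_perm => //; first exact: filter_uniq.
by move=> i; rewrite mem_filter; case: (boolP (i \in s)) => //= /sub ->.
Qed.

Hypothesis hspan : forall g, curve g ->
  exists c : {malg R[I]}, g 1%N = lincomb (fun i => h i 1%N) c.

(** If the product [G] agrees with [g] up to degree [k], then the curve G^(-1) g starts in degree
    [k.+1] with the difference of the two coefficients there. This is the first coefficient of a
    curve, hence a combination of the [h i 1], and adding the corresponding multiples of X^(k+1) to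
    the [phi i] corrects [G]. Indices new to the list are given phi = 0 beforehand, which leaves [G]
    unchanged. *)
Lemma curve_peel (g : ser U) k : curve g -> exists s phi,
  [/\ uniq s, sorted le s, forall i, (phi i)`_0 = 0
    & forall l, (l <= k)%N -> comp_prod s phi l = g l].
Proof.
move=> gc; elim: k => [|k [s [phi [us ss phi0 E]]]].
  exists [::], (fun=> 0); split=> // [i|l]; first by rewrite coef0.
  by rewrite leqn0 => /eqP ->; rewrite /comp_prod big_nil gc.2.
have Gc := curve_comp_prod s phi0; set G := comp_prod s phi in E Gc.
have [v [vc vG]] := curve_inv Gc.
have rE l : (v * g) l = (l == 0%N)%:R +
  \sum_(j < l.+1) v j * (g (l - j)%N - G (l - j)%N).
  have -> : (l == 0%N)%:R = (v * G) l by rewrite vG.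
  by rewrite !smulE -big_split; apply: eq_bigr => j _;
    rewrite /= -mulrDr addrC subrK.
have rlow l : (0 < l < k.+1)%N -> (v * g) l = 0.
  move=> /andP[l0 lk]; rewrite rE gtn_eqF // add0r big1 // => j _.
  by rewrite E ?subrr ?mulr0 //; lia.
have rk : (v * g) k.+1 = g k.+1 - G k.+1.
  rewrite rE add0r big_ord_recl /= subn0 vc.2 mul1r big1 ?addr0 // => j _.
  by rewrite E ?subrr ?mulr0 // /bump /=; lia.
have [f [fc f1]] := leading_coef_lift (ltn0Sn k) (curve_mul vc gc) rlow.
have [c cE] := hspan fc.
pose s' := sort le (undup (s ++ (msupp c : seq I))).
have us' : uniq s' by rewrite sort_uniq undup_uniq.
have ss' : sorted le s' by exact: sort_sorted.
have sub : {subset s <= s'}.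
  by move=> i si; rewrite mem_sort mem_undup mem_cat si.
pose psi i := if i \in s then phi i else 0.
have psi0 i : (psi i)`_0 = 0 by rewrite /psi; case: ifP; rewrite ?coef0.
have [Pl Pk] := comp_prod_perturb s' (fun i => c@_i) (ltn0Sn k) psi0.
have EG : comp_prod s' psi = G by exact: comp_prod_widen.
exists s', (fun i => psi i + c@_i *: 'X^(k.+1)); split=> //.
  by move=> i; rewrite coefD psi0 coefZ coefXn mulr0 addr0.
move=> l; rewrite leq_eqVlt => /orP[/eqP ->|]; last first.
  by rewrite ltnS => lk; rewrite Pl // EG E.
rewrite Pk EG; have -> : \sum_(i <- s') c@_i *: h i 1%N = f 1%N.
  rewrite cE /lincomb (bigID (fun i => i \in msupp c)) /=
    [X in _ + X]big1 ?addr0.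
    rewrite -big_filter; apply: perm_big; apply: uniq_perm.
    - exact: filter_uniq.
    - exact: fset_uniq.
    - move=> i; rewrite mem_filter mem_sort mem_undup mem_cat.
      by rewrite orbC; case: (i \in msupp c).
  by move=> i ic; rewrite mcoeff_outdom // scale0r.
by rewrite f1 rk addrC subrK.
Qed.

Lemma curve_coef_span (g : ser U) k : curve g ->
  exists c, g k = lincomb (curve_prod le h) c.
Proof.
move=> gc; have [s [phi [us ss phi0 E]]] := curve_peel k gc.
rewrite -(E k) //; apply: (comp_prod_submod phi
  (W := fun x => exists c, x = lincomb (curve_prod le h) c)) => //.
  split; first by exists 0; rewrite linear0.
  move=> a x y [cx ->] [cy ->]; exists (a *: cx + cy); by rewrite linearP.
move=> a; pose al : multiset I := [fsfun i in seq_fset tt s => a i | 0%N].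
exists << al >>; rewrite lincombU.
have sa : {subset finsupp al <= s}.
  move=> i; rewrite mem_finsupp fsfun_fun seq_fsetE.
  by case: ifP => //; rewrite eqxx.
rewrite (curve_prodE le_anti le_trans le_total hc us ss sa).
rewrite big_seq [RHS]big_seq; apply: eq_bigr => i si.
by rewrite fsfun_fun seq_fsetE si.
Qed.

End Peel.

(** * Linear functionals into the fraction field *)

(** An alias of the fraction field that carries its structure of module over [R]. *)
Definition fracmod (R : idomainType) : Type := {fraction R}.

Section FractionModule.
Context (R : idomainType).

HB.instance Definition _ := GRing.Field.on (fracmod R).

Definition frac_scale (a : R) (x : fracmod R) : fracmod R := tofrac a * x.

Lemma frac_scaleA a b x :
  frac_scale a (frac_scale b x) = frac_scale (a * b) x.
Proof. by rewrite /frac_scale tofracM mulrA. Qed.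
Lemma frac_scale1 : left_id 1 frac_scale.
Proof. by move=> x; rewrite /frac_scale tofrac1 mul1r. Qed.
Lemma frac_scaleDr : right_distributive frac_scale +%R.
Proof. by move=> a x y; rewrite /frac_scale mulrDr. Qed.
Lemma frac_scaleDl x : {morph frac_scale^~ x : a b / a + b}.
Proof. by move=> a b; rewrite /frac_scale tofracD mulrDl. Qed.

HB.instance Definition _ := GRing.Zmodule_isLmodule.Build R (fracmod R)
  frac_scaleA frac_scale1 frac_scaleDr frac_scaleDl.

Lemma fracZ a (x : fracmod R) : a *: x = tofrac a * x. Proof. by []. Qed.

End FractionModule.

Lemma frac_linear_comb (F : fieldType) (a r r' c c' : F) :
  r != 0 -> r' != 0 ->
  (a * r' * c + r * c') / (r * r') = a * (c / r) + c' / r'.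
Proof. by move=> r0 r'0; field; rewrite r0 r'0. Qed.

Section DualFunctional.
Context (R : idomainType) (M : lmodType R) (T : choiceType).
Context (D : T -> Prop) (z : T -> M) (t : T).
Hypothesis Dt : D t.
Hypothesis indep : forall c : {malg R[T]},
  (forall s, s \in msupp c -> D s) -> lincomb z c = 0 -> c = 0.

Let subm (S : set M) := forall a x y, S x -> S y -> S (a *: x + y).
Let avoids (S : set M) := forall r, S (r *: z t) -> r = 0.
Let contains (S : set M) := S 0 /\ forall s, D s -> s <> t -> S (z s).

(* A submodule avoiding z t and maximal for that property has a quotient of
   rank one, generated up to torsion by z t. *)
Lemma max_avoiding : exists S : set M, [/\ subm S, avoids S, contains S
  & forall u, exists r c, r != 0 /\ S (r *: u - c *: z t)].
Proof.
pose good S := [/\ subm S, avoids S & contains S].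
pose P (S : set M) := S = set0 \/ good S.
have [F FP Ftot|A [PA Amax]] := @Zorn_bigcup M P.
  have [[X [FX gX]]|no] := pselect (exists X, F X /\ good X); last first.
    left; rewrite -subset0 => x [X FX Xx].
    have [X0|gX] := FP X FX; first by rewrite X0 in Xx.
    by case: no; exists X.
  right; split.
  - move=> a x y [Y FY Yx] [Y' FY' Yy].
    have sm V v : F V -> V v -> subm V.
      by move=> FV Vv; have [V0|[]//] := FP V FV; rewrite V0 in Vv.
    have [YY'|Y'Y] := Ftot Y Y' FY FY'.
      by exists Y' => //; apply: (sm Y' y) => //; exact: YY'.
    by exists Y => //; apply: (sm Y x) => //; exact: Y'Y.
  - move=> r [Y FY Yr]; have [Y0|[_ Ya _]] := FP Y FY; last exact: Ya.
    by rewrite Y0 in Yr.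
  - have [_ _ [X0 Xz]] := gX; split; first by exists X.
    by move=> s Ds st; exists X => //; exact: Xz.
(* The combinations of the other [z s] form a good submodule, so the maximal element is not the
   empty set. *)
pose S0 : set M := fun x => exists c : {malg R[T]},
  [/\ forall s, s \in msupp c -> D s, c@_t = 0 & x = lincomb z c].
have gS0 : good S0.
  split.
  - move=> a x y [c [cD c0 ->]] [c' [c'D c'0 ->]]; exists (a *: c + c'); split.
    + move=> s /(fsubsetP (msuppD_le _ _)); rewrite inE => /orP[|/c'D//].
      by move=> /(fsubsetP (msuppZ_le _ _)) /cD.
    + by rewrite mcoeffD mcoeffZ c0 c'0 mulr0 addr0.
    + by rewrite linearP.
  - move=> r [c [cD c0 rE]].
    have /(congr1 (mcoeff t)) : r *: << t >> - c = 0.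
      apply: indep; last by rewrite linearB linearZ /= lincombU rE subrr.
      move=> s /(fsubsetP (msuppB_le _ _)); rewrite inE => /orP[|/cD//].
      move=> /(fsubsetP (msuppZ_le _ _)) /(fsubsetP msuppU_le).
      by rewrite inE => /eqP ->.
    by rewrite mcoeffB mcoeffZ mcoeffUU c0 mulr1 subr0 mcoeff0.
  - split; first by exists 0; split; rewrite ?mcoeff0 ?linear0 // => s;
    rewrite msupp0.
    move=> s Ds st; exists << s >>; split.
    + by move=> s' /(fsubsetP msuppU_le); rewrite inE => /eqP ->.
    + by rewrite mcoeffU; case: eqP.
    + by rewrite lincombU.
have gA : good A.
  case: PA => // A0; case: (Amax S0); [|by right].
  split; first by rewrite A0.
  by have [_ _ [S00 _]] := gS0; move=> /(_ 0 S00); rewrite A0.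
have [Asub Aav [A0 Az]] := gA; exists A; split=> // u.
have [Au|nAu] := pselect (A u).
  by exists 1, 0; rewrite oner_neq0 scale1r scale0r subr0.
pose B : set M := fun x => exists a k, A a /\ x = a + k *: u.
have AB : A `<` B.
  split; first by move=> x Ax; exists x, 0; rewrite scale0r addr0.
  by move=> /(_ u) H; apply: nAu; apply: H; exists 0, 1; rewrite scale1r add0r.
have nav : ~ avoids B.
  move=> Bav; apply: (Amax B AB); right; split=> //.
    move=> a x y [x' [k [Ax ->]]] [y' [k' [Ay ->]]].
    exists (a *: x' + y'), (a * k + k'); split; first exact: Asub.
    by rewrite scalerDr scalerA scalerDl addrACA.
  split; first by exists 0, 0; rewrite scale0r addr0.
  by move=> s Ds st; exists (z s), 0; rewrite scale0r addr0; split=> //;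
    exact: Az.
have [r [[a [k [Aa rE]]] r0]] : exists r, B (r *: z t) /\ r <> 0.
  apply: contrapT => H; apply: nav => r Br; apply: contrapT => r0.
  by apply: H; exists r.
exists k, r; split.
  apply/eqP => k0; apply: r0; apply: Aav.
  by rewrite rE k0 scale0r addr0.
rewrite rE opprD addrCA subrr addr0 -scaleN1r -[_ *: a]addr0.
exact: Asub.
Qed.

(** With [S] from [max_avoiding], every [u] has a nonzero multiple r u congruent to some c z_t
    modulo [S], and [lam u] is c / r. Two such fractions are equal because [S] contains no nonzero
    multiple of [z t]. *)
Lemma dual_functional : exists lam : M -> fracmod R,
  linear lam /\ forall s, D s -> lam (z s) = (s == t)%:R.
Proof.
have [S [Ssub Sav [S0 Sz] rank1]] := max_avoiding.
have /choice[lam lamP] : forall u, exists x : fracmod R,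
    exists r c, [/\ r != 0, S (r *: u - c *: z t) & x = tofrac c / tofrac r].
  by move=> u; have [r [c [r0 H]]] := rank1 u;
    exists (tofrac c / tofrac r), r, c.
have SZ a x : S x -> S (a *: x).
  by move=> Sx; rewrite -[_ *: _]addr0; exact: Ssub.
have lamE u r c : r != 0 -> S (r *: u - c *: z t) ->
    lam u = tofrac c / tofrac r.
  move=> r0 H; have [r' [c' [r'0 H' ->]]] := lamP u.
  have E : r * c' = r' * c.
    apply/subr0_eq/Sav.
    have -> : (r * c' - r' * c) *: z t =
        (- r) *: (r' *: u - c' *: z t) + r' *: (r *: u - c *: z t).
      rewrite scalerBl !scalerBr !scalerA mulNr scaleNr mulNr scaleNr opprK.
      rewrite [r' * r]mulrC addrACA addNr add0r; congr (_ + _).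
    by apply: Ssub => //; exact: SZ.
  by apply/eqP; rewrite eqr_div ?tofrac_eq0 // -!tofracM mulrC E mulrC.
exists lam; split; last first.
  move=> s Ds; have [->|/eqP st] := eqVneq s t.
    rewrite (lamE _ 1 1) ?oner_neq0 //; last by rewrite subrr.
    by rewrite tofrac1 divr1.
  rewrite (lamE _ 1 0) ?oner_neq0 //; first by rewrite tofrac0 mul0r.
  by rewrite scale1r scale0r subr0; exact: Sz.
move=> a u v; have [r [c [r0 H ->]]] := lamP u;
  have [r' [c' [r'0 H' ->]]] := lamP v.
rewrite (lamE _ (r * r') (a * r' * c + r * c')) ?mulf_neq0 //.
  rewrite tofracD !tofracM (@frac_linear_comb {fraction R}) //.
    by rewrite tofrac_eq0.
  by rewrite tofrac_eq0.
have -> : (r * r') *: (a *: u + v) - (a * r' * c + r * c') *: z t =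
    (a * r') *: (r *: u - c *: z t) + r *: (r' *: v - c' *: z t).
  rewrite scalerDr scalerBr scalerDl scalerBr !scalerA opprD addrACA.
  by congr (_ *: _ - _ + _); ring.
by apply: Ssub => //; exact: SZ.
Qed.

End DualFunctional.

Lemma linear_fun0 (R : comNzRingType) (V W : lmodType R) (f : V -> W) :
  linear f -> f 0 = 0.
Proof.
move=> fl; have := fl (-1) 0 0; rewrite scaler0 addr0 => ->.
by rewrite scaleN1r addNr.
Qed.

(** * Linear independence of the ordered products *)

Section MultisetDegree.
Context (I : choiceType).
Implicit Types (a b : multiset I).

Lemma size_multisetE (s : seq I) a : uniq s -> {subset finsupp a <= s} ->
  size a = (\sum_(i <- s) a i)%N.
Proof.
move=> us sa; rewrite size_mset [RHS](bigID (fun i => i \in finsupp a)) /=.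
rewrite [X in (_ + X)%N]big1 ?addn0; last by move=> i /fsfun_dflt ->.
rewrite -[RHS]big_filter; apply: perm_big; apply: uniq_perm;
  rewrite ?fset_uniq //.
  exact: filter_uniq.
by move=> i; rewrite mem_filter; case: (boolP (i \in finsupp a)) => //= /sa ->.
Qed.

Lemma size_multisetD a b : size (a `+` b)%mset = (size a + size b)%N.
Proof.
pose s : seq I := undup ((finsupp a : seq I) ++ (finsupp b : seq I)).
have us : uniq s by exact: undup_uniq.
have sa : {subset finsupp a <= s}.
  by move=> i ia; rewrite mem_undup mem_cat; apply/orP; left.
have sb : {subset finsupp b <= s}.
  by move=> i ib; rewrite mem_undup mem_cat orbC; apply/orP; left.
have sab : {subset finsupp (a `+` b)%mset <= s}.
  move=> i; rewrite mem_finsupp msetDE => H.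
  have [ai|ai] := eqVneq (a i) 0%N; last by apply: sa; rewrite mem_finsupp.
  by apply: sb; rewrite mem_finsupp; rewrite ai in H.
rewrite (size_multisetE us sa) (size_multisetE us sb) (size_multisetE us sab).
by rewrite -big_split; apply: eq_bigr => i _; rewrite msetDE.
Qed.

Lemma msubset_addK a b : (b `<=` a)%mset -> (b `+` (a `\` b))%mset = a.
Proof.
by move=> /msubsetP ba; apply/msetP => i; rewrite msetDE msetBE subnKC.
Qed.

Lemma size_multisetB a b : (b `<=` a)%mset ->
  (size b + size (a `\` b)%mset)%N = size a.
Proof. by move=> ba; rewrite -size_multisetD msubset_addK. Qed.

Lemma size_mset1 (i : I) : size ([mset i]%mset : multiset I) = 1%N.
Proof.
rewrite (@size_multisetE [:: i]) ?big_seq1 ?msetnxx // => j.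
by rewrite mem_finsupp msetnE inE; case: (j == i).
Qed.

Lemma size1_mset a : size a = 1%N -> exists i, a = [mset i]%mset.
Proof.
move=> a1; have [i ia] : exists i, i \in finsupp a.
  apply: contrapT => H; have : a = mset0; last by move=> E;
    rewrite E size_mset0 in a1.
  apply/msetP => i; rewrite mset0E; apply: fsfun_dflt.
  by apply/negP => ia; apply: H; exists i.
have le1 : ([mset i] `<=` a)%mset.
  apply/msubsetP => j; rewrite msetnE; case: eqP => // ->.
  by move: ia; rewrite mem_finsupp lt0n.
exists i; have := size_multisetB le1; rewrite a1 size_mset1.
move=> /eqP; rewrite -[1%N]addn0 -addnA eqn_add2l add0n size_mset_eq0 => /eqP E.
by rewrite -[LHS](msubset_addK le1) E msetD0.
Qed.

End MultisetDegree.

Section Independence.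
Context (R : idomainType) (U : bialgType R) (I : choiceType).
Context (Z : multiset I -> U).
Hypothesis Z0 : Z mset0 = 1.
Hypothesis comulZ : forall a : multiset I, comul (Z a) =
  \sum_(b \in [set b : multiset I | (b `<=` a)%mset]) Z b ⊗ Z (a `\` b)%mset.
Hypothesis indep1 : forall c : {malg R[I]},
  lincomb (fun i => Z [mset i]%mset) c = 0 -> c = 0.
Implicit Types (a b : multiset I) (c : {malg R[multiset I]}).

Definition msub_seq a := msubs (finsupp a : seq I) a.

Lemma comulZ_seq a :
  comul (Z a) = \sum_(b <- msub_seq a) Z b ⊗ Z (a `\` b)%mset.
Proof. by rewrite comulZ (@sum_msubset _ _ (finsupp a : seq I)) ?fset_uniq. Qed.

Lemma mem_msub_seq a b : (b \in msub_seq a) = (b `<=` a)%mset.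
Proof.
apply/(mem_msubs _ _ (fset_uniq _))/idP => [H|/msubsetP H i].
  apply/msubsetP => i; have := H i; case: ifP => // _ /eqP ->; exact: leq0n.
have := H i; case: ifP => // /negbT ia.
by rewrite (fsfun_dflt ia) leqn0.
Qed.

Lemma primitive_Z1 i : comul (Z [mset i]%mset) =
  Z [mset i]%mset ⊗ 1 + 1 ⊗ Z [mset i]%mset.
Proof.
rewrite comulZ (@sum_msubset _ _ [:: i]) //; last first.
  by move=> j; rewrite mem_finsupp msetnE inE; case: (j == i).
rewrite msubsE (big_allpairs_dep (h := fun j b => (msetn j i `+` b)%mset)).
rewrite msetnxx /= !big_cons !big_nil !addr0 !msetD0 msetn0 Z0.
have -> : ([mset i] `\` mset0)%mset = [mset i]%mset :> multiset I.
  by apply/msetP => j; rewrite msetBE mset0E subn0.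
have -> : ([mset i] `\` [mset i])%mset = mset0 :> multiset I.
  by apply/msetP => j; rewrite msetBE mset0E subnn.
by rewrite Z0 addrC.
Qed.

Lemma counit_bilinear : bilinear_map (fun y z : U => counit y *: z).
Proof.
by split=> [y a x x'|x a y y'];
  rewrite /= ?linearP /= ?scalerDl ?scalerDr ?scalerA // mulrC.
Qed.

Lemma counit_Z1 i : counit (Z [mset i]%mset) = 0.
Proof.
have := counitl (Z [mset i]%mset); rewrite primitive_Z1.
have := tens_lift_linear counit_bilinear 1 (Z [mset i]%mset ⊗ 1)
  (1 ⊗ Z [mset i]%mset).
rewrite !scale1r => ->; rewrite !(tens_liftE counit_bilinear).
rewrite rmorph1 scale1r => /eqP; rewrite -subr_eq0 addrK => /eqP.
by move=> /(congr1 (@counit R U)); rewrite linearZ /= rmorph1 rmorph0 mulr1.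
Qed.

Lemma linear_apply_lincomb (V : lmodType R) (f : U -> V) c : linear f ->
  f (lincomb Z c) = \sum_(a <- msupp c) c@_a *: f (Z a).
Proof.
move=> fl; have f0 := linear_fun0 fl; rewrite /lincomb;
  elim/big_rec2: _ => [//|a x y _ <-].
by rewrite fl.
Qed.

Lemma linear_apply_comul (V : lmodType R) (f : U ⊗ U -> V) a : linear f ->
  f (comul (Z a)) = \sum_(b <- msub_seq a) f (Z b ⊗ Z (a `\` b)%mset).
Proof.
move=> fl; have f0 := linear_fun0 fl; rewrite comulZ_seq;
  elim/big_rec2: _ => [//|b x y _ <-].
by rewrite -{1}[_ ⊗ _]scale1r fl scale1r.
Qed.

Let indep_upto n := forall c, (forall a, a \in msupp c -> (size a < n)%N) ->
  lincomb Z c = 0 -> c = 0.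

Lemma indep_upto1 : indep_upto 1.
Proof.
move=> c cS c0; have E a : a \in msupp c -> a = mset0.
  by move=> /cS; rewrite ltnS leqn0 size_mset_eq0 => /eqP.
apply/malgP => a; rewrite mcoeff0; apply: mcoeff_outdom; apply/negP => ac.
have := c0; rewrite (@lincombEw _ _ _ _ [fset mset0]%fset); last first.
  by apply/fsubsetP => b /E ->; rewrite inE.
rewrite big_seq_fset1 Z0 => /(congr1 (@counit R U)).
rewrite linearZ /= rmorph1 rmorph0 mulr1 => /eqP.
by rewrite -(E a ac) mcoeff_eq0 ac.
Qed.

(** In degree one the hypothesis [indep1] provides dual forms. Composing them with u - counit(u) 1
    makes them vanish at [Z mset0 = 1] without changing their values on the primitive [Z
    [mset i]]. *)
Lemma indep_upto2 : indep_upto 2.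
Proof.
move=> c cS c0; apply: indep_upto1 => // a ac.
rewrite ltnS leqn0; apply/negPn/negP => an0.
have [i aE] : exists i, a = [mset i]%mset.
  by apply: size1_mset; have := cS a ac; lia.
have [lam [laml lamZ]] := @dual_functional R U I (fun=> True)
  (fun i => Z [mset i]%mset) i Logic.I (fun (c1 : {malg R[I]}) _ => @indep1 c1).
pose mu u := lam (u - counit u *: 1).
have mul : linear mu.
  move=> k u v; rewrite /mu -laml; congr lam.
  by rewrite linearP /= scalerDl scalerBr scalerA opprD addrACA.
have := linear_apply_lincomb c mul; rewrite c0 (linear_fun0 mul).
rewrite (bigD1_seq a) ?fset_uniq //= big_seq_cond big1 ?addr0; last first.
  move=> b /andP[bc ba]; have [b0|b1] := posnP (size (b : multiset I)).
    move/eqP: b0; rewrite size_mset_eq0 => /eqP ->.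
    by rewrite Z0 /mu rmorph1 scale1r subrr (linear_fun0 laml) scaler0.
  have [j bE] : exists j, b = [mset j]%mset.
    by apply: size1_mset; have := cS b bc; lia.
  rewrite bE /mu counit_Z1 scale0r subr0 lamZ //; case: eqP => [ji|].
    by rewrite bE ji aE eqxx in ba.
  by rewrite scaler0.
rewrite aE /mu counit_Z1 scale0r subr0 lamZ // eqxx fracZ mulr1 => /esym/eqP.
by rewrite tofrac_eq0 mcoeff_eq0 -aE ac.
Qed.

(** An index [a] of size [n] is written as a letter [e] plus [g], both of size below [n] and
    nonempty since n > 1. With forms dual to [Z e] and [Z g], their tensor product takes the
    coproduct of [Z b] to 1 if b = a and to 0 otherwise. The end terms [1 ⊗ Z b] and [Z b ⊗ 1],
    where the dual forms are not controlled on [Z b], drop out because both forms vanish at 1. *)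
Lemma indep_upto_step n : (1 < n)%N -> indep_upto n -> indep_upto n.+1.
Proof.
move=> n1 IH c cS c0; apply: (IH c) (c0) => a ac.
have := cS a ac; rewrite ltnS leq_eqVlt => /orP[/eqP an|//].
have [i ia] : exists i, i \in finsupp a.
  apply: contrapT => H; have a0 : a = mset0.
    apply/msetP => i; rewrite mset0E; apply: fsfun_dflt.
    by apply/negP => ia; apply: H; exists i.
  by move: n1; rewrite -an a0 size_mset0.
pose e : multiset I := [mset i]%mset; pose g := (a `\` e)%mset.
have ea : (e `<=` a)%mset.
  apply/msubsetP => j; rewrite msetnE; case: eqP => // ->.
  by move: ia; rewrite mem_finsupp lt0n.
have sg : (size g).+1 = n.
  by have := size_multisetB ea; rewrite size_mset1 add1n an.
pose D (b : multiset I) := (size b < n)%N : Prop.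
have De : D e by rewrite /D size_mset1.
have Dg : D g by rewrite /D -sg.
have [lam [laml lamZ]] := dual_functional De IH.
have [mu [mul muZ]] := dual_functional Dg IH.
have lam0 : lam 1 = 0.
  rewrite -Z0 lamZ /D ?size_mset0 //; last by lia.
  by case: eqP => // E; have := size_mset1 i; rewrite -/e -E size_mset0.
have mu0 : mu 1 = 0.
  rewrite -Z0 muZ /D ?size_mset0 //; last by lia.
  by case: eqP => // E; move: sg n1; rewrite -E size_mset0 => <-.
pose f (x y : U) : fracmod R := lam x * mu y.
have fb : bilinear_map f.
  split=> [y k x x'|x k y y']; rewrite /f /= ?laml ?mul !fracZ.
    by rewrite mulrDl mulrA.
  by rewrite mulrDr mulrCA.
pose fl := tens_lift f.
have fll : linear fl by exact: tens_lift_linear.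
have fE b b' : fl (Z b ⊗ Z b') = lam (Z b) * mu (Z b') by exact: tens_liftE.
have fcl : linear (fun x => fl (comul x)).
  by move=> k x y; rewrite linearP fll.
have := linear_apply_lincomb c fcl; rewrite c0 (linear_fun0 fcl).
have fa b : b \in msupp c -> fl (comul (Z b)) = (b == a)%:R.
  move=> bc; rewrite (linear_apply_comul _ fll).
  have term (x : multiset I) : x \in msub_seq b -> fl (Z x ⊗ Z (b `\` x)%mset) =
      ((x == e) && ((b `\` x)%mset == g))%:R.
    rewrite mem_msub_seq => xb; rewrite fE.
    have sx := size_multisetB xb; have sb := cS b bc.
    have [x0|xn0] := posnP (size x).
      move/eqP: x0; rewrite size_mset_eq0 => /eqP ->; rewrite Z0 lam0 mul0r.
      by case: eqP => // E; have := size_mset1 i; rewrite -/e -E size_mset0.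
    have [y0|yn0] := posnP (size (b `\` x)%mset).
      move/eqP: y0; rewrite size_mset_eq0 => /eqP ->; rewrite Z0 mu0 mulr0.
      rewrite [_ == g]eq_sym -size_mset_eq0
        (_ : (size g == 0%N) = false) ?andbF //.
      by apply/negbTE; rewrite -lt0n; lia.
    rewrite lamZ ?muZ /D; try lia.
    by case: eqP; case: eqP; rewrite ?mulr0 ?mul0r ?mulr1.
  rewrite big_seq (eq_bigr _ term) -big_seq.
  have um : uniq (msub_seq b) by apply: msubs_uniq; exact: fset_uniq.
  have [bE|ba] := eqVneq b a; first rewrite bE in um *.
    rewrite (bigD1_seq e) ?mem_msub_seq //= !eqxx /= big1 ?addr0 //.
    by move=> x /negbTE ->.
  rewrite big_seq big1 // => x; rewrite mem_msub_seq => xb.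
  case: eqP => //= xe; case: eqP => //= bg; case/eqP: ba.
  by rewrite -(msubset_addK xb) bg xe msubset_addK.
rewrite big_seq (eq_bigr (fun b => c@_b *: ((b == a)%:R : fracmod R)));
  last first.
  by move=> b /fa ->.
rewrite -big_seq (bigD1_seq a) ?fset_uniq //= eqxx big1 ?addr0; last first.
  by move=> b /negbTE ->; rewrite scaler0.
rewrite fracZ mulr1 => /esym/eqP.
by rewrite tofrac_eq0 mcoeff_eq0 ac.
Qed.

Lemma structural_indep c : lincomb Z c = 0 -> c = 0.
Proof.
pose sz (a : multiset I) := size a.
(* Two is added to the largest size because the induction starts from [indep_upto 2]. *)
pose n := (\max_(a <- (msupp c : seq (multiset I))) sz a).+2.
have H : indep_upto n.
  rewrite /n; elim: (\max_(a <- _) sz a)%N => [|k IH]; first exact: indep_upto2.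
  exact: indep_upto_step.
apply: H => a ac; rewrite /n ltnS; apply: leqW; rewrite -/(sz a).
by rewrite (big_rem a ac) leq_maxl.
Qed.

End Independence.

(** * Convolution and the antipode *)

Section Bilinear.
Context (R : comNzRingType).

Lemma bilinear_mul (M N : lmodType R) (U : algType R)
  (f : M -> U) (g : N -> U) :
  linear f -> linear g -> bilinear_map (fun x y => f x * g y).
Proof.
move=> fl gl; split=> [y k x x'|x k y y'] /=.
  by rewrite fl mulrDl scalerAl.
by rewrite gl mulrDr scalerAr.
Qed.

Lemma bilinear_tens (M N M' N' : lmodType R) (f : M -> M') (g : N -> N') :
  linear f -> linear g -> bilinear_map (fun x y => f x ⊗ g y).
Proof.
move=> fl gl; split=> [y k x x'|x k y y'] /=.
  by rewrite fl tensDl tensZl.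
by rewrite gl tensDr tensZr.
Qed.

Lemma id_is_linear (M : lmodType R) : linear (@id M). Proof. by []. Qed.

Lemma linear_funZ (M N : lmodType R) (f : M -> N) (k : R) x :
  linear f -> f (k *: x) = k *: f x.
Proof. by move=> fl; have := fl k x 0; rewrite (linear_fun0 fl) !addr0. Qed.

Lemma linear_comb (M N : lmodType R) (k : R) (f g : M -> N) :
  linear f -> linear g -> linear (fun x => k *: f x + g x).
Proof.
move=> fl gl a x y; rewrite fl gl !scalerDr !scalerA [k * a]mulrC.
by rewrite addrACA.
Qed.

Lemma assoc_inner (M N P : lmodType R) (z : P) :
  bilinear_map (fun (x : M) (y : N) => x ⊗ (y ⊗ z)).
Proof.
split=> [y k x x'|x k y y'] /=; first by rewrite tensDl tensZl.
by rewrite tensDl tensZl tensDr tensZr.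
Qed.

Lemma assoc_outer (M N P : lmodType R) : bilinear_map
  (fun (t : M ⊗ N) (z : P) => tens_lift (fun x y => x ⊗ (y ⊗ z)) t).
Proof.
split=> [z|t k z z']; first exact: tens_lift_linear (assoc_inner _ _ z).
move: t; apply: tens_ext.
- exact: tens_lift_linear (assoc_inner _ _ _).
- by apply: linear_comb; exact: tens_lift_linear (assoc_inner _ _ _).
- move=> x y; rewrite !(tens_liftE (assoc_inner _ _ _)).
  by rewrite tensDr tensZr tensDr tensZr.
Qed.

Lemma tens_assoc_linear (M N P : lmodType R) : linear (@tens_assoc R M N P).
Proof. exact: tens_lift_linear (assoc_outer M N P). Qed.

Lemma tens_assocE (M N P : lmodType R) (x : M) (y : N) (z : P) :
  tens_assoc ((x ⊗ y) ⊗ z) = x ⊗ (y ⊗ z).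
Proof.
by rewrite /tens_assoc (tens_liftE (assoc_outer M N P))
  (tens_liftE (assoc_inner M N z)).
Qed.

End Bilinear.

Section Convolution.
Context (R : comNzRingType) (U : bialgType R).
Implicit Types (f g h : U -> U).

Definition conv f g (x : U) : U := tens_lift (fun y z => f y * g z) (comul x).
Definition conv_unit (x : U) : U := (counit x)%:A.

Lemma comul_lin : linear (@comul R U). Proof. exact: linearP. Qed.

Lemma conv_unit_linear : linear conv_unit.
Proof. by move=> k x y; rewrite /conv_unit linearP /= scalerDl scalerA. Qed.

Lemma conv_linear f g : linear f -> linear g -> linear (conv f g).
Proof.
move=> fl gl; apply: (comp_linear (f := tens_lift (fun y z => f y * g z))).
  by apply: tens_lift_linear; exact: bilinear_mul.
exact: comul_lin.
Qed.

Lemma conv_unitl f : linear f -> conv conv_unit f =1 f.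
Proof.
move=> fl x; have cb : bilinear_map (fun y z : U => counit y *: z).
  by split=> [y a z z'|z a y y']; rewrite /= ?linearP /= ?scalerDl ?scalerDr
    ?scalerA // mulrC.
rewrite -[in RHS](counitl x) /conv; move: (comul x); apply: tens_ext.
- by apply: tens_lift_linear; apply: bilinear_mul => //;
  exact: conv_unit_linear.
- by apply: comp_linear => //; exact: tens_lift_linear cb.
- move=> y z; rewrite (tens_liftE cb).
  rewrite (tens_liftE (bilinear_mul conv_unit_linear fl)) /conv_unit.
  by rewrite -scalerAl mul1r /= (linear_funZ _ _ fl).
Qed.

Lemma conv_unitr f : linear f -> conv f conv_unit =1 f.
Proof.
move=> fl x; have cb : bilinear_map (fun y z : U => counit z *: y).
  by split=> [y a z z'|z a y y']; rewrite /= ?linearP /= ?scalerDl ?scalerDr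
    ?scalerA // mulrC.
rewrite -[in RHS](counitr x) /conv; move: (comul x); apply: tens_ext.
- by apply: tens_lift_linear; apply: bilinear_mul => //;
  exact: conv_unit_linear.
- by apply: comp_linear => //; exact: tens_lift_linear cb.
- move=> y z; rewrite (tens_liftE cb).
  rewrite (tens_liftE (bilinear_mul fl conv_unit_linear)) /conv_unit.
  by rewrite -scalerAr mulr1 /= (linear_funZ _ _ fl).
Qed.

(** Each side is a linear map on one bracketing of the triple tensor product, applied to an iterated
    coproduct. Coassociativity identifies the arguments, and on pure tensors the maps agree by
    associativity in [U]. *)
Lemma convA f g h : linear f -> linear g -> linear h ->
  conv f (conv g h) =1 conv (conv f g) h.
Proof.
move=> fl gl hl x.
have bfg := bilinear_mul fl gl; have bgh := bilinear_mul gl hl.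
have lfg := tens_lift_linear bfg; have lgh := tens_lift_linear bgh.
have bphi := bilinear_mul fl lgh; have bpsi := bilinear_mul lfg hl.
have lphi := tens_lift_linear bphi; have lpsi := tens_lift_linear bpsi.
set phi := tens_lift _ in lphi; set psi := tens_lift _ in lpsi.
have bm1 := bilinear_tens comul_lin (@id_is_linear R U).
have bm2 := bilinear_tens (@id_is_linear R U) comul_lin.
have -> : conv f (conv g h) x = phi (tens_map id (@comul R U) (comul x)).
  rewrite {1}/conv; move: (comul x); apply: tens_ext.
  - by apply: tens_lift_linear; apply: bilinear_mul => //; exact: conv_linear.
  - by apply: comp_linear => //; exact: tens_lift_linear bm2.
  - move=> y z; rewrite (tens_liftE (bilinear_mul fl (conv_linear gl hl))).
    by rewrite /tens_map (tens_liftE bm2) /phi (tens_liftE bphi).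
have -> : conv (conv f g) h x = psi (tens_map (@comul R U) id (comul x)).
  rewrite {1}/conv; move: (comul x); apply: tens_ext.
  - by apply: tens_lift_linear; apply: bilinear_mul => //; exact: conv_linear.
  - by apply: comp_linear => //; exact: tens_lift_linear bm1.
  - move=> y z; rewrite (tens_liftE (bilinear_mul (conv_linear fl gl) hl)).
    by rewrite /tens_map (tens_liftE bm1) /psi (tens_liftE bpsi).
rewrite -comulA; move: (tens_map _ _ _) => t.
suff E : (fun t => phi (tens_assoc t)) =1 psi by exact: E.
apply: tens_ext => //.
  by apply: comp_linear => //; exact: tens_assoc_linear.
move=> s z; move: s; apply: tens_ext => [||y w].
- apply: (comp_linear (f := fun t => phi (tens_assoc t))); last first.
    exact: (tens_bilinear _ _).1 z.
  by apply: comp_linear => //; exact: tens_assoc_linear.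
- by apply: comp_linear => //; exact: (tens_bilinear _ _).1 z.
- rewrite tens_assocE /phi /psi (tens_liftE bphi) (tens_liftE bpsi).
  by rewrite (tens_liftE bgh) (tens_liftE bfg) mulrA.
Qed.

End Convolution.

Section Antipode.
Context (R : idomainType) (U : bialgType R) (I : choiceType).
Context (Z : multiset I -> U).
Hypothesis Z0 : Z mset0 = 1.
Hypothesis comulZ : forall a : multiset I, comul (Z a) =
  \sum_(b \in [set b : multiset I | (b `<=` a)%mset]) Z b ⊗ Z (a `\` b)%mset.
Hypothesis spanZ :
  forall x : U, exists c : {malg R[multiset I]}, x = lincomb Z c.
Hypothesis indepZ : forall c : {malg R[multiset I]}, lincomb Z c = 0 -> c = 0.
Implicit Types (a b : multiset I).

Lemma msubset_refl a : (a `<=` a)%mset.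
Proof. exact/msubsetP. Qed.

Lemma msetBB a : (a `\` a)%mset = mset0.
Proof. by apply/msetP => i; rewrite msetBE mset0E subnn. Qed.

Lemma size_msub_lt a b : (b `<=` a)%mset -> b != a -> (size b < size a)%N.
Proof.
move=> ba nba; rewrite -(size_multisetB ba) -[X in (X < _)%N]addn0 ltn_add2l.
rewrite lt0n size_mset_eq0; apply: contra nba => /eqP E.
by rewrite -(msubset_addK ba) E msetD0.
Qed.

(** Apply the counit to the left counit identity at [Z a]. By induction on the size only the terms b
    = 0 and b = a remain for nonzero [a], so twice the value equals the value. *)
Lemma counit_Z a : counit (Z a) = (a == mset0)%:R.
Proof.
have [n] := ubnP (size a); elim: n a => // n IH a an.
have [->|a0] := eqVneq a mset0; first by rewrite Z0 rmorph1.
have cb := counit_bilinear U.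
have := congr1 (@counit R U) (counitl (Z a)).
rewrite (linear_apply_comul comulZ _ (tens_lift_linear cb)) rmorph_sum /=.
under eq_bigr => b _ do rewrite (tens_liftE cb) linearZ /=.
have ma : a \in msub_seq a by rewrite mem_msub_seq msubset_refl.
have m0 : mset0 \in msub_seq a.
  by rewrite mem_msub_seq; apply/msubsetP => i; rewrite mset0E.
have um : uniq (msub_seq a) by apply: msubs_uniq; exact: fset_uniq.
rewrite (bigD1_seq a) //= -big_filter (bigD1_seq mset0) ?filter_uniq //=;
  last first.
  by rewrite mem_filter eq_sym a0.
rewrite big_filter_cond big_seq_cond big1 ?addr0; last first.
  move=> b /andP[]; rewrite mem_msub_seq => ba /andP[nba b0].
  rewrite IH ?(negbTE b0) ?mul0r // (leq_trans (size_msub_lt ba nba)) //.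
have -> : (a `\` mset0)%mset = a by apply/msetP => i;
  rewrite msetBE mset0E subn0.
rewrite msetBB Z0 rmorph1 mulr1 mul1r => /eqP.
by rewrite -subr_eq0 addrK => /eqP.
Qed.

Section LeftInverse.
Context (f : U -> U).
Hypothesis fl : linear f.
Hypothesis f1 : f 1 = 1.

(** The equation for a left convolution inverse at [Z a], solved for its value there, which occurs
    with the factor f(1) = 1. The argument [n] is fuel, sufficient once it exceeds [size a]. *)
Fixpoint left_inv n a : U :=
  if n is n'.+1 then (a == mset0)%:R -
    \sum_(b <- msub_seq a | b != a) left_inv n' b * f (Z (a `\` b)%mset)
  else 0.

Lemma left_invS n a : left_inv n.+1 a = (a == mset0)%:R -
  \sum_(b <- msub_seq a | b != a) left_inv n b * f (Z (a `\` b)%mset).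
Proof. by []. Qed.

Lemma left_inv_stable n n' a : (size a < n)%N -> (size a < n')%N ->
  left_inv n a = left_inv n' a.
Proof.
elim: n n' a => [//|n IH] [//|n'] a an an'; rewrite !left_invS; congr (_ - _).
rewrite big_seq_cond [RHS]big_seq_cond; apply: eq_bigr => b.
rewrite mem_msub_seq => /andP[ba nba]; congr (_ * _); apply: IH.
  exact: leq_trans (size_msub_lt ba nba) _.
exact: leq_trans (size_msub_lt ba nba) _.
Qed.

Lemma left_inv_exists : exists gZ : multiset I -> U, forall a,
  \sum_(b <- msub_seq a) gZ b * f (Z (a `\` b)%mset) = (a == mset0)%:R.
Proof.
exists (fun a => left_inv (size a).+1 a) => a.
have um : uniq (msub_seq a) by apply: msubs_uniq; exact: fset_uniq.
rewrite (bigD1_seq a) ?mem_msub_seq ?msubset_refl //.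
rewrite msetBB Z0 f1 mulr1 left_invS -[RHS](subrK (\sum_(b <- msub_seq a | b !=
  a)
  left_inv (size a) b * f (Z (a `\` b)%mset))); congr (_ + _).
rewrite big_seq_cond [RHS]big_seq_cond; apply: eq_bigr => b.
rewrite mem_msub_seq => /andP[ba nba]; congr (_ * _).
apply: left_inv_stable => //; exact: size_msub_lt.
Qed.

Lemma conv_left_inverse : exists g, linear g /\ conv g f =1 @conv_unit R U.
Proof.
have [gZ gZP] := left_inv_exists; have /choice[co coP] := spanZ.
have coE c : co (lincomb Z c) = c.
  by apply/subr0_eq/indepZ; rewrite linearB /= -coP subrr.
have col : linear co.
  move=> k x y; rewrite [x in LHS]coP [y in LHS]coP -linearP coE.
  by [].
pose g x := lincomb gZ (co x).
have gl : linear g by move=> k x y; rewrite /g col linearP.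
exists g; split=> // x; rewrite (coP x); move: (co x) => c.
rewrite (linear_apply_lincomb Z c (conv_linear gl fl)).
rewrite (linear_apply_lincomb Z c (@conv_unit_linear R U)).
apply: eq_bigr => a _; congr (_ *: _).
rewrite /conv (linear_apply_comul comulZ _ (tens_lift_linear (bilinear_mul gl
  fl))).
under eq_bigr => b _ do rewrite (tens_liftE (bilinear_mul gl fl)).
rewrite /conv_unit counit_Z; transitivity ((a == mset0)%:R : U); last first.
  by case: eqP; rewrite ?scale1r ?scale0r.
rewrite -gZP; apply: eq_bigr => b _; congr (_ * _).
by rewrite /g -(lincombU Z b) coE lincombU.
Qed.

End LeftInverse.

(** A left inverse S of the identity fixes 1, so it has a left inverse T in turn. Associativity
    gives T = T conv (S conv id) = (T conv S) conv id = id, and S is also a right inverse. *)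
Lemma structural_Hopf : is_Hopf_algebra U.
Proof.
have idl : linear (@id U) by [].
have [S [Sl SP]] := conv_left_inverse idl (erefl _).
have S1 : S 1 = 1.
  have := SP 1; rewrite /conv /conv_unit !rmorph1 scale1r.
  by rewrite -[1]/(1 ⊗ 1) (tens_liftE (bilinear_mul Sl idl)) mulr1.
have [T [Tl TP]] := conv_left_inverse Sl S1.
have TE : T =1 id.
  move=> x; rewrite -(conv_unitr Tl) /conv.
  have -> : tens_lift (fun y z : U => T y * conv_unit z) (comul x) =
      conv T (conv S id) x.
    by rewrite /conv; congr (tens_lift _ _); apply/funext => y;
      apply/funext => z;
      rewrite -SP.
  rewrite (convA Tl Sl idl) -[RHS](conv_unitl idl) /conv.
  by congr (tens_lift _ _); apply/funext => y; apply/funext => z; rewrite -TP.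
exists S; split; [exact: Sl | exact: SP | move=> x].
by rewrite -[RHS]TP /conv; congr (tens_lift _ _); apply/funext => y;
  apply/funext => z; rewrite TE.
Qed.

End Antipode.

(** * First coefficients of curves, and assembly of the structural basis *)

Section Liftable.
Context (R : comNzRingType) (U : bialgType R).

Definition liftable : set U := [set u | exists g, curve g /\ g 1%N = u].

Lemma liftable_primitive u : liftable u -> primitive u.
Proof.
move=> [g [[gg g0] <-]]; rewrite /primitive /= gg big_ord_recl big_ord1 /=.
by rewrite g0 addrC.
Qed.

Lemma liftable0 : liftable 0.
Proof. by exists 1; split; [exact: curve1 | rewrite soneE]. Qed.

(** The curve g(a x) h(x) has first coefficient a g_1 + h_1. *)
Lemma liftableP a u v : liftable u -> liftable v -> liftable (a *: u + v).
Proof.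
move=> [g [gc <-]] [h [hc <-]]; have aX : (a *: 'X : {poly R})`_0 = 0.
  by rewrite coefZ coefX mulr0.
exists (scomp g (a *: 'X) * h); split;
  first exact: curve_mul (curve_comp aX gc) hc.
rewrite smulE big_ord_recl big_ord1 /= (curve_comp aX gc).2 mul1r hc.2 mulr1.
rewrite /scomp big_ord_recl big_ord1 /= expr0 coef1 scale0r add0r expr1 coefZ.
by rewrite coefX mulr1 addrC.
Qed.

End Liftable.

Theorem theorem2p15 (R : idomainType) (U : bialgType R) :
  principal_ideal_domain R ->
  torsion_free U ->
  free_submodule (@primitive R U) ->
  (exists G : set (nat -> U),
      (forall a, G a -> group_like a /\ a 0%N = 1) /\
      generates [set u | exists a, G a /\ exists i, u = a i]) ->
  is_Hopf_algebra U /\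
  exists (I : choiceType) (Z : multiset I -> U), structural_basis Z.
Proof.
move=> pid _ Pfree [G [Gc Ggen]].
have [I [b [bL bb]]] := pid_submodule_free pid Pfree (@liftable_primitive R U)
  (liftable0 U) (@liftableP R U).
have /choice[h hP] : forall i, exists g, curve g /\ g 1%N = b i := bL.
have hc i : curve (h i) by have [] := hP i.
have [le le_wo] := well_ordering_principle I.
have [_ anti trans tot] := well_order_total le_wo.
pose Z := curve_prod le h.
have Z0 : Z mset0 = 1 := curve_prod0 anti trans tot hc.
have comulZ := comul_curve_prod anti trans tot hc.
have spanZ x : exists c : {malg R[multiset I]}, x = lincomb Z c.
  have GC u : [set u | exists a, G a /\ exists i, u = a i] u ->
      exists g i, curve g /\ u = g i.
    by move=> [a [Ga [i ->]]]; exists a, i; split=> //; exact: Gc.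
  apply: (@generates_curve_span _ _ _ Ggen GC x
    (fun x => exists c, x = lincomb Z c)) => [|g i gc].
    split; first by exists 0; rewrite linear0.
    by move=> a u v [c ->] [c' ->]; exists (a *: c + c'); rewrite linearP.
  apply: (curve_coef_span anti trans tot hc _ _ gc) => f fc.
  have [c [fE _]] := bb (f 1%N) (ex_intro _ f (conj fc erefl)).
  exists c; rewrite fE; congr (lincomb _ c); apply/funext => j.
  by have [_ ->] := hP j.
(* On one-letter multisets [Z] is the basis [b] of the first coefficients, so degree one is settled
   by freeness. *)
have indep1 (c : {malg R[I]}) :
    lincomb (fun i => Z [mset i]%mset) c = 0 -> c = 0.
  have -> : (fun i => Z [mset i]%mset) = b.
    apply/funext => i; have [_ <-] := hP i.
    by rewrite /Z (curve_prod1 anti trans tot hc).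
  move=> c0; have [c1 [_ u]] := bb 0 (liftable0 U).
  by rewrite -(u c) ?(u 0) ?linear0.
have indepZ := structural_indep Z0 comulZ indep1.
split; first exact: structural_Hopf Z0 comulZ spanZ indepZ.
exists I, Z; split=> //; apply: lincomb_inj_basis => // x _; exact: spanZ.
Qed.
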